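(* Let $d\ge1$ be an integer. There is a sequence $Q_n\in\mathcal C_2^\eta$ such that $Q_n\to Z_d$ in distribution, $\mathcal J_4(Q_n)\to0$, and $\mathbb E[Q_n^r]\to\mathbb E[Z_d^r]$ for every integer $r\ge1$.
   Context: $\eta$ is a Poisson random measure on an atomless $\sigma$-finite measure space $(\mathcal Z,\mathscr Z,\mu)$ of infinite total mass, with control (intensity) measure $\mu$; $\widehat\eta=\eta-\mu$. $L^2_s(\mu^2)$ is the space of symmetric real kernels in $L^2(\mathcal Z^2,\mu^2)$, $I_2^\eta(f)$ is the double Wiener–Itô integral of $f\in L_s^2(\mu^2)$ with respect to $\widehat\eta$ (normalized by $\mathbb E[I_2^\eta(f)^2]=2\|f\|^2_{L^2(\mu^2)}$), and $\mathcal C_2^\eta=\{I_2^\eta(f):f\in L^2_s(\mu^2)\}$. The add-one derivative is $D_zF=F(\eta+\delta_z)-F(\eta)$, and for $F\in L^4$, $\mathcal J_4(F)=\int_{\mathcal Z}\mathbb E[|D_zF|^4]\,\mu(dz)$. $Z_d=2X_{d/2,1}-d$, where $X_{d/2,1}$ is Gamma distributed with shape $d/2$ and rate $1$. *)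

(* Defs.v *)
From HB Require Import structures.
From mathcomp Require Import all_boot all_order all_algebra.
From mathcomp Require Import all_classical all_reals all_analysis.
From mathcomp Require Import measurable_realfun.
Import Order.TTheory GRing.Theory Num.Theory.
Import numFieldNormedType.Exports.

Set Implicit Arguments.
Unset Strict Implicit.
Unset Printing Implicit Defensive.

Local Open Scope classical_set_scope.
Local Open Scope ring_scope.
Local Open Scope ereal_scope.

Definition atomless d (T : measurableType d) (R : realType)
    (mu : {measure set T -> \bar R}) : Prop :=
  forall A, measurable A -> 0 < mu A ->
    exists B, [/\ measurable B, B `<=` A, 0 < mu B & mu B < mu A].

Section point_measures.
Context d (T : measurableType d) (R : realType).

Record point_measure := PointMeasure {
  pm_measure :> {measure set T -> \bar R};
  pm_sigma_finite : sigma_finite setT pm_measure;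
  pm_natural : forall A, measurable A ->
    pm_measure A = +oo \/ exists k : nat, pm_measure A = k%:R%:E
}.

Lemma mzero_sigma_finite : sigma_finite setT (@mzero _ T R).
Proof.
exists (fun=> setT); first by rewrite bigcup_const//; exists 0%N.
by move=> _; split => //; rewrite /mzero ltry.
Qed.

Lemma mzero_natural (A : set T) : measurable A ->
  @mzero _ T R A = +oo \/ exists k : nat, @mzero _ T R A = k%:R%:E.
Proof. by move=> _; right; exists 0%N. Qed.

HB.instance Definition _ := gen_eqMixin point_measure.
HB.instance Definition _ := gen_choiceMixin point_measure.
HB.instance Definition _ := isPointed.Build point_measure
  (PointMeasure mzero_sigma_finite mzero_natural).

Definition evaluation_sets : set (set point_measure) :=
  \bigcup_(A in measurable)
    preimage_set_system [set: point_measure]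
      (fun chi => pm_measure chi A) measurable.

Definition point_measure_space : measurableType evaluation_sets.-sigma :=
  g_sigma_algebraType evaluation_sets.

Section add_point.
Variables (chi : point_measure) (z : T).

Let chiz := measure_add chi (dirac z : {measure set T -> \bar R}).

Lemma add_point_sigma_finite : sigma_finite setT chiz.
Proof.
have [F FT Ffin] := pm_sigma_finite chi.
exists F => // i; have [mF Foo] := Ffin i; split=> //.
rewrite /chiz measure_addE lte_add_pinfty//= diracE.
by rewrite ltry.
Qed.

Lemma add_point_natural A : measurable A ->
  chiz A = +oo \/ exists k : nat, chiz A = k%:R%:E.
Proof.
move=> mA; rewrite /chiz measure_addE /= diracE.
have [->|[k ->]] := pm_natural chi mA; first by left.
by right; exists (k + (z \in A))%N; rewrite natrD EFinD.
Qed.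

Definition add_point : point_measure :=
  PointMeasure add_point_sigma_finite add_point_natural.

End add_point.

Definition add_one_cost (F : point_measure -> R) (z : T)
    (chi : point_measure) : R :=
  (F (add_point chi z) - F chi)%R.

End point_measures.

Arguments point_measure {d} T R.
Arguments point_measure_space {d} T R.

Section poisson_functionals.
Context d dO (T : measurableType d) (O : measurableType dO) (R : realType).
Variables (P : probability O R) (mu : {sigma_finite_measure set T -> \bar R}).

(* The second argument of [poisson_prob] is a dummy of the library; for rate 0
   the law is the Dirac mass at 0. *)
Definition poisson_random_measure (eta : O -> point_measure T R) : Prop :=
  [/\ forall A, measurable A -> mu A < +oo -> forall k : nat,
        P [set w | eta w A = k%:R%:E] = poisson_prob (fine (mu A)) 0 [set k],
      forall A, measurable A -> mu A = +oo ->
        P [set w | eta w A = +oo] = 1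
    & forall (m : nat) (A : 'I_m -> set T), (forall i, measurable (A i)) ->
        trivIset setT A ->
        forall B : 'I_m -> set (\bar R), (forall i, measurable (B i)) ->
        P (\bigcap_(i in [set: 'I_m]) [set w | B i (eta w (A i))])
        = \prod_(i < m) P [set w | B i (eta w (A i))] ].

(* Meaningful only on sets of finite mu-measure. *)
Definition compensated (chi : point_measure T R) (A : set T) : R :=
  (fine (chi A) - fine (mu A))%R.

Record off_diagonal_kernel := OffDiagonalKernel {
  odk_size : nat;
  odk_set : 'I_odk_size -> set T;
  odk_coef : 'I_odk_size -> 'I_odk_size -> R;
  odk_measurable : forall i, measurable (odk_set i);
  odk_finite : forall i, mu (odk_set i) < +oo;
  odk_disjoint : trivIset setT odk_set;
  odk_sym : forall i j, odk_coef i j = odk_coef j i;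
  odk_diag : forall i, odk_coef i i = 0%R
}.

Definition odk_fun (e : off_diagonal_kernel) (x : T * T) : R :=
  (\sum_(i < odk_size e) \sum_(j < odk_size e)
    odk_coef i j * \1_(odk_set i) x.1 * \1_(odk_set j) x.2)%R.

(* Both (i, j) and (j, i) are summed, so that the variance is
   2 * `| odk_fun e |^2 in L2(mu \x mu). *)
Definition odk_integral (e : off_diagonal_kernel)
    (chi : point_measure T R) : R :=
  (\sum_(i < odk_size e) \sum_(j < odk_size e)
    odk_coef i j * compensated chi (odk_set i) * compensated chi (odk_set j))%R.

Definition L2_sym : set (T * T -> R) :=
  [set f | f \in Lfun (mu \x mu) 2%:E /\
           {ae mu \x mu, forall x, f (x.2, x.1) = f x}].

(* I_2(f), defined up to P-null sets, is the L2(P)-limit of the integrals of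
   elementary kernels tending to f in L2; it is rendered as a relation. *)
Definition double_wiener_ito (eta : O -> point_measure T R)
    (f : T * T -> R) (F : O -> R) : Prop :=
  F \in Lfun P 2%:E /\
  exists e : nat -> off_diagonal_kernel,
    'N[mu \x mu]_(2%:E)[EFin \o (odk_fun (e k) \- f)%R] @[k --> \oo] --> 0 /\
    'N[P]_(2%:E)[EFin \o ((odk_integral (e k) \o eta) \- F)%R]
      @[k --> \oo] --> 0.

Definition chaos2 (eta : O -> point_measure T R) : set (O -> R) :=
  [set F | exists2 f, L2_sym f & double_wiener_ito eta f F].

Definition J4 (eta : O -> point_measure T R) (F : point_measure T R -> R) :
    \bar R :=
  \int[mu]_z 'E_P[fun w => (`|add_one_cost F z (eta w)| ^+ 4)%R].

End poisson_functionals.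

Section gamma_distribution.
Context {R : realType}.

Definition gamma_fun (a : R) : R :=
  (\int[lebesgue_measure]_(x in `]0%R, +oo[) (x `^ (a - 1) * expR (- x)))%R.

Definition gamma_pdf (a x : R) : R :=
  (if 0 < x then x `^ (a - 1) * expR (- x) / gamma_fun a else 0)%R.

Definition gamma_distributed d (O : measurableType d) (P : probability O R)
    (a : R) (X : {RV P >-> R}) : Prop :=
  forall A, measurable A ->
    distribution P X A = \int[lebesgue_measure]_(x in A) (gamma_pdf a x)%:E.

End gamma_distribution.

Definition cvg_in_distribution (R : realType) d d' (O : measurableType d)
    (O' : measurableType d') (P : probability O R) (P' : probability O' R)
    (Y : nat -> O -> R) (Z : O' -> R) : Prop :=
  forall h : R -> R, continuous h ->
    (exists M, forall x, (`|h x| <= M)%R) ->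
    'E_P[h \o Y n] @[n --> \oo] --> 'E_P'[h \o Z].

(* Main.v *)
From HB Require Import structures.
Require Import Defs.
From mathcomp Require Import all_boot all_order all_algebra.
From mathcomp Require Import all_classical all_reals all_analysis.
From mathcomp Require Import measurable_realfun.
From mathcomp Require Import ring lra.
Import Order.TTheory GRing.Theory Num.Theory.
Import numFieldNormedType.Exports.

(** For independent standard Gaussian [N_k], the law of [\sum_(k < d) (N_k ^ 2 - 1)]
    is that of [2 X - d] for a Gamma variable [X] of shape [d / 2]. The approximating
    integrals imitate this sum.

    Since the measure is atomless and infinite, there are infinitely many disjoint
    sets of measure 1, which are called cells ([atomless_infinite_unit_sets]). For
    each [n], choose [d] disjoint blocks of [n] cells, and let the kernel be [1 / n]
    on pairs of distinct cells of the same block and 0 elsewhere. Its double integral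
    is elementary, and equals [Q_n = \sum_k (S_k ^ 2 - V_k)], where [S_k] is the
    standardized number of points in the [k]-th block, a Poisson variable of
    parameter [n], and [V_k] is the average over the block of the squares [W_z ^ 2] of
    the compensated counts of its cells. The variables [W_z ^ 2] are uncorrelated of
    mean 1, so that [V_k] tends to 1 in mean square.

    The limit of [S_k ^ 2] comes from Stein's identity for a Poisson variable
    ([poisson_stein]). Applied to [x * exp (- t x ^ 2)], it shows that the Laplace
    transform [psi] of [S_k ^ 2] satisfies [(1 + 2 t) psi' = - psi] up to a term of
    order [1 / sqrt n], so that [(1 + 2 t) psi ^ 2] tends to 1 ([laplace_sq_limit]).
    By independence of the blocks, the transform of [\sum_k S_k ^ 2] tends to
    [(1 + 2 t) ^ (- d / 2)], which is the transform of [2 X] ([gamma_laplace]).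
    Convergence of the Laplace transforms gives convergence in distribution
    by polynomial approximation in the variable [exp (- x)]
    ([laplace_cvg_bounded_continuous]), and the perturbation [d - \sum_k V_k] does
    not change the limit ([laplace_cvg_perturbed]).

    Stein's identity for powers also bounds each moment of [S_k] uniformly in [n]
    ([standardized_moment_bounded]). All moments of [Q_n] are therefore bounded, and
    convergence in distribution implies that of the moments ([cvg_moments]).

    Finally, adding a point changes [Q_n] only if the point falls into some cell [z]
    of some block [k], and then by [(2 / sqrt n) (S_k - W_z / sqrt n)], of fourth moment
    at most [C / n ^ 2]. The cells of the blocks have total measure [d n], so that
    [J4] is at most [C d / n] ([J4_chi_square_integral_cvg0]). *)

Set Implicit Arguments.
Unset Strict Implicit.
Unset Printing Implicit Defensive.

Local Open Scope classical_set_scope.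
Local Open Scope ring_scope.
Local Open Scope ereal_scope.

(** * Elementary inequalities *)

Section elementary.
Context {R : realType}.
Local Open Scope ring_scope.
Implicit Types (a b x y : R).

Lemma norm_expR_sub_le a b : 0 <= a -> 0 <= b ->
  `|expR (- a) - expR (- b)| <= `|a - b|.
Proof.
wlog ab : a b / a <= b.
  move=> H a0 b0; have [|/ltW] := leP a b; first by move=> ?; exact: H.
  by move=> ba; rewrite distrC (distrC a); exact: H.
move=> a0 b0.
rewrite ger0_norm ?subr_ge0 ?ler_expR ?lerN2// distrC ger0_norm ?subr_ge0//.
have -> : expR (- b) = expR (- a) * expR (- (b - a)).
  by rewrite -expRD; congr expR; lra.
have e1 : expR (- a) <= 1 by rewrite -expR0 ler_expR oppr_le0.
have e2 := expR_ge1Dx (- (b - a)).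
have := expR_ge0 (- a); nra.
Qed.

Lemma expR_first_order a b : 0 <= a -> 0 <= b ->
  `|expR (- b) - expR (- a) + (b - a) * expR (- a)| <= (b - a) ^+ 2.
Proof.
move=> a0 b0.
have h1 : expR (- a) * (1 - (b - a)) <= expR (- b).
  have -> : expR (- b) = expR (- a) * expR (- (b - a)).
    by rewrite -expRD; congr expR; lra.
  by rewrite ler_wpM2l ?expR_ge0// -[leLHS]/(1 + - (b - a)) expR_ge1Dx.
have h2 : expR (- b) * (1 - (a - b)) <= expR (- a).
  have -> : expR (- a) = expR (- b) * expR (- (a - b)).
    by rewrite -expRD; congr expR; lra.
  by rewrite ler_wpM2l ?expR_ge0// -[leLHS]/(1 + - (a - b)) expR_ge1Dx.
have h3 := norm_expR_sub_le b0 a0.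
rewrite ger0_norm; last by lra.
apply: (@le_trans _ _ ((a - b) * (expR (- b) - expR (- a)))); first by nra.
apply: (le_trans (ler_norm _)).
rewrite normrM -[leRHS]ger0_norm ?sqr_ge0// expr2 normrM (distrC a b).
by rewrite ler_wpM2l.
Qed.

(** Chebyshev's sum inequality for the two similarly ordered families [x i]
    and [x i ^+ p], iterated on [p]. *)
Lemma mean_exp_le (I : finType) (x : I -> R) (p : nat) :
  (forall i, 0 <= x i) -> (0 < #|I|)%N ->
  ((\sum_i x i) / #|I|%:R) ^+ p.+1 <= (\sum_i x i ^+ p.+1) / #|I|%:R.
Proof.
move=> x0 I0; have n0 : (0 : R) < #|I|%:R by rewrite ltr0n.
elim: p => [|p IH]; first exact: lexx.
rewrite exprS.
apply: (@le_trans _ _ ((\sum_i x i) / #|I|%:R * ((\sum_i x i ^+ p.+1) / #|I|%:R))).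
  by rewrite ler_wpM2l// divr_ge0 ?ler0n// sumr_ge0.
rewrite mulrACA -invfM ler_pdivrMr ?mulr_gt0//.
rewrite -mulrA (mulrCA (_^-1)) mulVf ?mulr1 ?gt_eqF//.
rewrite -subr_ge0.
have -> : (\sum_i x i ^+ p.+2) * #|I|%:R - (\sum_i x i) * (\sum_i x i ^+ p.+1)
    = 2^-1 * \sum_i \sum_j (x i - x j) * (x i ^+ p.+1 - x j ^+ p.+1).
  have -> : \sum_i \sum_j (x i - x j) * (x i ^+ p.+1 - x j ^+ p.+1) =
    \sum_i \sum_j (x i ^+ p.+2 + x j ^+ p.+2 - x i * x j ^+ p.+1
       - x i ^+ p.+1 * x j).
    by apply: eq_bigr => i _; apply: eq_bigr => j _; rewrite !exprS; ring.
  have e1 : \sum_i \sum_(j : I) x i ^+ p.+2 = (\sum_i x i ^+ p.+2) * #|I|%:R.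
    by rewrite mulr_suml; apply: eq_bigr => i _; rewrite sumr_const mulr_natr.
  have e2 : \sum_(i : I) \sum_j x j ^+ p.+2 = (\sum_i x i ^+ p.+2) * #|I|%:R.
    by rewrite sumr_const mulr_natr.
  have e3 : \sum_i \sum_j x i * x j ^+ p.+1 = (\sum_i x i) * (\sum_i x i ^+ p.+1).
    by rewrite mulr_suml; apply: eq_bigr => i _; rewrite mulr_sumr.
  have e4 : \sum_i \sum_j x i ^+ p.+1 * x j = (\sum_i x i) * (\sum_i x i ^+ p.+1).
    rewrite mulrC mulr_suml; apply: eq_bigr => i _; by rewrite mulr_sumr.
  under [in RHS]eq_bigr do rewrite !big_split/= !sumrN.
  by rewrite !big_split/= !sumrN e1 e2 e3 e4; lra.
rewrite mulr_ge0 ?invr_ge0//; apply: sumr_ge0 => i _; apply: sumr_ge0 => j _.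
have [xij|/ltW xij] := leP (x i) (x j).
  by rewrite mulr_le0// subr_le0// lerXn2r// nnegrE.
by rewrite mulr_ge0// subr_ge0// lerXn2r// nnegrE.
Qed.

Lemma normrD_exp_le a b (p : nat) :
  `|a + b| ^+ p <= 2 ^+ p * (`|a| ^+ p + `|b| ^+ p).
Proof.
apply: (@le_trans _ _ ((2 * Num.max `|a| `|b|) ^+ p)).
  apply: lerXn2r; rewrite ?nnegrE ?mulr_ge0 ?le_max ?normr_ge0//.
  apply: (le_trans (ler_normD _ _)); rewrite mulrDl !mul1r.
  by rewrite lerD ?le_max ?lexx ?orbT.
rewrite exprMn ler_wpM2l ?exprn_ge0//.
by rewrite maxEle; case: ifP => _; rewrite ?lerDl ?lerDr exprn_ge0.
Qed.

Lemma normrM_exp_le a b (p : nat) :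
  `|a * b| ^+ p <= `|a| ^+ (2 * p) + `|b| ^+ (2 * p).
Proof.
rewrite normrM exprMn !(mulnC 2) !exprM.
have := exprn_ge0 p (normr_ge0 a); have := exprn_ge0 p (normr_ge0 b).
move: (_ ^+ p) (`|a| ^+ p) => u v; nra.
Qed.

(** Cut the interval into small steps: the quadratic part of the increments
    disappears in the limit. This replaces the mean value inequality for a
    function that is known only through its increments. *)
Lemma telescope_increments (D : R -> R) (k A B : R) : 0 < k -> 0 <= B ->
  (forall t h, 0 <= t -> 0 <= h -> t + h <= k ->
     `|D (t + h) - D t| <= h * (A + B * h)) ->
  `|D k - D 0| <= k * A.
Proof.
move=> k0 B0 H; apply/ler_addgt0Pr => e e0.
pose N := (Num.truncn (k ^+ 2 * B / e)).+1.
have N0 : (0 : R) < N%:R by rewrite ltr0n.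
have Ne : k ^+ 2 * B / e < N%:R by rewrite truncnS_gt.
have NB : k ^+ 2 * B / N%:R <= e.
  by rewrite ler_pdivrMr// (mulrC e) -ler_pdivrMr// ltW.
pose h := k / N%:R.
have h0 : 0 <= h by rewrite divr_ge0// ltW.
have step (m : nat) : (m <= N)%N ->
    `|D (m%:R * h) - D 0| <= m%:R * (h * (A + B * h)).
  elim: m => [|m IH] mN; first by rewrite !mul0r subrr normr0.
  rewrite -natr1 [in leLHS]mulrDl mul1r [leRHS]mulrDl mul1r.
  rewrite -(subrKA (D (m%:R * h))).
  apply: (le_trans (ler_normD _ _)); rewrite addrC lerD ?IH//; first exact: ltnW.
  apply: H => //; first by rewrite mulr_ge0.
  rewrite -{2}(mul1r h) -mulrDl natr1 mulrA ler_pdivrMr// mulrC ler_wpM2l ?(ltW k0)//.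
  by rewrite ler_nat.
have := step N (leqnn _).
have -> : N%:R * h = k by rewrite /h mulrC divfK// gt_eqF.
rewrite mulrA (_ : N%:R * h = k); last by rewrite /h mulrC divfK// gt_eqF.
move=> /le_trans; apply; rewrite mulrDr lerD2l /h.
apply: (le_trans _ NB).
by rewrite expr2 -!mulrA (mulrCA B).
Qed.

End elementary.

(** * Bernstein polynomials *)

Section bernstein.
Context {R : realType}.
Local Open Scope ring_scope.
Implicit Types (g : R -> R) (x y : R).

(** The expectation of [g] at a sum of [m] independent Bernoulli variables of
    parameter ['X], by conditioning on the last one; at [g \o (fun s => s / m)]
    this is the Bernstein polynomial, without its binomial coefficients. *)
Fixpoint bernstein (m : nat) (g : R -> R) : {poly R} :=
  if m is m'.+1
  then 'X * bernstein m' (fun s => g (s + 1)) + (1 - 'X) * bernstein m' g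
  else (g 0)%:P.

Lemma bernsteinS m g x : (bernstein m.+1 g).[x] =
  x * (bernstein m (fun s => g (s + 1))).[x] + (1 - x) * (bernstein m g).[x].
Proof. by rewrite /= !hornerE. Qed.

Lemma bernstein_le m g g' x : 0 <= x <= 1 -> (forall i : nat, (i <= m)%N ->
    g i%:R <= g' i%:R) ->
  (bernstein m g).[x] <= (bernstein m g').[x].
Proof.
move=> x01; elim: m g g' => [|m IH] g g' H; first by rewrite !hornerC (H 0%N).
rewrite !bernsteinS; case/andP: (x01) => x0 x1.
apply: lerD; apply: ler_wpM2l => //; rewrite ?subr_ge0//; apply: IH => i im.
  by rewrite natr1 H.
by rewrite H// leqW.
Qed.

Lemma bernstein_quadratic m (a b c : R) x :
  (bernstein m (fun s => a + b * (s - c) ^+ 2)).[x] =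
    a + b * (m%:R * x * (1 - x) + (m%:R * x - c) ^+ 2).
Proof.
elim: m c => [|m IH] c; first by rewrite hornerC; ring.
rewrite bernsteinS.
rewrite (_ : (fun s => _) = (fun s => a + b * (s - (c - 1)) ^+ 2)).
  by rewrite !IH -natr1; ring.
by apply/funext => s; congr (_ + _ * _); ring.
Qed.

(** Uniform continuity on the unit interval handles close points; for distant
    ones [2 * M] is a multiple of [(x - y) ^+ 2]. A quadratic bound is what the
    variance of a Bernoulli sum can absorb. *)
Lemma quadratic_modulus (f : R -> R) (M e : R) : continuous f -> 0 < e ->
  (forall x, `|f x| <= M) ->
  exists2 C, 0 <= C & forall x y, 0 <= x <= 1 ->
    `|f x - f y| <= e + C * (x - y) ^+ 2.
Proof.
move=> cf e0 fM.
have /compact_near_coveringP H := @segment_compact R 0 1.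
have [|d /= d0 Hd] := H _ (0^'+)
  (fun d x => forall y, `|x - y| < d -> `|f x - f y| < e).
  move=> x _.
  have /cvgrPdist_lt /(_ (e / 2) (divr_gt0 e0 (ltr0n _ 2))) := cf x.
  case=> r /= r0 Hr; exists (ball x (r / 2), [set d | d < r / 2]).
    split; first by apply: nbhsx_ballx; rewrite divr_gt0.
    by apply: nbhs_right_lt; rewrite divr_gt0.
  move=> [x' d] /= [xx' dr] y x'y.
  have h1 : `|f x - f x'| < e / 2.
    by apply: Hr; rewrite /ball_/= (lt_trans xx')//; lra.
  have h2 : `|f x - f y| < e / 2.
    apply: Hr; rewrite /ball_/= -(subrKA x').
    rewrite (le_lt_trans (ler_normD _ _))//.
    by have := ltrD xx' (lt_trans x'y dr); rewrite -splitr.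
  rewrite -(subrKA (f x)) (le_lt_trans (ler_normD _ _))// distrC.
  by rewrite [ltRHS]splitr ltrD.
pose D := d / 2.
have D0 : 0 < D by rewrite divr_gt0.
have M0 : 0 <= M by rewrite (le_trans _ (fM 0)).
have C0 : 0 <= 2 * M / D ^+ 2.
  by apply: divr_ge0; [exact: mulr_ge0|exact: sqr_ge0].
exists (2 * M / D ^+ 2) => // x y x01.
have [xy|xy] := ltP `|x - y| D.
  apply: ler_wpDr; first by rewrite mulr_ge0 ?sqr_ge0.
  apply: ltW; apply: (Hd D _ D0 x _ y) => //=.
  by rewrite sub0r normrN gtr0_norm// /D; lra.
apply: ler_wpDl; first exact: ltW.
apply: (@le_trans _ _ (2 * M)).
  rewrite (le_trans (ler_normB _ _))// mulrDl mul1r.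
  exact: lerD.
rewrite -[leRHS]mulrA ler_peMr ?mulr_ge0// mulrC ler_pdivlMr ?exprn_gt0// mul1r.
by rewrite -(real_normK (num_real (x - y))) lerXn2r// ?nnegrE// ltW.
Qed.

(** Weierstrass' theorem, by Bernstein's argument: a sum of [m] Bernoulli
    variables of parameter [x] has mean [m * x] and variance
    [m * x * (1 - x) <= m / 4], hence the average of [f] at the empirical mean is
    within [e + C / (4 * m)] of [f x]. *)
Lemma weierstrass_unit_interval (f : R -> R) (M e : R) : continuous f -> 0 < e ->
  (forall x, `|f x| <= M) ->
  exists p : {poly R}, forall x, 0 <= x <= 1 -> `|f x - p.[x]| <= e.
Proof.
move=> cf e0 fM.
have [C C0 HC] := quadratic_modulus cf (divr_gt0 e0 (ltr0n R 2)) fM.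
pose m := (Num.truncn (C / e)).+1.
have m0 : (0 : R) < m%:R by rewrite ltr0n.
have Cm : C <= m%:R * e by rewrite -ler_pdivrMr// ltW// truncnS_gt.
exists (bernstein m (fun s => f (s / m%:R))) => x x01.
have bound : e / 2 + C / m%:R ^+ 2 * (m%:R * x * (1 - x) + (m%:R * x - m%:R * x) ^+ 2) <= e.
  have q : x * (1 - x) <= 1 / 4.
    by clear; have := sqr_ge0 (x - 1 / 2); rewrite expr2; lra.
  have -> : C / m%:R ^+ 2 * (m%:R * x * (1 - x) + (m%:R * x - m%:R * x) ^+ 2)
      = C / m%:R * (x * (1 - x)).
    by rewrite subrr expr0n/= addr0; field; rewrite gt_eqF.
  have : C / m%:R <= e by rewrite ler_pdivrMr// mulrC.
  have : 0 <= C / m%:R by rewrite divr_ge0// ltW.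
  by move: (C / _) => c c0 ce; nra.
have pw (i : nat) : `|f x - f (i%:R / m%:R)| <=
    e / 2 + C / m%:R ^+ 2 * (i%:R - m%:R * x) ^+ 2.
  have -> : C / m%:R ^+ 2 * (i%:R - m%:R * x) ^+ 2 = C * (x - i%:R / m%:R) ^+ 2.
    by field; rewrite gt_eqF.
  exact: HC.
rewrite ler_norml; apply/andP; split.
  rewrite lerBrDl -lerBrDr opprK.
  apply: (@le_trans _ _ (bernstein m (fun s => (f x + e / 2) +
     C / m%:R ^+ 2 * (s - m%:R * x) ^+ 2)).[x]).
    apply: bernstein_le => // i _; have := pw i.
    by rewrite ler_norml => /andP[+ _]; lra.
  by rewrite bernstein_quadratic -addrA lerD2l.
rewrite lerBlDr -lerBlDl.
apply: (@le_trans _ _ (bernstein m (fun s => (f x - e / 2) +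
     (- (C / m%:R ^+ 2)) * (s - m%:R * x) ^+ 2)).[x]).
  by rewrite bernstein_quadratic; lra.
apply: bernstein_le => // i _; have := pw i.
by rewrite ler_norml => /andP[_ +]; lra.
Qed.

End bernstein.

(** * Disjoint sets of unit mass in an atomless measure space *)

Section atomless_measures.
Context d (T : measurableType d) (R : realType).
Variable mu : {measure set T -> \bar R}.
Hypothesis mu_atomless : atomless mu.

Let finE A : mu A < +oo -> mu A = (fine (mu A))%:E.
Proof. by move=> A0; rewrite fineK// ge0_fin_numE. Qed.

Let finD A B : measurable A -> measurable B -> B `<=` A -> mu A < +oo ->
  fine (mu (A `\` B)) = (fine (mu A) - fine (mu B))%R.
Proof.
move=> mA mB BA Aoo.
have Boo : mu B < +oo by rewrite (le_lt_trans _ Aoo)// le_measure ?inE.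
by rewrite measureD// (setIidr BA) fineB// ge0_fin_numE.
Qed.

Let sub_fin A B : measurable A -> measurable B -> B `<=` A -> mu A < +oo ->
  mu B < +oo.
Proof. by move=> mA mB BA; apply: le_lt_trans; rewrite le_measure ?inE. Qed.

(** Of the two parts of a splitting, keep the one with at most half of the
    mass, and iterate. *)
Lemma atomless_small_subset A (e : R) : measurable A -> 0 < mu A -> mu A < +oo ->
  (0 < e)%R -> exists B, [/\ measurable B, B `<=` A, 0 < mu B & mu B < e%:E].
Proof.
move=> mA A0 Aoo e0.
have H (n : nat) : exists B, [/\ measurable B, B `<=` A, 0 < mu B &
    (fine (mu B) <= fine (mu A) / 2 ^+ n)%R].
  elim: n => [|n [B [mB BA B0 Bn]]]; first by exists A; split; rewrite ?expr0 ?divr1.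
  have Boo := sub_fin mA mB BA Aoo.
  have [C [mC CB C0 CltB]] := mu_atomless mB B0.
  have Coo := sub_fin mB mC CB Boo.
  have [CB2|BC2] := leP (fine (mu C)) (fine (mu B) / 2)%R.
    exists C; split => //; first exact: subset_trans BA.
    by rewrite exprS invfM mulrCA; lra.
  exists (B `\` C); split; [exact: measurableD|by move=> x [/BA]| |].
    rewrite finE; last by apply: sub_fin Boo => //; exact: measurableD.
    rewrite finD// lte_fin subr_gt0 -lte_fin -!finE//.
  by rewrite finD// exprS invfM mulrCA; lra.
have pow2 (m : nat) : (m%:R < 2 ^+ m :> R)%R by rewrite -natrX ltr_nat ltn_expl.
have [n Hn] : exists n, (fine (mu A) / 2 ^+ n < e)%R.
  exists (Num.truncn (fine (mu A) / e)).+1.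
  rewrite ltr_pdivrMr ?exprn_gt0// mulrC -ltr_pdivrMr//.
  exact: lt_trans (truncnS_gt _) (pow2 _).
have [B [mB BA B0 Bn]] := H n.
exists B; split => //; rewrite (finE (sub_fin mA mB BA Aoo)) lte_fin.
exact: le_lt_trans Hn.
Qed.

(** Sierpinski's intermediate value theorem, by exhaustion: keep enlarging a
    subset of measure at most [c] by at least half of what can be added. The
    increments tend to zero, so the union has measure [c], since otherwise a
    small subset of the remainder could have been added at every step. *)
Lemma atomless_intermediate A (c : R) : measurable A -> mu A < +oo ->
  (0 <= c)%R -> c%:E <= mu A ->
  exists B, [/\ measurable B, B `<=` A & mu B = c%:E].
Proof.
move=> mA Aoo c0 cA.
pose ok (C : set T) := [/\ measurable C, C `<=` A & (fine (mu C) <= c)%R].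
pose addable (C B : set T) := [/\ measurable B, B `<=` A `\` C &
  (fine (mu C) + fine (mu B) <= c)%R].
pose step (C D : {C | ok C}) := sval C `<=` sval D /\ forall B,
  addable (sval C) B -> (fine (mu B) <= 2 * (fine (mu (sval D)) - fine (mu (sval C))))%R.
have sub_oo C : measurable C -> C `<=` A -> mu C < +oo.
  by move=> mC CA; exact: sub_fin Aoo.
have ok0 : ok set0 by split=> //; rewrite measure0.
have step_total C : exists D, step C D.
  case: C => C okC; have [mC CA Cc] := okC.
  pose S := [set x : R | exists2 B, addable C B & fine (mu B) = x].
  have S0 : S 0%R.
    by exists set0; [split=> //; rewrite measure0 addr0|rewrite measure0].
  have Sub : ubound S c.
    move=> _ [B [_ _ Bc] <-]; apply: le_trans Bc.
    by rewrite lerDr fine_ge0.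
  have Shas : has_sup S by split; [exists 0%R|exists c].
  have [s0|s0] := eqVneq (sup S) 0%R.
    exists (exist ok C okC); split=> //= B CB.
    rewrite subrr mulr0 -s0; apply: ub_le_sup; first by exists c.
    by exists B.
  have sp : (0 < sup S)%R.
    by rewrite lt_neqAle eq_sym s0/=; apply: ub_le_sup => //; exists c.
  have [_ [B [mB BAC Bc] <-]] := sup_adherent (divr_gt0 sp (ltr0n R 2)) Shas.
  move=> Bs.
  have BA : B `<=` A by move=> x /BAC[].
  have CB0 : [disjoint C & B].
    by apply/disj_setPS => x [Cx /BAC[]].
  have CBE : fine (mu (C `|` B)) = (fine (mu C) + fine (mu B))%R.
    rewrite measureU//; last by apply/eqP; rewrite -/(disj_set _ _).
    by rewrite fineD// ge0_fin_numE// sub_oo.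
  have okCB : ok (C `|` B).
    by split; [exact: measurableU|rewrite subUset|rewrite CBE].
  exists (exist ok _ okCB); split => /=; first exact: subsetUl.
  move=> D CD; rewrite CBE addrAC subrr add0r.
  have : (fine (mu D) <= sup S)%R by apply: ub_le_sup; [exists c|exists D].
  by lra.
have [f [f0 fS]] := dependent_choice (fun C => cid (step_total C)) (exist ok set0 ok0).
pose C n := sval (f n).
have okC n : ok (C n) by exact: (svalP (f n)).
have mC n : measurable (C n) by case: (okC n).
have CA n : C n `<=` A by case: (okC n).
have Cc n : (fine (mu (C n)) <= c)%R by case: (okC n).
have Cnd : nondecreasing_seq C.
  by apply/nondecreasing_seqP => n; apply/subsetPset; case: (fS n).
have mU : measurable (\bigcup_n C n) by exact: bigcup_measurable.
have UA : \bigcup_n C n `<=` A by apply: bigcup_sub => n _; exact: CA.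
exists (\bigcup_n C n); split=> //.
have Uc : mu (\bigcup_n C n) <= c%:E.
  have cv : mu \o C @ \oo --> mu (\bigcup_n C n) by exact: nondecreasing_cvg_mu.
  rewrite -(cvg_lim _ cv)//; apply: lime_le; first by apply/cvg_ex; exists (mu (\bigcup_n C n)).
  by apply: nearW => n; rewrite /= finE ?lee_fin// sub_oo.
apply/eqP; rewrite eq_le Uc/= leNgt; apply/negP => Ultc.
have Uoo := sub_oo _ mU UA.
pose e := (c - fine (mu (\bigcup_n C n)))%R.
have e0 : (0 < e)%R by rewrite subr_gt0 -lte_fin -finE.
have rest0 : 0 < mu (A `\` \bigcup_n C n).
  rewrite finE; last by apply: sub_oo => //; exact: measurableD.
  rewrite finD// lte_fin subr_gt0 -lte_fin -!finE//.
  exact: lt_le_trans Ultc cA.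
have [||||B [mB BAU B0 Be]] := @atomless_small_subset (A `\` \bigcup_n C n) e.
- exact: measurableD.
- exact: rest0.
- by apply: sub_oo => //; exact: measurableD.
- exact: e0.
have BA : B `<=` A by move=> x /BAU[].
have b0 : (0 < fine (mu B))%R by rewrite -lte_fin -finE// sub_oo.
(* The same [B] could be added at every step, so each step gained at least half
   of its mass, which contradicts the bound [c]. *)
have growth n : (n%:R * (fine (mu B) / 2) <= fine (mu (C n)))%R.
  elim: n => [|n IH]; first by rewrite mul0r fine_ge0.
  have CB : addable (C n) B.
    split=> //; first by move=> x /BAU[Ax nUx]; split=> // Cx; apply: nUx; exists n.
    have : (fine (mu (C n)) <= fine (mu (\bigcup_n C n)))%R.
      apply: fine_le; rewrite ?ge0_fin_numE ?sub_oo//.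
      by rewrite le_measure ?inE//; exact: bigcup_sup.
    have : (fine (mu B) < e)%R by rewrite -lte_fin -finE// sub_oo.
    by rewrite /e; lra.
  have Bn : (fine (mu B) <= 2 * (fine (mu (C n.+1)) - fine (mu (C n))))%R.
    by have [_ /(_ B CB)] := fS n.
  rewrite -natr1 mulrDl mul1r.
  move: (fine (mu (C n))) (fine (mu (C n.+1))) (fine (mu B)) Bn IH => x y b.
  by move: (n%:R * (b / 2))%R => z; lra.
have := growth (Num.truncn (c / (fine (mu B) / 2))).+1.
apply/negP; rewrite -ltNge (le_lt_trans (Cc _))//.
by rewrite -ltr_pdivrMr ?divr_gt0// truncnS_gt.
Qed.

(** The intermediate values are available in a set of finite mass: intersect
    with the first members of a sequence of sets of finite mass covering the
    space. *)
Lemma atomless_infinite_unit_subset A : sigma_finite setT mu -> measurable A ->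
  mu A = +oo -> exists B, [/\ measurable B, B `<=` A & mu B = 1].
Proof.
move=> [F FT Ffin] mA Aoo.
pose G n := A `&` \big[setU/set0]_(i < n) F i.
have mbig n : measurable (\big[setU/set0]_(i < n) F i).
  by apply: bigsetU_measurable => i _; case: (Ffin i).
have mG n : measurable (G n) by exact: measurableI.
have Gfin n : mu (G n) < +oo.
  have bfin : mu (\big[setU/set0]_(i < n) F i) < +oo.
    elim: n => [|n IH]; first by rewrite big_ord0 measure0.
    have [mF Foo] := Ffin n.
    rewrite big_ord_recr/= (le_lt_trans (measureU2 _ (mbig n) mF))//.
    exact: lte_add_pinfty.
  apply: le_lt_trans bfin; apply: le_measure; rewrite ?inE//.
  exact: subIsetr.
have GU : \bigcup_n G n = A.
  apply/seteqP; split=> [x [n _ []//]|x Ax].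
  have : (\bigcup_n F n) x by rewrite -FT.
  case=> n _ Fx; exists n.+1 => //; split => //.
  by rewrite -bigcup_mkord; exists n => /=.
have Gnd : nondecreasing_seq G.
  apply/nondecreasing_seqP => n; apply/subsetPset; apply: setIS.
  by rewrite big_ord_recr/=; exact: subsetUl.
have cv : mu \o G @ \oo --> mu (\bigcup_n G n).
  by apply: nondecreasing_cvg_mu => //; exact: bigcup_measurable.
have [n Gn] : exists n, 1 <= mu (G n).
  apply: contrapT => /forallNP H.
  have : mu (\bigcup_n G n) <= 1.
    rewrite -(cvg_lim _ cv)//; apply: lime_le; first by apply/cvg_ex; eexists; exact: cv.
    by apply: nearW => n; rewrite ltW// ltNge; apply/negP/H.
  by rewrite GU Aoo.
have [B [mB BG B1]] := atomless_intermediate (mG n) (Gfin n) ler01 Gn.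
by exists B; split=> //; apply: subset_trans BG _; exact: subIsetl.
Qed.

(** Removing a set of unit mass leaves an infinite mass, so that the choice of
    such a set can be repeated forever in what remains. *)
Lemma atomless_infinite_unit_sets : sigma_finite setT mu -> mu setT = +oo ->
  exists B : nat -> set T,
    [/\ forall i, measurable (B i), forall i, mu (B i) = 1 & trivIset setT B].
Proof.
move=> sf muT.
pose big A := measurable A /\ mu A = +oo.
have pick A : big A -> exists B, [/\ measurable B, B `<=` A, mu B = 1 & big (A `\` B)].
  move=> [mA Aoo]; have [B [mB BA B1]] := atomless_infinite_unit_subset sf mA Aoo.
  exists B; split=> //; split; first exact: measurableD.
  have : mu A = mu B + mu (A `\` B).
    rewrite -[in LHS](setDUK BA) measureU//; first exact: measurableD.
    by apply/seteqP; split=> // x [Bx [_ /(_ Bx)]].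
  by rewrite B1 Aoo; case: (mu (A `\` B)).
pose next (s : {A | big A}) := cid (pick _ (svalP s)).
pose B (s : {A | big A}) := sval (next s).
have BP s : [/\ measurable (B s), B s `<=` sval s, mu (B s) = 1 &
    big (sval s `\` B s)] by exact: (svalP (next s)).
pose rest (s : {A | big A}) : {A | big A} :=
  exist big (sval s `\` B s) (let: And4 _ _ _ h := BP s in h).
pose S n := iter n rest (exist big setT (conj measurableT muT)).
have SS m n : (m <= n)%N -> sval (S n) `<=` sval (S m).
  move/subnK <-; elim: (n - m)%N => // k IH.
  by apply: subset_trans IH; rewrite addSn /= => x [].
exists (fun n => B (S n)); split=> [i|i|]; [by case: (BP (S i))..|].
have disj m n x : (m < n)%N -> B (S m) x -> B (S n) x -> False.
  move=> mn Bm Bn; have [_ BS _ _] := BP (S n).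
  by have [] := SS _ _ mn x (BS _ Bn).
move=> i j _ _ [x [Bi Bj]].
by have [ij|ji|//] := ltngtP i j; exfalso; [apply: disj ij Bi Bj|apply: disj ji Bj Bi].
Qed.

End atomless_measures.

(** * Families bounded in every Lebesgue space *)

Section integration.
Context {R : realType}.
Local Open Scope ring_scope.

Lemma Rintegral_sum d (T : measurableType d) (mu : {measure set T -> \bar R})
    (J : Type) (r : seq J) (f : J -> T -> R) :
  (forall k, mu.-integrable setT (EFin \o f k)) ->
  \int[mu]_w (\sum_(k <- r) f k w) = \sum_(k <- r) \int[mu]_w f k w.
Proof.
move=> intf; rewrite /Rintegral.
under eq_integral do rewrite -sumEFin.
rewrite integral_sum//.
rewrite [X in fine X](_ : _ = (\sum_(k <- r) fine (\int[mu]_x (f k x)%:E))%:E)//.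
rewrite -sumEFin; apply: eq_bigr => k _; rewrite fineK//.
by apply: integrable_fin_num => //; exact: intf.
Qed.

Lemma bounded_integrable d (T : measurableType d) (Q : probability T R)
    (u : T -> R) M : measurable_fun setT u -> (forall w, `|u w| <= M) ->
  Q.-integrable setT (EFin \o u).
Proof.
move=> mu uM; apply/integrableP; split; first exact/measurable_EFinP.
apply: le_lt_trans (ltry M).
apply: (@le_trans _ _ (\int[Q]_w M%:E)%E); last first.
  by rewrite integral_cst//= probability_setT mule1.
apply: ge0_le_integral => //.
  by apply/measurable_EFinP; exact: measurableT_comp.
by move=> w _; rewrite lee_fin uM.
Qed.

End integration.

Section moment_bounded_families.
Context d (O : measurableType d) (R : realType) (P : probability O R).
Implicit Types (I K : Type).

(** Asking for all exponents at once makes the notion stable under products. *)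
Definition moment_bounded I (F : I -> O -> R) :=
  (forall i, measurable_fun setT (F i)) /\
  (forall p : nat, exists C : R, forall i,
     \int[P]_w (`|F i w| ^+ p)%:E <= C%:E).

Lemma measurable_norm_exp (f : O -> R) p : measurable_fun setT f ->
  measurable_fun setT (fun w => (`|f w| ^+ p)%:E).
Proof.
move=> mf; apply/measurable_EFinP/measurable_funX.
exact: measurableT_comp.
Qed.

Lemma moment_bounded_comp I K (F : I -> O -> R) (a : K -> I) :
  moment_bounded F -> moment_bounded (F \o a).
Proof.
move=> [mF bF]; split=> [k|p]; first exact: mF.
by have [C HC] := bF p; exists C => k; exact: HC.
Qed.

Lemma moment_bounded_le I (F G : I -> O -> R) :
  (forall i, measurable_fun setT (G i)) ->
  (forall i w, (`|G i w| <= `|F i w|)%R) ->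
  moment_bounded F -> moment_bounded G.
Proof.
move=> mG GF [mF bF]; split=> // p; have [C HC] := bF p.
exists C => i; apply: le_trans (HC i); apply: ge0_le_integral => //.
- exact: measurable_norm_exp.
- exact: measurable_norm_exp.
- by move=> w _; rewrite lee_fin lerXn2r// nnegrE.
Qed.

Lemma moment_bounded_cst I (c : I -> R) (M : R) : (forall i, `|c i| <= M)%R ->
  moment_bounded (fun i (_ : O) => c i).
Proof.
move=> cM; split=> [//|p]; exists (M ^+ p)%R => i.
rewrite integral_cst//= probability_setT mule1 lee_fin lerXn2r ?nnegrE//.
exact: le_trans (cM i).
Qed.

Lemma moment_boundedD I (F G : I -> O -> R) :
  moment_bounded F -> moment_bounded G ->
  moment_bounded (fun i w => F i w + G i w)%R.
Proof.
move=> [mF bF] [mG bG]; split=> [i|p]; first exact: measurable_funD.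
have [C HC] := bF p; have [D HD] := bG p; exists (2 ^+ p * (C + D))%R => i.
apply: (@le_trans _ _ (\int[P]_w ((2 ^+ p)%:E *
    ((`|F i w| ^+ p)%:E + (`|G i w| ^+ p)%:E)))).
  apply: ge0_le_integral => //.
  - by apply: measurable_norm_exp; exact: measurable_funD.
  - apply: emeasurable_funM; first exact: measurable_cst.
    by apply: emeasurable_funD; exact: measurable_norm_exp.
  - by move=> w _; rewrite -EFinD -EFinM lee_fin normrD_exp_le.
rewrite ge0_integralZl//; last 2 first.
  by apply: emeasurable_funD; exact: measurable_norm_exp.
  by move=> w _; rewrite -EFinD lee_fin addr_ge0.
rewrite ge0_integralD//; [|exact: measurable_norm_exp..].
by rewrite EFinM EFinD lee_wpmul2l// ?lee_fin ?exprn_ge0// leeD.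
Qed.

Lemma moment_boundedM I (F G : I -> O -> R) :
  moment_bounded F -> moment_bounded G ->
  moment_bounded (fun i w => F i w * G i w)%R.
Proof.
move=> [mF bF] [mG bG]; split=> [i|p]; first exact: measurable_funM.
have [C HC] := bF (2 * p)%N; have [D HD] := bG (2 * p)%N; exists (C + D)%R => i.
apply: (@le_trans _ _ (\int[P]_w
    ((`|F i w| ^+ (2 * p))%:E + (`|G i w| ^+ (2 * p))%:E))).
  apply: ge0_le_integral => //.
  - by apply: measurable_norm_exp; exact: measurable_funM.
  - by apply: emeasurable_funD; exact: measurable_norm_exp.
  - by move=> w _; rewrite -EFinD lee_fin normrM_exp_le.
rewrite ge0_integralD//; [|exact: measurable_norm_exp..].
by rewrite EFinD leeD.
Qed.

Lemma moment_boundedX I (F : I -> O -> R) (p : nat) :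
  moment_bounded F -> moment_bounded (fun i w => F i w ^+ p)%R.
Proof.
move=> bF; elim: p => [|p IH].
  by apply: (moment_bounded_cst (c := fun=> 1%R) (M := 1%R)) => i; rewrite normr1.
by have := moment_boundedM bF IH; under eq_fun do under eq_fun do rewrite -exprS.
Qed.

Lemma moment_boundedZ I (F : I -> O -> R) (c : I -> R) (M : R) :
  (forall i, `|c i| <= M)%R ->
  moment_bounded F -> moment_bounded (fun i w => c i * F i w)%R.
Proof. by move=> cM; apply: moment_boundedM; exact: moment_bounded_cst cM. Qed.

Lemma moment_boundedB I (F G : I -> O -> R) :
  moment_bounded F -> moment_bounded G ->
  moment_bounded (fun i w => F i w - G i w)%R.
Proof.
move=> bF bG; have [mG _] := bG; apply: moment_boundedD => //.
apply: moment_bounded_le bG => [i|i w]; last by rewrite normrN.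
by apply: measurableT_comp => //; case: bG.
Qed.

Lemma moment_bounded_sum I (n : nat) (F : 'I_n -> I -> O -> R) :
  (forall k, moment_bounded (F k)) ->
  moment_bounded (fun i w => \sum_(k < n) F k i w)%R.
Proof.
elim: n F => [|n IH] F bF.
  under eq_fun do under eq_fun do rewrite big_ord0.
  by apply: (moment_bounded_cst (c := fun=> 0%R) (M := 0%R)) => i; rewrite normr0.
under eq_fun do under eq_fun do rewrite big_ord_recr/=.
by apply: moment_boundedD => //; apply: IH => k; exact: bF.
Qed.

(** The bound survives averaging over arbitrarily many members, by convexity of
    [x ^+ p]. *)
Lemma moment_bounded_mean I K (F : K -> O -> R) (n : I -> nat)
    (a : forall i, 'I_(n i) -> K) : (forall i, 0 < n i)%N ->
  moment_bounded F ->
  moment_bounded (fun i w => (\sum_(j < n i) F (a i j) w) / (n i)%:R)%R.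
Proof.
move=> n0 [mF bF]; split=> [i|[|p]].
- by apply: measurable_funM => //; apply: measurable_sum => j; exact: mF.
- exists 1%R => i; under eq_integral do rewrite expr0.
  by rewrite integral_cst//= probability_setT mule1.
have [C HC] := bF p.+1; exists C => i.
have ni0 : (0 < (n i)%:R :> R)%R by rewrite ltr0n.
apply: (@le_trans _ _ (\int[P]_w ((n i)%:R^-1%:E *
    \sum_(j < n i) (`|F (a i j) w| ^+ p.+1)%:E))).
  apply: ge0_le_integral => //.
  - apply: measurable_norm_exp; apply: measurable_funM => //.
    by apply: measurable_sum => j; exact: mF.
  - apply: emeasurable_funM; first exact: measurable_cst.
    apply: emeasurable_sum => j.
    exact: measurable_norm_exp.
  - move=> w _; rewrite sumEFin -EFinM lee_fin.
    apply: (@le_trans _ _ (((\sum_(j < n i) `|F (a i j) w|) / (n i)%:R) ^+ p.+1)%R).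
      rewrite lerXn2r ?nnegrE ?divr_ge0 ?sumr_ge0 ?(ltW ni0)//.
      rewrite normrM normfV (gtr0_norm ni0) ler_pM2r ?invr_gt0//.
      exact: ler_norm_sum.
    rewrite [leRHS]mulrC.
    have := @mean_exp_le _ 'I_(n i) (fun j => `|F (a i j) w|)%R p.
    by rewrite card_ord; apply.
rewrite ge0_integralZl//; last 2 first.
  by apply: emeasurable_sum => j; exact: measurable_norm_exp.
  by move=> w _; rewrite sumEFin lee_fin sumr_ge0.
rewrite ge0_integral_sum//; last by move=> j; exact: measurable_norm_exp.
rewrite muleC lee_pdivrMr//.
apply: (@le_trans _ _ (\sum_(j < n i) C%:E)); first exact: lee_sum.
by rewrite sumEFin sumr_const card_ord -[in leLHS]mulr_natr EFinM.
Qed.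

Lemma moment_bounded_integrable I (F : I -> O -> R) i : moment_bounded F ->
  P.-integrable setT (EFin \o F i).
Proof.
move=> [mF bF]; apply/integrableP; split; first exact/measurable_EFinP.
have [C HC] := bF 1%N; apply: le_lt_trans (ltry C); apply: le_trans (HC i).
by under [leRHS]eq_integral do rewrite expr1.
Qed.

Lemma moment_bounded_Rintegral I (F : I -> O -> R) p : moment_bounded F ->
  exists C : R, forall i, (\int[P]_w (`|F i w| ^+ p) <= C)%R.
Proof.
move=> bF; have [C HC] := bF.2 p; exists C => i.
rewrite -lee_fin /Rintegral fineK; first exact: HC.
by rewrite ge0_fin_numE ?(le_lt_trans (HC i) (ltry _))// integral_ge0.
Qed.

Lemma moment_bounded_Lfun I (F : I -> O -> R) i (p : nat) :
  moment_bounded F -> F i \in Lfun P p%:R%:E.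
Proof.
move=> [mF bF]; rewrite inE; apply/andP; split; rewrite inE//=.
have [C HC] := bF p.
rewrite /finite_norm unlock/= poweR_lty//; under eq_integral do rewrite powR_mulrn//.
exact: le_lt_trans (HC i) (ltry _).
Qed.

End moment_bounded_families.

(** * Poisson variables and Stein's identity *)

Section poisson_variables.
Context d (O : measurableType d) (R : realType) (P : probability O R).
Implicit Types (lambda : R) (Y : O -> \bar R).

Definition poisson_variable lambda Y :=
  [/\ measurable_fun setT Y, forall w, 0 <= Y w &
      forall k : nat, P [set w | Y w = k%:R%:E] = (poisson_pmf lambda k)%:E].

Lemma poisson_pmf_sum1 lambda : (0 < lambda)%R ->
  \sum_(k <oo) (poisson_pmf lambda k)%:E = 1.
Proof.
move=> l0; rewrite -(probability_setT (poisson_prob lambda 0)) /= /poisson_prob l0.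
by rewrite nneseries_esumT// => k; rewrite lee_fin poisson_pmf_ge0.
Qed.

Lemma measurable_value Y (y : \bar R) : measurable_fun setT Y ->
  measurable [set w | Y w = y].
Proof.
move=> mY; rewrite -[X in measurable X]setTI.
by apply: (mY _ [set y]) => //; exact: emeasurable_set1.
Qed.

Lemma trivIset_values Y : trivIset setT (fun k : nat => [set w | Y w = k%:R%:E]).
Proof.
move=> i j _ _ [w [/= Yi Yj]]; apply/eqP.
by rewrite -(eqr_nat R) -eqe -Yi -Yj.
Qed.

Lemma poisson_natural lambda Y : (0 < lambda)%R -> poisson_variable lambda Y ->
  P (\bigcup_k [set w | Y w = k%:R%:E]) = 1.
Proof.
move=> l0 [mY _ pY]; rewrite measure_semi_bigcup.
- rewrite -[RHS](poisson_pmf_sum1 l0).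
  by apply: eq_eseriesr => k _; exact: pY.
- by move=> k; exact: measurable_value.
- exact: trivIset_values.
- by apply: bigcupT_measurable => k; exact: measurable_value.
Qed.

Lemma ge0_expectation_poisson lambda Y (f : \bar R -> \bar R) :
  (0 < lambda)%R -> poisson_variable lambda Y ->
  measurable_fun setT f -> (forall y, 0 <= f y) ->
  \int[P]_w f (Y w) = \sum_(k <oo) f k%:R%:E * (poisson_pmf lambda k)%:E.
Proof.
move=> l0 poissonY mf f0; have [mY _ pY] := poissonY.
pose F k := [set w | Y w = k%:R%:E].
have mF k : measurable (F k) by exact: measurable_value.
have tF : trivIset setT F by exact: trivIset_values.
have mU : measurable (\bigcup_k F k) by exact: bigcup_measurable.
have PU : P (\bigcup_k F k) = 1 by exact: poisson_natural poissonY.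
have mfY : measurable_fun setT (f \o Y) by exact: measurableT_comp.
rewrite (@ge0_negligible_integral _ _ _ P setT (~` \bigcup_k F k))//; last 2 first.
- exact: measurableC.
- by rewrite /= probability_setC// PU subee.
rewrite setTD setCK ge0_integral_bigcup//; last exact: measurable_funS mfY.
apply: eq_eseriesr => k _.
transitivity (\int[P]_(w in F k) f k%:R%:E).
  by apply: eq_integral => w; rewrite inE /F/= => ->.
by rewrite integral_cst//= pY.
Qed.

(** The recursion [k * pmf k = lambda * pmf (k - 1)] of the weights. *)
Lemma ge0_poisson_shift lambda Y (f : R -> R) :
  (0 < lambda)%R -> poisson_variable lambda Y ->
  measurable_fun setT f -> (forall x, 0 <= f x)%R ->
  \int[P]_w (fine (Y w) * f (fine (Y w)))%:E =
  lambda%:E * \int[P]_w (f (fine (Y w) + 1)%R)%:E.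
Proof.
move=> l0 pY mf f0.
have mfine : measurable_fun setT (@fine R) by exact: fine_measurable.
have -> : \int[P]_w (fine (Y w) * f (fine (Y w)))%:E =
    \int[P]_w (`|fine (Y w)| * f (fine (Y w)))%:E.
  by case: pY => _ Y0 _; apply: eq_integral => w _; rewrite ger0_norm// fine_ge0.
rewrite (@ge0_expectation_poisson _ _ (fun y => (`|fine y| * f (fine y))%:E) l0)//; last 2 first.
- apply/measurable_EFinP/measurable_funM; exact: measurableT_comp.
- by move=> y; rewrite lee_fin mulr_ge0.
rewrite (@ge0_expectation_poisson _ _ (fun y => (f (fine y + 1))%:E) l0)//; last 2 first.
- by apply/measurable_EFinP; apply: measurableT_comp => //; exact: measurable_funD.
- by move=> y; rewrite lee_fin.
rewrite -nneseriesZl//; last first.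
  by move=> k _; rewrite -EFinM lee_fin mulr_ge0// poisson_pmf_ge0.
rewrite nneseries_recl//; last first.
  by move=> k; rewrite -EFinM lee_fin mulr_ge0// ?poisson_pmf_ge0// mulr_ge0.
rewrite /= normr0 mul0r mul0e add0e.
rewrite -[in LHS](@nneseries_addn _ _ 1)//; last first.
  by move=> k; rewrite -EFinM lee_fin mulr_ge0// ?poisson_pmf_ge0// mulr_ge0.
apply: eq_eseriesr => k _; rewrite addn1 -!EFinM natr1; congr EFin.
rewrite normr_nat /poisson_pmf l0 factS natrM invfM exprS.
have k1 : (k.+1%:R : R) != 0%R by rewrite pnatr_eq0.
have k2 : (k`!%:R : R) != 0%R by rewrite pnatr_eq0 gtn_eqF// fact_gt0.
by field; rewrite k2/= addrC natr1.
Qed.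

(** By induction on the exponent, which the shift lowers by one. *)
Lemma poisson_moments lambda Y : (0 < lambda)%R -> poisson_variable lambda Y ->
  moment_bounded P (fun (_ : unit) w => fine (Y w)).
Proof.
move=> l0 pY; have [mY Y0 _] := pY.
have mX : measurable_fun setT (fun w => fine (Y w)) by exact: measurableT_comp.
split=> [//|p]; suff [C HC] : exists C : R, \int[P]_w (`|fine (Y w)| ^+ p)%:E <= C%:E.
  by exists C.
elim: p => [|p [C HC]].
  exists 1%R; under eq_integral do rewrite expr0.
  by rewrite integral_cst//= probability_setT mule1.
exists (lambda * (2 ^+ p * (C + 1)))%R.
under eq_integral do rewrite exprS [X in (X * _)%R]ger0_norm ?fine_ge0//.
have mp : measurable_fun setT (fun x : R => `|x| ^+ p)%R.
  by apply: measurable_funX; exact: normr_measurable.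
rewrite (ge0_poisson_shift l0 pY mp)//.
rewrite EFinM lee_wpmul2l// ?lee_fin ?(ltW l0)//.
apply: (@le_trans _ _ (\int[P]_w ((2 ^+ p)%:E *
    ((`|fine (Y w)| ^+ p)%:E + 1%:E)))).
  apply: ge0_le_integral => //.
  - by apply: measurable_norm_exp; exact: measurable_funD.
  - apply: emeasurable_funM; first exact: measurable_cst.
    by apply: emeasurable_funD => //; exact: measurable_norm_exp.
  - move=> w _; rewrite -EFinD -EFinM lee_fin.
    by rewrite (le_trans (normrD_exp_le _ _ _))// normr1 expr1n.
rewrite ge0_integralZl//; last 2 first.
  by apply: emeasurable_funD => //; exact: measurable_norm_exp.
  by move=> w _; rewrite -EFinD lee_fin addr_ge0.
rewrite ge0_integralD//; last exact: measurable_norm_exp.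
rewrite integral_cst//= probability_setT mule1.
by rewrite EFinM EFinD lee_wpmul2l// ?lee_fin ?exprn_ge0// leeD.
Qed.

Definition standardized lambda Y (w : O) : R :=
  ((fine (Y w) - lambda) / Num.sqrt lambda)%R.

Lemma standardized_moments lambda Y : (0 < lambda)%R ->
  poisson_variable lambda Y ->
  moment_bounded P (fun (_ : unit) => standardized lambda Y).
Proof.
move=> l0 pY; apply: moment_boundedM; last first.
  exact: (moment_bounded_cst P (c := fun=> (Num.sqrt lambda)^-1%R) (fun=> lexx _)).
apply: moment_boundedB; first exact: poisson_moments pY.
exact: (moment_bounded_cst P (c := fun=> lambda) (fun=> lexx _)).
Qed.

(** Stein's identity: for a standard Gaussian the right-hand side would be the
    mean of the derivative; here it is a difference quotient of step
    [1 / sqrt lambda]. *)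
Lemma poisson_stein lambda Y (g : R -> R) : (0 < lambda)%R ->
  poisson_variable lambda Y -> measurable_fun setT g ->
  moment_bounded P (fun (_ : unit) w => g (standardized lambda Y w)) ->
  moment_bounded P (fun (_ : unit) w =>
    g (standardized lambda Y w + (Num.sqrt lambda)^-1)%R) ->
  (\int[P]_w (standardized lambda Y w * g (standardized lambda Y w)) =
  Num.sqrt lambda * (\int[P]_w g (standardized lambda Y w + (Num.sqrt lambda)^-1) -
                     \int[P]_w g (standardized lambda Y w)))%R.
Proof.
move=> l0 pY mg bg bgh; have [mY Y0 _] := pY.
have s0 : (0 < Num.sqrt lambda)%R by rewrite sqrtr_gt0.
have sl : (Num.sqrt lambda * Num.sqrt lambda = lambda)%R.
  by rewrite -expr2 sqr_sqrtr// ltW.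
set S := standardized lambda Y in bg bgh *; set h := (Num.sqrt lambda)^-1%R in bgh *.
(* The shift holds for nonnegative functions: split [f] into its positive and
   negative parts. *)
pose f (x : R) := g ((x - lambda) / Num.sqrt lambda)%R.
have mf : measurable_fun setT f.
  apply: measurableT_comp => //; apply: measurable_funM => //.
  exact: measurable_funB.
have fS w : f (fine (Y w)) = g (S w) by [].
have fSh w : f (fine (Y w) + 1)%R = g (S w + h)%R.
  by rewrite /f /S /standardized /h; congr g; rewrite addrAC mulrDl mul1r.
have bX := poisson_moments l0 pY.
have bS := standardized_moments l0 pY.
pose fp (x : R) := Num.max (f x) 0%R; pose fn (x : R) := Num.max (- f x)%R 0%R.
have mfp : measurable_fun setT fp by exact: measurable_funrpos.
have mfn : measurable_fun setT fn by exact: measurable_funrneg.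
have fpn x : f x = (fp x - fn x)%R.
  by rewrite /fp /fn; case: (leP (f x) 0%R); case: (leP (- f x)%R 0%R); lra.
have mX : measurable_fun setT (fun w => fine (Y w)) by exact: measurableT_comp.
have mX1 : measurable_fun setT (fun w => fine (Y w) + 1)%R by exact: measurable_funD.
have lefp x : (`|fp x| <= `|f x|)%R.
  by rewrite /fp; case: (leP (f x) 0%R) => //; rewrite normr0.
have lefn x : (`|fn x| <= `|f x|)%R.
  rewrite /fn; case: (leP (- f x)%R 0%R) => //; rewrite ?normr0//.
  by rewrite normrN.
have bfp : moment_bounded P (fun (_ : unit) w => fp (fine (Y w))).
  by apply: moment_bounded_le bg => [_|_ w]; [exact: measurableT_comp|exact: lefp].
have bfn : moment_bounded P (fun (_ : unit) w => fn (fine (Y w))).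
  by apply: moment_bounded_le bg => [_|_ w]; [exact: measurableT_comp|exact: lefn].
have bfp1 : moment_bounded P (fun (_ : unit) w => fp (fine (Y w) + 1)%R).
  apply: moment_bounded_le bgh => [_|_ w]; first exact: measurableT_comp.
  by rewrite -fSh lefp.
have bfn1 : moment_bounded P (fun (_ : unit) w => fn (fine (Y w) + 1)%R).
  apply: moment_bounded_le bgh => [_|_ w]; first exact: measurableT_comp.
  by rewrite -fSh lefn.
have int F : moment_bounded P (fun _ : unit => F) -> P.-integrable setT (EFin \o F).
  exact: (moment_bounded_integrable tt).
have shift : (\int[P]_w (fine (Y w) * f (fine (Y w))) =
    lambda * \int[P]_w f (fine (Y w) + 1))%R.
  have E1 (u : R -> R) : measurable_fun setT u -> (forall x, 0 <= u x)%R ->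
      moment_bounded P (fun _ : unit => (fun w => u (fine (Y w) + 1)%R)) ->
      (\int[P]_w (fine (Y w) * u (fine (Y w))) =
       lambda * \int[P]_w u (fine (Y w) + 1))%R.
    move=> mu u0 /int iu; rewrite /Rintegral (ge0_poisson_shift l0 pY mu u0) fineM//.
    exact: integrable_fin_num.
  under eq_Rintegral do rewrite fpn mulrBr.
  rewrite RintegralB//; [|by apply: int; exact: moment_boundedM..].
  rewrite !E1//; try by move=> x; rewrite le_max lexx orbT.
  under [in RHS]eq_Rintegral do rewrite fpn.
  by rewrite RintegralB ?mulrBr//; exact: int.
have -> : (\int[P]_w (S w * g (S w)) =
   h * (\int[P]_w (fine (Y w) * f (fine (Y w))) - lambda * \int[P]_w g (S w)))%R.
  rewrite -RintegralZl//; last exact: int.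
  rewrite -RintegralB//; last 2 first.
    by apply: int; exact: moment_boundedM.
    apply: int; apply: moment_boundedM => //.
    exact: (moment_bounded_cst P (c := fun=> lambda) (fun=> lexx _)).
  rewrite -RintegralZl//; last first.
    apply: int; apply: moment_boundedB; first exact: moment_boundedM.
    apply: moment_boundedM => //.
    exact: (moment_bounded_cst P (c := fun=> lambda) (fun=> lexx _)).
  apply: eq_Rintegral => w _; rewrite fS /h {1}/S /standardized.
  by rewrite mulrC; ring.
rewrite shift; under [in LHS]eq_Rintegral do rewrite fSh.
by rewrite -mulrBr mulrA -{1}sl /h mulKf// gt_eqF.
Qed.

End poisson_variables.

(** * The square of a standardized Poisson variable *)

Section poisson_families.
Context d (O : measurableType d) (R : realType) (P : probability O R).
Variables (I : Type) (lam : I -> R) (Y : I -> O -> \bar R).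
Hypothesis lam1 : forall i, (1 <= lam i)%R.
Hypothesis poissonY : forall i, poisson_variable P (lam i) (Y i).

Local Open Scope ring_scope.
Let S i := standardized (lam i) (Y i).
Let h i := (Num.sqrt (lam i))^-1.

Let lam0 i : 0 < lam i. Proof. exact: lt_le_trans (lam1 i). Qed.
Let sqrt0 i : 0 < Num.sqrt (lam i). Proof. by rewrite sqrtr_gt0. Qed.
Let h0 i : 0 <= h i. Proof. by rewrite invr_ge0. Qed.
Let h1 i : h i <= 1.
Proof. by rewrite invf_le1// -[leLHS]sqrtr1 ler_wsqrtr. Qed.
Let mS i : measurable_fun setT (S i).
Proof. by have [/(_ tt)] := standardized_moments (lam0 i) (poissonY i). Qed.

Let bcst (c : R) : moment_bounded P (fun (_ : unit) (_ : O) => c).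
Proof. exact: (moment_bounded_cst P (c := fun=> c) (fun=> lexx _)). Qed.

Let bS i : moment_bounded P (fun _ : unit => S i).
Proof. exact: standardized_moments. Qed.

Let bSh i : moment_bounded P (fun _ : unit => (fun w => S i w + h i)).
Proof. by apply: moment_boundedD => //; exact: bcst. Qed.

Let int F : moment_bounded P (fun _ : unit => F) -> P.-integrable setT (EFin \o F).
Proof. exact: (moment_bounded_integrable tt). Qed.

(* Stein's identity for [x ^+ q], with the binomial expansion of [(x + h) ^+ q]. *)
Let moment_rec i q : \int[P]_w (S i w ^+ q.+1) =
  \sum_(j < q) ('C(q, j.+1)%:R * h i ^+ j) * \int[P]_w (S i w ^+ (q - j.+1)).
Proof.
have bX p : moment_bounded P (fun _ : unit => (fun w => S i w ^+ p)).
  exact: moment_boundedX.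
under eq_Rintegral do rewrite exprS.
have mq : measurable_fun setT (fun x : R => x ^+ q) by exact: measurable_funX.
rewrite (poisson_stein (lam0 i) (poissonY i) mq (bX q) (moment_boundedX q (bSh i))).
rewrite -RintegralB//; last 2 first.
- by apply: int; exact: (moment_boundedX q (bSh i)).
- exact: int.
have -> : \int[P]_w ((S i w + h i) ^+ q - S i w ^+ q) =
   \int[P]_w (\sum_(j < q) ('C(q, j.+1)%:R * h i ^+ j.+1) * S i w ^+ (q - j.+1)).
  apply: eq_Rintegral => w _; rewrite exprDn big_ord_recl/= subn0 expr0 mulr1 bin0.
  rewrite mulr1n addrAC subrr add0r; apply: eq_bigr => j _.
  by rewrite /bump/= add1n -mulr_natr; ring.
rewrite Rintegral_sum; last first.
  by move=> k; apply: int; apply: moment_boundedM => //; exact: bcst.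
rewrite mulr_sumr; apply: eq_bigr => j _; rewrite RintegralZl//; last exact: int.
rewrite mulrA; congr (_ * _).
rewrite mulrCA; congr (_ * _); rewrite exprS mulrA /h divff ?mul1r//.
by rewrite gt_eqF.
Qed.

Lemma standardized_second_moment i : \int[P]_w (S i w ^+ 2) = 1.
Proof.
rewrite moment_rec big_ord_recl big_ord0 addr0/= bin1 expr0 !mul1r.
under eq_Rintegral do rewrite expr0.
by rewrite Rintegral_cst//= probability_setT mul1r.
Qed.

(** The recursion on the moments has bounded coefficients since the step
    [1 / sqrt lambda] is at most 1. *)
Lemma standardized_moment_bounded : moment_bounded P S.
Proof.
have raw q : exists2 C, 0 <= C & forall m i, (m <= q)%N ->
    `|\int[P]_w (S i w ^+ m)| <= C.
  elim: q => [|q [C C0 HC]].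
    exists 1 => // m i; rewrite leqn0 => /eqP ->.
    under eq_Rintegral do rewrite expr0.
    by rewrite Rintegral_cst//= probability_setT mul1r normr1.
  exists (C + \sum_(j < q) 'C(q, j.+1)%:R * C).
    by rewrite addr_ge0// sumr_ge0// => j _; rewrite mulr_ge0.
  move=> m i; rewrite leq_eqVlt => /orP[/eqP ->|mq]; last first.
    by rewrite (le_trans (HC m i mq))// lerDl sumr_ge0// => j _; rewrite mulr_ge0.
  rewrite moment_rec; apply: ler_wpDl => //.
  apply: le_trans (ler_norm_sum _ _ _) _; apply: ler_sum => j _.
  rewrite !normrM normr_nat -mulrA ler_wpM2l//.
  rewrite -[leRHS]mul1r ler_pM//; last by rewrite HC// leq_subr.
  by rewrite normrX exprn_ile1// ger0_norm.
split=> [//|p]; have [C C0 HC] := raw (2 * p)%N; exists (1 + C)%R => i.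
have bX q : moment_bounded P (fun _ : unit => (fun w => S i w ^+ q)).
  exact: moment_boundedX.
have iX : P.-integrable setT (EFin \o (fun w => 1 + S i w ^+ (2 * p))).
  by apply: int; apply: moment_boundedD => //; exact: bcst.
apply: (@le_trans _ _ (\int[P]_w (1 + S i w ^+ (2 * p))%:E)%E).
  apply: ge0_le_integral => //.
  - exact: measurable_norm_exp.
  - by case/integrableP: iX.
  - move=> w _; rewrite lee_fin.
    rewrite exprM -(real_normK (num_real (S i w))) -exprM mulnC exprM.
    by move: (`|_| ^+ p) => x; nra.
have -> : (\int[P]_w (1 + S i w ^+ (2 * p))%:E)%E =
    (\int[P]_w (1 + S i w ^+ (2 * p)))%:E.
  by rewrite /Rintegral fineK//; exact: integrable_fin_num.
rewrite lee_fin RintegralD//; [|by apply: int; exact: bcst|exact: int].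
rewrite Rintegral_cst//= probability_setT mul1r lerD2l.
by apply: le_trans (HC _ i (leqnn _)); exact: ler_norm.
Qed.

(** [laplace_sq'] is minus the derivative of [laplace_sq]. *)
Definition laplace_sq i t := \int[P]_w expR (- (t * S i w ^+ 2)).
Definition laplace_sq' i t := \int[P]_w (S i w ^+ 2 * expR (- (t * S i w ^+ 2))).

Implicit Types (t x s e k : R).

Let g t (x : R) := x * expR (- (t * x ^+ 2)).

Let mg t : measurable_fun setT (g t).
Proof.
apply: measurable_funM => //; apply: measurableT_comp => //.
by apply: measurableT_comp => //; exact: measurable_funM.
Qed.

Let exp_le1 t x : 0 <= t -> 0 <= expR (- (t * x ^+ 2)) <= 1.
Proof.
by move=> t0; rewrite expR_ge0 -[leRHS]expR0 ler_expR oppr_le0 mulr_ge0// sqr_ge0.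
Qed.

Let mexp t i : measurable_fun setT (fun w => expR (- (t * S i w ^+ 2))).
Proof.
apply: measurableT_comp => //; apply: measurableT_comp => //.
by apply: measurable_funM => //; exact: measurable_funX.
Qed.

Let bexp t i : 0 <= t ->
  moment_bounded P (fun _ : unit => (fun w => expR (- (t * S i w ^+ 2)))).
Proof.
move=> t0; apply: moment_bounded_le (bcst 1) => [_|_ w]; first exact: mexp.
by have /andP[e0 e1] := exp_le1 (S i w) t0; rewrite normr1 ger0_norm.
Qed.

Let bS2exp t i : 0 <= t -> moment_bounded P
  (fun _ : unit => (fun w => S i w ^+ 2 * expR (- (t * S i w ^+ 2)))).
Proof.
move=> t0; apply: moment_boundedM; last exact: bexp.
exact: moment_boundedX.
Qed.

Let quotient_bound k t s e : 0 <= t <= k -> 0 < e <= 1 ->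
  `|e^-1 * (g t (s + e) - g t s) - (1 - 2 * t * s ^+ 2) * expR (- (t * s ^+ 2))|
  <= e * (k * (3 * `|s| + 1) + k ^+ 2 * ((`|s| + 1) * (2 * `|s| + 1) ^+ 2)).
Proof.
move=> /andP[t0 tk] /andP[e0 e1]; have k0 := le_trans t0 tk.
pose a := t * s ^+ 2; pose b := t * (s + e) ^+ 2.
have a0 : 0 <= a by rewrite mulr_ge0 ?sqr_ge0.
have b0 : 0 <= b by rewrite mulr_ge0 ?sqr_ge0.
pose r := expR (- b) - expR (- a) + (b - a) * expR (- a).
have rle : `|r| <= (b - a) ^+ 2 by exact: expR_first_order.
have eb : expR (- b) = expR (- a) - (b - a) * expR (- a) + r by rewrite /r; ring.
have /andP[x0 x1] : 0 <= expR (- a) <= 1 by exact: exp_le1.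
have -> : e^-1 * (g t (s + e) - g t s) - (1 - 2 * t * s ^+ 2) * expR (- (t * s ^+ 2))
    = - (t * e * (3 * s + e)) * expR (- a) + (s + e) * (e^-1 * r).
  rewrite /g -/a -/b eb /b /a.
  by move: (expR _) (r) => x y; field; rewrite gt_eqF.
have s3 : `|3 * s + e| <= 3 * `|s| + 1.
  by rewrite (le_trans (ler_normD _ _))// normrM normr_nat lerD// gtr0_norm.
have s2 : `|2 * s + e| <= 2 * `|s| + 1.
  by rewrite (le_trans (ler_normD _ _))// normrM normr_nat lerD// gtr0_norm.
have s1 : `|s + e| <= `|s| + 1.
  by rewrite (le_trans (ler_normD _ _))// lerD// gtr0_norm.
have ns0 := normr_ge0 s.
apply: (le_trans (ler_normD _ _)); rewrite [leRHS]mulrDr; apply: lerD.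
  rewrite normrM normrN (ger0_norm x0) -[leRHS]mulr1.
  apply: ler_pM => //; rewrite !normrM (ger0_norm t0) (gtr0_norm e0) (mulrC t).
  by rewrite -mulrA ler_wpM2l ?(ltW e0)// ler_pM.
have re : e^-1 * `|r| <= e * (k ^+ 2 * (2 * `|s| + 1) ^+ 2).
  rewrite mulrC ler_pdivrMr// (le_trans rle)//.
  have -> : (b - a) ^+ 2 = (t ^+ 2 * `|2 * s + e| ^+ 2) * (e * e).
    by rewrite real_normK ?num_real// /b /a; ring.
  rewrite [leRHS](_ : _ = k ^+ 2 * (2 * `|s| + 1) ^+ 2 * (e * e)); last by ring.
  rewrite ler_wpM2r ?mulr_ge0 ?(ltW e0)//.
  by apply: ler_pM; rewrite ?exprn_ge0// lerXn2r// ?nnegrE.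
rewrite !normrM normfV (gtr0_norm e0).
apply: le_trans (ler_pM _ _ s1 re) _ => //; first by rewrite mulr_ge0 ?invr_ge0 ?(ltW e0).
by rewrite le_eqVlt; apply/orP; left; apply/eqP; ring.
Qed.

(** Stein's identity applied to [x * exp (- t x ^ 2)], whose derivative is
    [(1 - 2 t x ^ 2) * exp (- t x ^ 2)]: the transform approximately solves the
    equation [(1 + 2 t) psi' = - psi] of the square of a Gaussian variable. *)
Lemma laplace_sq_stein k : 0 <= k -> exists2 C, 0 <= C & forall i t, 0 <= t <= k ->
  `|(1 + 2 * t) * laplace_sq' i t - laplace_sq i t| <= C / Num.sqrt (lam i).
Proof.
move=> k0.
pose p (s : R) := k * (3 * `|s| + 1) + k ^+ 2 * ((`|s| + 1) * (2 * `|s| + 1) ^+ 2).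
have p0 s : 0 <= p s.
  by rewrite /p addr_ge0// mulr_ge0 ?exprn_ge0 ?addr_ge0 ?mulr_ge0 ?exprn_ge0 ?addr_ge0 ?mulr_ge0.
have bc c : moment_bounded P (fun (_ : I) (_ : O) => c : R).
  exact: (moment_bounded_cst P (c := fun=> c) (fun=> lexx _)).
have bp : moment_bounded P (fun i w => p (S i w)).
  have bS' := standardized_moment_bounded.
  have bn : moment_bounded P (fun i w => `|S i w|).
    apply: moment_bounded_le bS' => [i|i w]; last by rewrite normr_id.
    exact: measurableT_comp.
  have bn1 c : moment_bounded P (fun i w => c * `|S i w| + 1).
    by apply: moment_boundedD => //; exact: moment_boundedM.
  apply: moment_boundedD; first exact: moment_boundedM.
  apply: moment_boundedM => //; apply: moment_boundedM.
    exact: moment_boundedD.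
  exact: moment_boundedX.
have [C HC] := moment_bounded_Rintegral 1 bp.
exists `|C| => // i t tk; have /andP[t0 _] := tk.
have gS : moment_bounded P (fun _ : unit => (fun w => g t (S i w))).
  by apply: moment_boundedM => //; exact: bexp.
have gSh : moment_bounded P (fun _ : unit => (fun w => g t (S i w + h i))).
  apply: moment_boundedM => //; apply: moment_bounded_le (bcst 1) => [_|_ w].
    apply: measurableT_comp => //; apply: measurableT_comp => //.
    apply: measurable_funM => //; apply: measurable_funX.
    exact: measurable_funD.
  by have /andP[e0 e1] := exp_le1 (S i w + h i) t0; rewrite normr1 ger0_norm.
have E1 : laplace_sq' i t =
    Num.sqrt (lam i) * (\int[P]_w g t (S i w + h i) - \int[P]_w g t (S i w)).
  rewrite -(poisson_stein (lam0 i) (poissonY i) (mg t))//.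
  by apply: eq_Rintegral => w _; rewrite /g -/(S i) mulrA -expr2.
have -> : (1 + 2 * t) * laplace_sq' i t - laplace_sq i t =
   \int[P]_w ((h i)^-1 * (g t (S i w + h i) - g t (S i w)) -
     (1 - 2 * t * S i w ^+ 2) * expR (- (t * S i w ^+ 2))).
  rewrite RintegralB//; last 2 first.
    by apply: int; apply: moment_boundedM => //; exact: moment_boundedB.
    apply: int; apply: moment_boundedM; last exact: bexp.
    apply: moment_boundedB => //; apply: moment_boundedM => //.
    exact: moment_boundedX.
  rewrite RintegralZl//; last by apply: int; exact: moment_boundedB.
  rewrite RintegralB//; [|exact: int..].
  rewrite {2}/h invrK -E1 mulrDl mul1r -addrA; congr (_ + _).
  rewrite -[LHS]opprK; congr (- _); rewrite opprB.
  rewrite -RintegralZl//; last by apply: int; exact: bS2exp.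
  rewrite -RintegralB//; last 2 first.
  - by apply: int; exact: bexp.
  - by apply: int; apply: moment_boundedM => //; exact: bS2exp.
  by apply: eq_Rintegral => w _; ring.
have idiff : P.-integrable setT (EFin \o (fun w =>
   (h i)^-1 * (g t (S i w + h i) - g t (S i w)) -
     (1 - 2 * t * S i w ^+ 2) * expR (- (t * S i w ^+ 2)))).
  apply: int; apply: moment_boundedB.
    by apply: moment_boundedM => //; exact: moment_boundedB.
  apply: moment_boundedM; last exact: bexp.
  apply: moment_boundedB => //; apply: moment_boundedM => //.
  exact: moment_boundedX.
have ip : P.-integrable setT (EFin \o (fun w => p (S i w))).
  exact: moment_bounded_integrable bp.
apply: (le_trans (le_normr_Rintegral _ _)) => //.
apply: (@le_trans _ _ (\int[P]_w (h i * p (S i w)))).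
  apply: le_Rintegral => //.
  - exact: (integrable_norm idiff).
  - apply: int; apply: moment_boundedM => //.
    exact: (moment_bounded_comp (fun _ : unit => i) bp).
  - move=> w _; apply: quotient_bound => //.
    by rewrite invr_gt0 sqrt0 h1.
rewrite RintegralZl// mulrC ler_wpM2r ?h0//.
apply: le_trans (ler_norm C); apply: le_trans (HC i).
by rewrite le_eqVlt; apply/orP; left; apply/eqP; apply: eq_Rintegral => w _;
   rewrite expr1 ger0_norm.
Qed.

Lemma laplace_sq_bounds i t : 0 <= t ->
  [/\ 0 <= laplace_sq i t <= 1 & 0 <= laplace_sq' i t <= 1].
Proof.
move=> t0; have E1 : 1 = \int[P]_w (1 : R).
  by rewrite Rintegral_cst//= probability_setT mul1r.
split; (apply/andP; split).
- by apply: Rintegral_ge0 => w _; exact: expR_ge0.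
- rewrite E1; apply: le_Rintegral => //; [by apply: int; exact: bexp|exact: int|].
  by move=> w _; case/andP: (exp_le1 (S i w) t0).
- by apply: Rintegral_ge0 => w _; rewrite mulr_ge0 ?sqr_ge0 ?expR_ge0.
- rewrite -(standardized_second_moment i); apply: le_Rintegral => //.
  + by apply: int; exact: bS2exp.
  + by apply: int; exact: moment_boundedX.
  + move=> w _; rewrite -[leRHS]mulr1 ler_wpM2l ?sqr_ge0//.
    by case/andP: (exp_le1 (S i w) t0).
Qed.

Lemma laplace_sq_increment : exists2 B, 0 <= B & forall i t e, 0 <= t -> 0 <= e ->
  `|laplace_sq i (t + e) - laplace_sq i t + e * laplace_sq' i t| <= e ^+ 2 * B.
Proof.
have bS4 : moment_bounded P (fun i w => S i w ^+ 4).
  by apply: moment_boundedX; exact: standardized_moment_bounded.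
have [B HB] := moment_bounded_Rintegral 1 bS4.
exists `|B| => // i t e t0 e0; have te0 : 0 <= t + e by rewrite addr_ge0.
have i1 := int (bexp i te0); have i2 := int (bexp i t0).
have i3 := int (bS2exp i t0).
have i4 : P.-integrable setT (EFin \o (fun w => S i w ^+ 4)).
  by apply: int; exact: moment_boundedX.
rewrite /laplace_sq /laplace_sq' -RintegralB// -RintegralZl// -RintegralD//; last 2 first.
- by apply: int; apply: moment_boundedB; exact: bexp.
- by apply: int; apply: moment_boundedM => //; exact: bS2exp.
have iall : P.-integrable setT (EFin \o (fun w => expR (- ((t + e) * S i w ^+ 2)) -
   expR (- (t * S i w ^+ 2)) + e * (S i w ^+ 2 * expR (- (t * S i w ^+ 2))))).
  apply: int; apply: moment_boundedD; first by apply: moment_boundedB; exact: bexp.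
  by apply: moment_boundedM => //; exact: bS2exp.
apply: (le_trans (le_normr_Rintegral _ _)) => //.
apply: (@le_trans _ _ (\int[P]_w (e ^+ 2 * (S i w ^+ 4)))).
  apply: le_Rintegral => //.
  - exact: (integrable_norm iall).
  - apply: int; apply: moment_boundedM => //; exact: moment_boundedX.
  - move=> w _.
    have := expR_first_order (mulr_ge0 t0 (sqr_ge0 (S i w)))
      (mulr_ge0 te0 (sqr_ge0 (S i w))).
    have -> : (t + e) * S i w ^+ 2 - t * S i w ^+ 2 = e * S i w ^+ 2 by ring.
    have -> : (e * S i w ^+ 2) ^+ 2 = e ^+ 2 * S i w ^+ 4 by ring.
    by rewrite mulrA.
rewrite RintegralZl// ler_wpM2l ?sqr_ge0//.
apply: le_trans (ler_norm B); apply: le_trans (HB i).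
rewrite le_eqVlt; apply/orP; left; apply/eqP; apply: eq_Rintegral => w _.
by rewrite expr1 ger0_norm// -[4%N]/(2 * 2)%N exprM sqr_ge0.
Qed.

(** The function [(1 + 2 t) psi(t)^2] is constant for the exact solution
    [psi t = (1 + 2 t)^(-1/2)]; here its derivative is of order
    [1 / sqrt lambda]. *)
Lemma laplace_sq_limit k : 0 < k -> exists C, forall i,
  `|(1 + 2 * k) * laplace_sq i k ^+ 2 - 1| <= C / Num.sqrt (lam i).
Proof.
move=> k0; have [C C0 HC] := laplace_sq_stein (ltW k0).
have [B B0 HB] := laplace_sq_increment.
exists (k * (2 * C)) => i; rewrite -[leRHS]mulrA -[X in k * X]mulrA.
pose D t := (1 + 2 * t) * laplace_sq i t ^+ 2.
have D0 : D 0 = 1.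
  rewrite /D /laplace_sq mulr0 addr0 mul1r.
  under eq_Rintegral do rewrite mul0r oppr0 expR0.
  by rewrite Rintegral_cst//= probability_setT mul1r expr1n.
rewrite -[X in `|_ - X|]D0 -/(D k).
pose L := 1 + k * B; pose T := 1 + 2 * k.
have L0 : 0 <= L by rewrite addr_ge0 ?mulr_ge0 ?(ltW k0).
have T0 : 0 <= T by rewrite addr_ge0 ?mulr_ge0 ?(ltW k0).
apply: (@telescope_increments _ _ _ _ (4 * L + 2 * T * B + T * L ^+ 2)) => //.
  by rewrite !addr_ge0 ?mulr_ge0 ?exprn_ge0.
move=> t e t0 e0 tek; rewrite /D.
have te0 : 0 <= t + e by rewrite addr_ge0.
have [/andP[x0 x1] /andP[m0 m1]] := laplace_sq_bounds i t0.
have [/andP[y0 y1] _] := laplace_sq_bounds i te0.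
have := HB i t e t0 e0; have := HC i t; rewrite t0 (le_trans _ tek) ?lerDl// => /(_ isT).
move: (laplace_sq i t) (laplace_sq i (t + e)) (laplace_sq' i t) x0 x1 y0 y1 m0 m1.
have q0 : 0 <= C / Num.sqrt (lam i) by rewrite divr_ge0// ltW.
move: (C / _) q0 => q q0 x y m x0 x1 y0 y1 m0 m1 Hm Hxy.
have ek : e <= k by rewrite (le_trans _ tek) ?lerDr.
have /andP[tT0 tT] : 0 <= 1 + 2 * t <= T.
  by apply/andP; split; rewrite ?addr_ge0 ?mulr_ge0// lerD2l ler_wpM2l// (le_trans _ tek) ?lerDl.
(* The increment is [2 * e * x * (x - (1 + 2 t) m)] up to [O(e ^ 2)]. *)
pose r := y - x + e * m.
have rle : `|r| <= e ^+ 2 * B by [].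
have yx : `|y - x| <= e * L.
  have -> : y - x = r - e * m by rewrite /r; ring.
  apply: (le_trans (ler_normB _ _)); rewrite (ger0_norm (mulr_ge0 e0 m0)) addrC.
  rewrite /L mulrDr; apply: lerD; first by rewrite ler_wpM2l.
  by rewrite (le_trans rle)// expr2 -mulrA !ler_wpM2l// ler_wpM2r.
have -> : (1 + 2 * (t + e)) * y ^+ 2 - (1 + 2 * t) * x ^+ 2 =
    2 * e * x * (x - (1 + 2 * t) * m) + 2 * e * (y + x) * (y - x)
    + (1 + 2 * t) * (2 * x) * r + (1 + 2 * t) * (y - x) ^+ 2.
  by rewrite /r; ring.
have h1' : `|2 * e * x * (x - (1 + 2 * t) * m)| <= e * (2 * q).
  rewrite !normrM normr_nat (ger0_norm e0) (ger0_norm x0) distrC.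
  rewrite [leRHS](_ : _ = 2 * e * 1 * q); last by ring.
  by rewrite ler_pM ?mulr_ge0// ler_pM ?mulr_ge0.
have h2' : `|2 * e * (y + x) * (y - x)| <= e * (4 * L * e).
  rewrite !normrM normr_nat (ger0_norm e0) ger0_norm ?addr_ge0//.
  rewrite [leRHS](_ : _ = 2 * e * 2 * (e * L)); last by ring.
  by rewrite ler_pM ?mulr_ge0 ?addr_ge0// ler_pM ?mulr_ge0 ?addr_ge0//; lra.
have h3' : `|(1 + 2 * t) * (2 * x) * r| <= e * (2 * T * B * e).
  rewrite !normrM normr_nat (ger0_norm tT0) (ger0_norm x0).
  rewrite [leRHS](_ : _ = T * (2 * 1) * (e ^+ 2 * B)); last by ring.
  by rewrite ler_pM ?mulr_ge0// ler_pM ?mulr_ge0// ler_wpM2l.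
have h4' : `|(1 + 2 * t) * (y - x) ^+ 2| <= e * (T * L ^+ 2 * e).
  rewrite normrM normrX (ger0_norm tT0).
  rewrite [leRHS](_ : _ = T * (e * L) ^+ 2); last by ring.
  by rewrite ler_pM ?exprn_ge0// lerXn2r ?nnegrE ?mulr_ge0.
rewrite (le_trans (ler_normD _ _))// (le_trans (lerD (ler_normD _ _) (lexx _)))//.
rewrite (le_trans (lerD (lerD (ler_normD _ _) (lexx _)) (lexx _)))//.
apply: le_trans (lerD (lerD (lerD h1' h2') h3') h4') _.
by rewrite le_eqVlt; apply/orP; left; apply/eqP; ring.
Qed.

End poisson_families.

(** * Products of independent Poisson variables *)

Section independent_poisson_variables.
Context d (O : measurableType d) (R : realType) (P : probability O R).
Variables (m : nat) (lam : 'I_m -> R) (Y : 'I_m -> O -> \bar R).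
Hypothesis lam0 : forall i, (0 < lam i)%R.
Hypothesis poissonY : forall i, poisson_variable P (lam i) (Y i).
Hypothesis independentY :
  forall B : 'I_m -> set (\bar R), (forall i, measurable (B i)) ->
    P (\bigcap_(i in [set: 'I_m]) [set w | B i (Y i w)])
    = \prod_(i < m) P [set w | B i (Y i w)].

Let F i k := [set w | Y i w = k%:R%:E].

Let mF i k : measurable (F i k).
Proof. by have [mY _ _] := poissonY i; exact: measurable_value. Qed.

Let N : set (\bar R) := \bigcup_k [set k%:R%:E].

Let mN : measurable N.
Proof. by apply: bigcupT_measurable => k; exact: emeasurable_set1. Qed.

Let D := \bigcap_(i in [set: 'I_m]) [set w | N (Y i w)].

Let mNY i : measurable [set w | N (Y i w)].
Proof. by have [mY _ _] := poissonY i; rewrite -[X in measurable X]setTI; exact: mY. Qed.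

Let mD : measurable D.
Proof. by apply: fin_bigcap_measurable. Qed.

Let PD : P D = 1.
Proof.
rewrite /D (independentY (fun=> mN)); apply: big1 => i _.
rewrite (_ : [set w | N (Y i w)] = \bigcup_k F i k); last first.
  by apply/seteqP; split=> w [k _ kw]; exists k.
exact: poisson_natural (poissonY i).
Qed.

Variable f : 'I_m -> R -> R.
Hypothesis f0 : forall i x, (0 <= f i x)%R.
Hypothesis mf : forall i, measurable_fun setT (f i).
Hypothesis intf : forall i, P.-integrable setT (EFin \o (fun w => f i (fine (Y i w)))).

(* The functions are truncated to finitely many values; the expectation of the
   product is then a finite sum over all tuples of values. *)
Let trunc K i w := (\sum_(k < K) f i k%:R * \1_(F i k) w)%R.

Let trunc_expectation K : \int[P]_w (\prod_(i < m) trunc K i w)%:E =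
  (\prod_(i < m) \sum_(k < K) f i k%:R * poisson_pmf (lam i) k)%:E.
Proof.
rewrite bigA_distr_bigA/=.
transitivity (\int[P]_w (\sum_(u : {ffun 'I_m -> 'I_K})
    ((\prod_(i < m) f i (u i)%:R)%:E *
     (\1_(\bigcap_(i in [set: 'I_m]) F i (u i)) w)%:E))).
  apply: eq_integral => w _; rewrite /trunc bigA_distr_bigA/= -sumEFin.
  apply: eq_bigr => u _; rewrite -EFinM big_split/=; congr (_ * _)%:E.
  rewrite indicE; case: (boolP (w \in _)) => /=.
    rewrite inE => H; apply: big1 => i _; rewrite indicE mem_set//.
    exact: H.
  move=> H; have [i Hi] : exists i, ~ F i (u i) w.
    apply/not_existsP => H'; move/negP: H; apply; rewrite inE => i _.
    by apply: contrapT; exact: H'.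
  by rewrite (bigD1 i)//= indicE memNset// mul0r.
have mcap (u : {ffun 'I_m -> 'I_K}) :
    measurable (\bigcap_(i in [set: 'I_m]) F i (u i)).
  exact: fin_bigcap_measurable.
rewrite ge0_integral_sum//; last 2 first.
- move=> u; apply: emeasurable_funM => //; apply/measurable_EFinP.
  exact: measurable_indic.
- by move=> u w _; rewrite -EFinM lee_fin mulr_ge0// prodr_ge0.
rewrite -sumEFin; apply: eq_bigr => u _.
rewrite ge0_integralZl//; last 2 first.
- by apply/measurable_EFinP; exact: measurable_indic.
- by rewrite lee_fin prodr_ge0.
rewrite integral_indic// setIT/=.
have -> : P (\bigcap_(i in [set: 'I_m]) F i (u i)) =
    \prod_(i < m) (poisson_pmf (lam i) (u i))%:E.
  have := independentY (fun i => emeasurable_set1 (u i)%:R%:E).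
  move=> /= ->; apply: eq_bigr => i _.
  by have [_ _ pY] := poissonY i; exact: pY.
by rewrite prodEFin -EFinM big_split.
Qed.

Let trunc_ge0 K i w : (0 <= trunc K i w)%R.
Proof. by rewrite sumr_ge0// => k _; rewrite mulr_ge0. Qed.

Let trunc_nd i w : {homo trunc^~ i ^~ w : K L / (K <= L)%N >-> (K <= L)%R}.
Proof.
apply/nondecreasing_seqP => K; rewrite /trunc big_ord_recr/= lerDl.
by rewrite mulr_ge0.
Qed.

Let mtrunc K i : measurable_fun setT (trunc K i).
Proof.
by apply: measurable_sum => k; exact: measurable_funM.
Qed.

Let trunc_eq i w k K : Y i w = k%:R%:E -> (k < K)%N -> trunc K i w = f i (fine (Y i w)).
Proof.
move=> Yk kK; rewrite /trunc (bigD1 (Ordinal kK))//= indicE mem_set// mulr1 Yk/=.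
rewrite big1 ?addr0// => j jk; rewrite indicE memNset ?mulr0// /F/= Yk => -[].
by move/eqP; rewrite eqr_nat => /eqP kj; move/eqP: jk; apply; apply: val_inj.
Qed.

(** From events to functions, by monotone convergence of the truncations on the
    almost sure event where all variables are natural numbers. *)
Lemma independent_expectation_prod :
  \int[P]_w (\prod_(i < m) f i (fine (Y i w)))%:E =
  (\prod_(i < m) \int[P]_w f i (fine (Y i w)))%R%:E.
Proof.
have mfY i : measurable_fun setT (fun w => f i (fine (Y i w))).
  by have [mY _ _] := poissonY i; do 2 apply: measurableT_comp => //.
have mprod : measurable_fun setT (fun w => (\prod_(i < m) f i (fine (Y i w)))%:E).
  by apply/measurable_EFinP; exact: measurable_prod.
have PnD : P (~` D) = 0 by rewrite probability_setC// PD subee.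
have restrict u : measurable_fun setT u -> (forall w, 0 <= u w) ->
    \int[P]_w u w = \int[P]_(w in D) u w.
  move=> mu u0; rewrite (@ge0_negligible_integral _ _ _ P setT (~` D))//; last first.
    exact: measurableC.
  by rewrite setTD setCK.
pose G K w := (\prod_(i < m) trunc K i w)%:E.
have mG K : measurable_fun setT (G K).
  by apply/measurable_EFinP; apply: measurable_prod => i _; exact: mtrunc.
have G0 K w : 0 <= G K w by rewrite lee_fin prodr_ge0.
have Glim w : D w -> limn (G^~ w) = (\prod_(i < m) f i (fine (Y i w)))%:E.
  move=> Dw; apply: (@lim_near_cst _ _ _ \oo); first exact: ereal_hausdorff.
  have /choice[k Hk] : forall i, exists k : nat, Y i w = k%:R%:E.
    by move=> i; have [k _ kw] := Dw i I; exists k.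
  exists (\max_(i < m) k i).+1 => // K /= HK; congr EFin; apply: eq_bigr => i _.
  apply: trunc_eq (Hk i) _; apply: leq_ltn_trans HK.
  exact: leq_bigmax.
have lim1 : \int[P]_w (\prod_(i < m) f i (fine (Y i w)))%:E = limn (fun K => \int[P]_w G K w).
  rewrite restrict//; last by move=> w; rewrite lee_fin prodr_ge0.
  transitivity (\int[P]_(w in D) limn (G^~ w)).
    by apply: eq_integral => w; rewrite inE => /Glim.
  rewrite monotone_convergence//.
  - by apply: congr_lim; apply/funext => K; rewrite restrict.
  - by move=> K; exact: measurable_funTS.
  - move=> w _ K L KL; rewrite lee_fin ler_prod// => i _.
    by rewrite trunc_ge0 trunc_nd.
rewrite lim1; apply/cvg_lim => //; rewrite /G.
under eq_cvg do rewrite trunc_expectation.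
apply: cvg_EFin; first exact: nearW.
apply: cvg_big => [|i _].
  by move=> xy; apply: mul_continuous.
have E1 : \sum_(k <oo) (f i (fine k%:R%:E))%:E * (poisson_pmf (lam i) k)%:E =
    (\int[P]_w f i (fine (Y i w)))%:E.
  have mg : measurable_fun setT (fun y : \bar R => (f i (fine y))%:E).
    by apply/measurable_EFinP; exact: measurableT_comp.
  rewrite -(ge0_expectation_poisson (lam0 i) (poissonY i) mg); last first.
    by move=> y; rewrite lee_fin.
  by rewrite fineK//; apply: integrable_fin_num => //; exact: intf.
have : (fun K => (\sum_(k < K) f i k%:R * poisson_pmf (lam i) k)%:E) @ \oo -->
    (\int[P]_w f i (fine (Y i w)))%:E.
  rewrite -E1; apply: cvg_toP.
    apply: ereal_nondecreasing_is_cvgn; apply/nondecreasing_seqP => K.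
    by rewrite big_ord_recr/= lee_fin lerDl mulr_ge0// poisson_pmf_ge0.
  apply: congr_lim; apply/funext => K; rewrite big_mkord -sumEFin.
  by under eq_bigr do rewrite EFinM.
by move/fine_cvg.
Qed.

End independent_poisson_variables.

(** * Convergence in distribution from Laplace transforms *)

Section laplace_convergence.
Context d d' (O : measurableType d) (O' : measurableType d') (R : realType).
Variables (P : probability O R) (P' : probability O' R).
Local Open Scope ring_scope.
Implicit Types (f g h : R -> R) (M : R).

Let tame f := measurable_fun setT f /\ exists M, forall x, 0 <= x -> `|f x| <= M.

Let tame_integrable d0 (T : measurableType d0) (Q : probability T R)
    (A : T -> R) f : measurable_fun setT A -> (forall w, 0 <= A w) -> tame f ->
  Q.-integrable setT (EFin \o (f \o A)).
Proof.
move=> mA A0 [mf [M fM]]; apply: (@bounded_integrable _ _ _ _ _ M).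
  exact: measurableT_comp.
by move=> w; exact: fM.
Qed.

Let Rint_diff d0 (T : measurableType d0) (Q : probability T R)
    (A : T -> R) f g e : measurable_fun setT A -> (forall w, 0 <= A w) ->
  tame f -> tame g -> tame e -> (forall x, 0 <= x -> `|f x - g x| <= e x) ->
  `|\int[Q]_w f (A w) - \int[Q]_w g (A w)| <= \int[Q]_w e (A w).
Proof.
move=> mA A0 tf tg te fge.
have if_ := tame_integrable Q mA A0 tf; have ig := tame_integrable Q mA A0 tg.
have ie := tame_integrable Q mA A0 te.
have ifg : Q.-integrable setT (EFin \o (fun w => f (A w) - g (A w))).
  have -> : EFin \o (fun w => f (A w) - g (A w)) =
      ((EFin \o (f \o A)) \- (EFin \o (g \o A)))%E by apply/funext.
  exact: integrableB.
rewrite -RintegralB//; apply: (le_trans (le_normr_Rintegral _ ifg)) => //.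
apply: le_Rintegral => //; first exact: (integrable_norm ifg).
by move=> w _; exact: fge.
Qed.

Variables (A : nat -> O -> R) (A' : O' -> R).
Hypothesis mA : forall n, measurable_fun setT (A n).
Hypothesis mA' : measurable_fun setT A'.
Hypothesis A0 : forall n w, 0 <= A n w.
Hypothesis A'0 : forall w, 0 <= A' w.

Let cv f := \int[P]_w f (A n w) @[n --> \oo] --> \int[P']_w f (A' w).

Let cv_approx f : tame f ->
  (forall e, 0 < e -> exists g u, [/\ tame g, tame u,
     forall x, 0 <= x -> `|f x - g x| <= u x, cv g & cv u /\
     \int[P']_w u (A' w) < e]) -> cv f.
Proof.
move=> tf H; apply/cvgrPdist_le => e e0.
have e4 : 0 < e / 4 by rewrite divr_gt0.
have [g [u [tg tu fgu cg [cu ue]]]] := H _ e4.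
have nearu : \forall n \near \oo, \int[P]_w u (A n w) < e / 4.
  by apply: cvgr_lt ue; exact: cu.
have /cvgrPdist_le /(_ _ e4) nearg := cg.
near=> n.
have h1 : `|\int[P]_w f (A n w) - \int[P]_w g (A n w)| <= e / 4.
  apply: le_trans (Rint_diff P (mA n) (A0 n) tf tg tu fgu) _.
  by apply: ltW; near: n.
have h2 : `|\int[P']_w f (A' w) - \int[P']_w g (A' w)| <= e / 4.
  by apply: le_trans (Rint_diff P' mA' A'0 tf tg tu fgu) (ltW ue).
have h3 : `|\int[P']_w g (A' w) - \int[P]_w g (A n w)| <= e / 4.
  by near: n.
move: h1 h2 h3; rewrite !ler_norml; lra.
Unshelve. all: by end_near. Qed.

Hypothesis laplace_cv : forall k : nat, cv (fun x => expR (- (k%:R * x))).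

Let u (x : R) := expR (- x).

Let u01 (x : R) : 0 <= x -> 0 <= u x <= 1.
Proof. by move=> x0; rewrite expR_ge0 -[leRHS]expR0 ler_expR oppr_le0. Qed.

Let mu : measurable_fun setT u.
Proof. by apply: measurableT_comp => //; exact: measurableT_comp. Qed.

Let tame_comp f M : continuous f -> (forall x, `|f x| <= M) -> tame (f \o u).
Proof.
move=> cf fM; split; last by exists M => x _; exact: fM.
apply: measurableT_comp => //; exact: continuous_measurable_fun.
Qed.

Let tame_u_exp k : tame (fun x => u x ^+ k).
Proof.
split; first exact: measurable_funX.
by exists 1 => x x0; have /andP[a b] := u01 x0; rewrite normrX exprn_ile1// ger0_norm.
Qed.

Let tame_sum n (F : 'I_n -> R -> R) : (forall i, tame (F i)) ->
  tame (fun x => \sum_(i < n) F i x).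
Proof.
move=> tF; split; first by apply: measurable_sum => i; case: (tF i).
have /choice[M HM] : forall i, exists M, forall x, 0 <= x -> `|F i x| <= M.
  by move=> i; case: (tF i).
exists (\sum_(i < n) M i) => x x0.
by apply: le_trans (ler_norm_sum _ _ _) _; apply: ler_sum => i _; exact: HM.
Qed.

Let tameZ c f : tame f -> tame (fun x => c * f x).
Proof.
move=> [mf [M fM]]; split; first exact: measurable_funM.
by exists (`|c| * M) => x x0; rewrite normrM ler_wpM2l ?fM.
Qed.

Let cv_sum n (F : 'I_n -> R -> R) : (forall i, tame (F i)) ->
  (forall i, cv (F i)) -> cv (fun x => \sum_(i < n) F i x).
Proof.
move=> tF cF; rewrite /cv Rintegral_sum; last first.
  by move=> i; exact: (tame_integrable P' mA' A'0 (tF i)).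
have -> : (fun n0 => \int[P]_w (\sum_(i < n) F i (A n0 w))) =
    (fun n0 => \sum_(i < n) \int[P]_w F i (A n0 w)).
  apply/funext => n0; rewrite Rintegral_sum// => i.
  exact: (tame_integrable P (mA n0) (A0 n0) (tF i)).
apply: cvg_big => [xy|i _]; [exact: add_continuous|exact: cF].
Qed.

Let cvZ c f : tame f -> cv f -> cv (fun x => c * f x).
Proof.
move=> tf cf; rewrite /cv RintegralZl//; last exact: (tame_integrable P' mA' A'0 tf).
have -> : (fun n => \int[P]_w (c * f (A n w))) = (fun n => c * \int[P]_w f (A n w)).
  apply/funext => n; rewrite RintegralZl//.
  exact: (tame_integrable P (mA n) (A0 n) tf).
exact: cvgMr.
Qed.

Let cv_poly (p : {poly R}) : tame (fun x => p.[u x]) /\ cv (fun x => p.[u x]).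
Proof.
have -> : (fun x => p.[u x]) = (fun x => \sum_(i < size p) p`_i * u x ^+ i).
  by apply/funext => x; exact: horner_coef.
have tE (i : 'I_(size p)) : tame (fun x => p`_i * u x ^+ i).
  by apply: tameZ; exact: tame_u_exp.
split; first exact: tame_sum.
apply: cv_sum => // i; apply: cvZ; first exact: tame_u_exp.
have -> : (fun x => u x ^+ i) = (fun x => expR (- (i%:R * x))); last exact: laplace_cv.
by apply/funext => x; rewrite -mulrN expRM_natl.
Qed.

Let cv_comp f M : continuous f -> (forall x, `|f x| <= M) -> cv (f \o u).
Proof.
move=> cf fM; apply: cv_approx; first exact: tame_comp cf fM.
move=> e e0; have [p Hp] := weierstrass_unit_interval cf (divr_gt0 e0 (ltr0n R 2)) fM.
exists (fun x => p.[u x]), (fun=> e / 2); have [tp cp] := cv_poly p.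
have te : tame (fun=> e / 2) by split => //; exists `|e / 2|.
have Ec d0 (T : measurableType d0) (Q : probability T R) c :
    \int[Q]_w (c : R) = c.
  by rewrite Rintegral_cst//= probability_setT mulr1.
split=> //; first by move=> x x0; exact: (Hp _ (u01 x0)).
split=> //.
  by rewrite /cv !Ec; exact: cvg_cst.
by rewrite Ec; lra.
Qed.

(** The means of polynomials in [exp (- x)] converge, and so do, by Weierstrass'
    theorem, those of continuous functions of [exp (- x)]. A bounded continuous
    function of [x >= 0] differs from such a function only in the tail, which has
    small mass for the limit, hence for the sequence. *)
Lemma laplace_cvg_bounded_continuous h M : continuous h -> (forall x, `|h x| <= M) ->
  \int[P]_w h (A n w) @[n --> \oo] --> \int[P']_w h (A' w).
Proof.
move=> ch hM; have M0 : 0 <= M by exact: le_trans (normr_ge0 _) (hM 0).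
have th : tame h by split; [exact: continuous_measurable_fun|exists M].
apply: cv_approx => // e e0.
pose r c x : R := Num.min 1 (Num.max 0 (2 - x / c)).
have cr c : continuous (r c).
  move=> x; apply: (@continuous_min R R (fun=> 1) (fun y => Num.max 0 (2 - y / c))).
    exact: cvg_cst.
  apply: (@continuous_max R R (fun=> 0) (fun y => 2 - y / c)); first exact: cvg_cst.
  apply: cvgB; first exact: cvg_cst.
  by apply: cvgMl; exact: cvg_id.
have r01 c x : 0 <= r c x <= 1.
  by rewrite /r le_min ler01 le_max lexx/= ge_min lexx.
have r1 c x : `|r c x| <= 1 by case/andP: (r01 c x) => ? ?; rewrite ger0_norm.
(* The ramp [r c] is 1 below [c] and 0 above [2 * c]: applied to [exp (- x)], it
   is a continuous function that dominates the indicator of the tail. *)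
have [c c0 rc] : exists2 c, 0 < c & \int[P']_w ((2 * M) * r c (u (A' w))) < e.
  pose F m w := (2 * M * r m.+1%:R^-1 (u (A' w)))%:E.
  have mF m : measurable_fun setT (F m).
    apply/measurable_EFinP; apply: measurable_funM => //.
    apply: (measurableT_comp (f := r m.+1%:R^-1)).
      by apply: continuous_measurable_fun; exact: cr.
    exact: measurableT_comp.
  have Flim w : [set: O'] w -> F ^~ w @ \oo --> (cst 0%E : O' -> \bar R) w.
    move=> _; apply: cvg_near_cst.
    exists (Num.truncn (2 / u (A' w))) => // m /= Hm; rewrite /F.
    suff -> : r m.+1%:R^-1 (u (A' w)) = 0 by rewrite mulr0.
    have u0 : 0 < u (A' w) by exact: expR_gt0.
    have : 2 <= u (A' w) / m.+1%:R^-1.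
      rewrite invrK mulrC -ler_pdivrMr// ltW//.
      by rewrite (lt_le_trans (truncnS_gt _))// ler_nat.
    by rewrite /r => H; rewrite max_l ?min_r//; lra.
  have Fint : P'.-integrable setT (cst (2 * M)%:E).
    exact: (@bounded_integrable _ _ _ P' (fun=> 2 * M) `|2 * M|).
  have Fdom m w : [set: O'] w -> (`|F m w| <= (cst (2 * M)%:E) w)%E.
    move=> _; rewrite /F lee_fin normrM ger0_norm ?mulr_ge0//.
    by rewrite ler_piMr ?mulr_ge0.
  have Ffin w : [set: O'] w -> (cst (2 * M)%:E : O' -> \bar R) w \is a fin_num by [].
  have := dominated_cvg measurableT mF Flim Ffin Fint Fdom.
  rewrite integral0 => /fine_cvg /= F0.
  have /filter_ex[m Hm] : \forall m \near \oo, fine (\int[P']_w F m w)%E < e.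
    by apply: cvgr_lt e0; exact: F0.
  by exists m.+1%:R^-1.
exists (fun x => h (- ln (Num.max (u x) c))), (fun x => (2 * M) * r c (u x)).
have cf : continuous (fun x => h (- ln (Num.max x c))).
  move=> x; apply: (continuous_comp (f := fun x => - ln (Num.max x c))); last exact: ch.
  apply: cvgN; apply: (continuous_comp (f := fun x => Num.max x c)).
    by apply: (@continuous_max R R id (fun=> c)); [exact: cvg_id|exact: cvg_cst].
  by apply: continuous_ln; rewrite lt_max c0 orbT.
have c2 : continuous (fun x => (2 * M) * r c x).
  by move=> x; apply: cvgMr; exact: cr.
have M2 x : `|2 * M * r c x| <= 2 * M.
  by rewrite normrM ger0_norm ?mulr_ge0// ler_piMr ?mulr_ge0.
have b1 x : `|h (- ln (Num.max x c))| <= M by exact: hM.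
split.
- exact: (tame_comp cf b1).
- exact: (tame_comp c2 M2).
- move=> x x0; have [uc|uc] := leP c (u x).
    by rewrite /u expRK opprK subrr normr0 mulr_ge0 ?mulr_ge0//; case/andP: (r01 c (expR (- x))).
  have -> : r c (u x) = 1.
    rewrite /r; have : u x / c < 1 by rewrite ltr_pdivrMr ?mul1r.
    by move=> h1; rewrite max_r ?min_l//; lra.
  rewrite mulr1 (le_trans (ler_normB _ _))// mulrDl mul1r.
  by apply: lerD; exact: hM.
- exact: (cv_comp cf b1).
- by split; [exact: (cv_comp c2 M2)|].
Qed.

End laplace_convergence.

Section perturbation.
Context d d' (O : measurableType d) (O' : measurableType d') (R : realType).
Variables (P : probability O R) (P' : probability O' R).
Local Open Scope ring_scope.
Variables (Y D : nat -> O -> R) (A : O' -> R).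
Hypothesis mY : forall n, measurable_fun setT (Y n).
Hypothesis mD : forall n, measurable_fun setT (D n).
Hypothesis mA : measurable_fun setT A.
Hypothesis Y0 : forall n w, 0 <= Y n w.
Hypothesis A0 : forall w, 0 <= A w.
Hypothesis intD2 : forall n, P.-integrable setT (EFin \o (fun w => D n w ^+ 2)).
Hypothesis D_cvg : \int[P]_w (D n w ^+ 2) @[n --> \oo] --> (0 : R).
Hypothesis Y_laplace : forall k : nat,
  \int[P]_w expR (- (k%:R * Y n w)) @[n --> \oo] -->
  \int[P']_w expR (- (k%:R * A w)).

Let T n w := Y n w + D n w.
Let Tp n w := Num.max (T n w) 0.

Let mT n : measurable_fun setT (T n).
Proof. exact: measurable_funD. Qed.

Let mTp n : measurable_fun setT (Tp n).
Proof. exact: measurable_funrpos. Qed.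

Let Tp0 n w : 0 <= Tp n w.
Proof. by rewrite le_max lexx orbT. Qed.

Let cvg_close (f g : nat -> O -> R) (l M : R) :
  (forall n, measurable_fun setT (f n)) -> (forall n, measurable_fun setT (g n)) ->
  (forall n w, `|f n w| <= M) -> (forall n w, `|g n w| <= M) ->
  (forall e, 0 < e -> exists2 C, 0 <= C & forall n w,
     `|f n w - g n w| <= e + C * D n w ^+ 2) ->
  \int[P]_w g n w @[n --> \oo] --> l -> \int[P]_w f n w @[n --> \oo] --> l.
Proof.
move=> mf mg fM gM H cg; apply/cvgrPdist_le => e e0.
have e2 : 0 < e / 4 by rewrite divr_gt0.
have [C C0 HC] := H _ e2.
have /cvgrPdist_le /(_ _ e2) nearg := cg.
have nearD : \forall n \near \oo, C * \int[P]_w (D n w ^+ 2) < e / 4.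
  suff : C * \int[P]_w (D n w ^+ 2) @[n --> \oo] --> C * 0.
    by move=> c; apply: cvgr_lt; [exact: c|rewrite mulr0].
  exact: cvgMr.
near=> n.
have if_ := bounded_integrable P (mf n) (fM n).
have ig := bounded_integrable P (mg n) (gM n).
have ifg : P.-integrable setT (EFin \o (fun w => f n w - g n w)).
  have -> : EFin \o (fun w => f n w - g n w) =
      ((EFin \o f n) \- (EFin \o g n))%E by apply/funext.
  exact: integrableB.
have iC : P.-integrable setT (EFin \o (fun w => C * D n w ^+ 2)).
  have -> : EFin \o (fun w => C * D n w ^+ 2) =
      (fun w => C%:E * (EFin \o (fun w => D n w ^+ 2)%R) w)%E by apply/funext.
  exact: integrableZl.
have ie : P.-integrable setT (EFin \o (fun _ : O => e / 4)).
  exact: (@bounded_integrable _ _ _ P (fun=> e / 4) `|e / 4|).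
have iall : P.-integrable setT (EFin \o (fun w => e / 4 + C * D n w ^+ 2)).
  have -> : EFin \o (fun w => e / 4 + C * D n w ^+ 2) =
    ((EFin \o (fun=> (e / 4)%R)) \+ (EFin \o (fun w => C * D n w ^+ 2)%R))%E by apply/funext.
  exact: integrableD.
have h1 : `|\int[P]_w f n w - \int[P]_w g n w| <= e / 2.
  rewrite -RintegralB//; apply: (le_trans (le_normr_Rintegral _ ifg)) => //.
  apply: (@le_trans _ _ (\int[P]_w (e / 4 + C * D n w ^+ 2))).
    apply: le_Rintegral => //; first exact: (integrable_norm ifg).
  rewrite RintegralD// Rintegral_cst//= probability_setT mulr1 RintegralZl//.
  have : C * \int[P]_w (D n w ^+ 2) < e / 4 by near: n.
  by lra.
have h3 : `|l - \int[P]_w g n w| <= e / 4 by near: n.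
move: h1 h3; rewrite !ler_norml; lra.
Unshelve. all: by end_near. Qed.

Let Tp_Y n w : `|Tp n w - Y n w| <= `|D n w|.
Proof.
rewrite /Tp /T; have := Y0 n w; move: (Y n w) (D n w) => y x y0.
have := ler_norm x; have := ler_norm (- x); rewrite normrN => h1 h2.
by have [H|H] := leP (y + x) 0; rewrite ler_norml; lra.
Qed.

Let quadratic e x : 0 < e -> `|x| <= e + e^-1 * x ^+ 2 :> R.
Proof.
move=> e0; rewrite -(real_normK (num_real x)).
have := normr_ge0 x; move: `|x| => y y0.
have [ye|ey] := leP y e; first by rewrite ler_wpDr// mulr_ge0 ?sqr_ge0 ?invr_ge0 ?ltW.
apply: ler_wpDl; first exact: ltW.
by rewrite mulrC ler_pdivlMr// expr2 ler_wpM2l// ltW.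
Qed.

(** Cut at 0, the perturbed variable has Laplace transforms. Both the
    perturbation and the cut change the means by at most a small constant plus a
    multiple of the mean square of [D]. *)
Lemma laplace_cvg_perturbed (h : R -> R) M : continuous h ->
  (forall x, `|h x| <= M) ->
  \int[P]_w h (Y n w + D n w) @[n --> \oo] --> \int[P']_w h (A w).
Proof.
move=> ch hM; have M0 : 0 <= M by exact: le_trans (normr_ge0 _) (hM 0).
have mh : measurable_fun setT h by exact: continuous_measurable_fun.
have lapT (k : nat) : \int[P]_w expR (- (k%:R * Tp n w)) @[n --> \oo] -->
    \int[P']_w expR (- (k%:R * A w)).
  have mE (Z : nat -> O -> R) n : (forall n, measurable_fun setT (Z n)) ->
      measurable_fun setT (fun w => expR (- (k%:R * Z n w))).
    move=> mZ; apply: measurableT_comp => //; apply: measurableT_comp => //.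
    exact: measurable_funM.
  have bE x : 0 <= x -> `|expR (- (k%:R * x))| <= (1 : R).
    by move=> x0; rewrite ger0_norm ?expR_ge0// -expR0 ler_expR oppr_le0 mulr_ge0.
  apply: (@cvg_close (fun n w => expR (- (k%:R * Tp n w)))
    (fun n w => expR (- (k%:R * Y n w))) _ 1 _ _ _ _ _ (@Y_laplace k)).
  - by move=> n; exact: mE.
  - by move=> n; exact: mE.
  - by move=> n w; exact: bE.
  - by move=> n w; exact: bE.
  - move=> e e0; have k10 : 0 < k%:R + 1 :> R by rewrite ltr_wpDl.
    have ek : 0 < e / (k%:R + 1) by rewrite divr_gt0.
    exists (k%:R * (e / (k%:R + 1))^-1) => [|n w].
      by rewrite mulr_ge0// invr_ge0 ltW.
    apply: (le_trans (norm_expR_sub_le _ _)); rewrite ?mulr_ge0//.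
    rewrite -mulrBr normrM normr_nat.
    apply: (@le_trans _ _ (k%:R * (e / (k%:R + 1) + (e / (k%:R + 1))^-1 * D n w ^+ 2))).
      by rewrite ler_wpM2l// (le_trans (Tp_Y n w))// quadratic.
    rewrite mulrDr -[X in _ <= _ + X]mulrA lerD2r mulrA ler_pdivrMr// mulrC ler_wpM2l ?(ltW e0)//.
    by rewrite lerDl.
have cvT := laplace_cvg_bounded_continuous mTp mA Tp0 A0 lapT ch hM.
apply: (@cvg_close (fun n w => h (T n w)) (fun n w => h (Tp n w)) _ M _ _ _ _ _ cvT).
- by move=> n; apply: measurableT_comp => //; exact: mT.
- by move=> n; exact: measurableT_comp.
- by move=> n w; exact: hM.
- by move=> n w; exact: hM.
move=> e e0.
have /cvgrPdist_le /(_ _ e0)[r /= r0 Hr] := ch 0.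
have C0 : 0 <= 2 * M / r ^+ 2.
  by apply: divr_ge0; [exact: mulr_ge0|exact: sqr_ge0].
exists (2 * M / r ^+ 2) => // n w.
have D2 : 0 <= 2 * M / r ^+ 2 * D n w ^+ 2 by rewrite mulr_ge0 ?sqr_ge0.
rewrite -/(T n w) /Tp; have [T0|T0] := leP (T n w) 0; last first.
  by rewrite subrr normr0 addr_ge0// ltW.
have TD : `|T n w| <= `|D n w|.
  rewrite ler0_norm// /T; have := Y0 n w; move: (Y n w) (D n w) => y x.
  by have := ler_norm (- x); rewrite normrN; lra.
have [Tr|Tr] := ltP `|T n w| r.
  apply: ler_wpDr => //; rewrite distrC; apply: Hr.
  by rewrite /ball_/= sub0r normrN.
apply: ler_wpDl; first exact: ltW.
apply: (@le_trans _ _ (2 * M)).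
  by rewrite (le_trans (ler_normB _ _))// mulrDl mul1r lerD.
rewrite -[leRHS]mulrA ler_peMr ?mulr_ge0// mulrC ler_pdivlMr ?exprn_gt0// mul1r.
rewrite -(real_normK (num_real (D n w))) lerXn2r// ?nnegrE//; first exact: ltW.
exact: le_trans TD.
Qed.

End perturbation.

(** * Convergence of moments *)

Section moment_convergence.
Context d d' (O : measurableType d) (O' : measurableType d') (R : realType).
Variables (P : probability O R) (P' : probability O' R).
Local Open Scope ring_scope.
Variables (Q : nat -> O -> R) (Z : O' -> R).
Hypothesis bQ : moment_bounded P Q.
Hypothesis mZ : measurable_fun setT Z.
Hypothesis Q_cvg : forall (h : R -> R) M, continuous h -> (forall x, `|h x| <= M) ->
  \int[P]_w h (Q n w) @[n --> \oo] --> \int[P']_w h (Z w).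

Let cut (m : nat) (x : R) := Num.max (- m%:R) (Num.min x m%:R).

Let cut_continuous m : continuous (cut m).
Proof.
move=> x; apply: (@continuous_max R R (fun=> - m%:R) (fun y => Num.min y m%:R)).
  exact: cvg_cst.
by apply: (@continuous_min R R id (fun=> m%:R)); [exact: cvg_id|exact: cvg_cst].
Qed.

Let cut_le m x : `|cut m x| <= m%:R.
Proof.
have m0 : (0 : R) <= m%:R by [].
rewrite /cut; have [xm|xm] := leP x m%:R.
  by have [H|H] := leP (- m%:R) x; rewrite ler_norml; lra.
by have [H|H] := leP (- m%:R : R) m%:R; rewrite ler_norml; lra.
Qed.

Let cut_norm_le m x : `|cut m x| <= `|x|.
Proof.
have m0 : (0 : R) <= m%:R by [].
have := ler_norm x; have := ler_norm (- x); rewrite normrN.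
rewrite /cut; have [xm|xm] := leP x m%:R.
  by have [H|H] := leP (- m%:R) x; rewrite ler_norml; lra.
by have [H|H] := leP (- m%:R : R) m%:R; rewrite ler_norml; lra.
Qed.

Let cut_id m x : `|x| <= m%:R -> cut m x = x.
Proof.
rewrite ler_norml => /andP[a b]; rewrite /cut.
by rewrite min_l// max_r.
Qed.

Let cutX_continuous m r : continuous (fun x => cut m x ^+ r).
Proof.
move=> x; apply: (continuous_comp (f := cut m) (g := fun y => y ^+ r)).
  exact: cut_continuous.
exact: exprn_continuous.
Qed.

Let cutX_le m r x : `|cut m x ^+ r| <= m%:R ^+ r.
Proof. by rewrite normrX lerXn2r// nnegrE. Qed.

Let cut_norm_nd x m m' : (m <= m')%N -> `|cut m x| <= `|cut m' x|.
Proof.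
move=> mm'; have [xm|/ltW mx] := leP `|x| m%:R.
  by rewrite !cut_id// (le_trans xm)// ler_nat.
apply: (le_trans (cut_le m x)).
have [xm'|/ltW mx'] := leP `|x| m'%:R; first by rewrite cut_id.
have m0 : (0 : R) <= m'%:R by [].
have mmR : m%:R <= m'%:R :> R by rewrite ler_nat.
move: mx'; rewrite /cut.
have [x0|/ltW x0] := leP 0 x.
  rewrite ger0_norm// => mx'; rewrite min_r// max_r; last by lra.
  by rewrite ger0_norm.
rewrite ler0_norm// => mx'; rewrite min_l; last by lra.
by rewrite max_l ?normrN ?ger0_norm//; lra.
Qed.

Let mcut m p : measurable_fun setT (fun w => `|cut m (Z w)| ^+ p).
Proof.
apply: measurable_funX; apply: measurableT_comp => //.
apply: measurableT_comp => //.
by apply: continuous_measurable_fun; exact: cut_continuous.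
Qed.

Let int_cut m p C : (forall n, \int[P]_w (`|Q n w| ^+ p) <= C) ->
  (\int[P']_w (`|cut m (Z w)| ^+ p)%:E <= C%:E)%E.
Proof.
move=> HC.
have cc : continuous (fun x => `|cut m x| ^+ p).
  move=> x; apply: (continuous_comp (f := fun y => `|cut m y|) (g := fun y => y ^+ p)).
    by apply: cvg_norm; exact: cut_continuous.
  exact: exprn_continuous.
have bb x : `| `|cut m x| ^+ p | <= m%:R ^+ p.
  by rewrite normrX normr_id lerXn2r// nnegrE.
have iZ : P'.-integrable setT (EFin \o (fun w => `|cut m (Z w)| ^+ p)).
  by apply: (bounded_integrable _ (mcut m p)) => w; exact: bb.
have -> : (\int[P']_w (`|cut m (Z w)| ^+ p)%:E)%E =
    (\int[P']_w (`|cut m (Z w)| ^+ p))%:E.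
  by rewrite /Rintegral fineK//; exact: (integrable_fin_num measurableT iZ).
rewrite lee_fin; have cv := Q_cvg cc bb.
rewrite -(cvg_lim _ cv)//; apply: limr_le; first by apply/cvg_ex; eexists; exact: cv.
apply: nearW => n; apply: le_trans (HC n).
apply: le_Rintegral => //.
- apply: (@bounded_integrable _ _ _ _ _ (m%:R ^+ p)) => [|w]; last exact: bb.
  apply: (measurableT_comp (f := fun x => `|cut m x| ^+ p)); last by case: bQ.
  exact: continuous_measurable_fun.
- have := moment_bounded_integrable n (moment_boundedX p bQ).
  move/integrable_norm; apply: eq_integrable => // w _ /=.
  by rewrite normrX.
- by move=> w _; rewrite lerXn2r// nnegrE.
Qed.

(** The bounds pass to the limit for the truncations, which are bounded
    continuous functions, and then to the limit variable by monotone
    convergence. *)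
Lemma limit_moment_bounded : moment_bounded P' (fun _ : unit => Z).
Proof.
split=> [//|p]; have [C HC] := moment_bounded_Rintegral p bQ; exists C => _.
have Zlim w : limn (fun m => (`|cut m (Z w)| ^+ p)%:E) = (`|Z w| ^+ p)%:E.
  apply: (@lim_near_cst _ _ _ \oo); first exact: ereal_hausdorff.
  exists (Num.truncn `|Z w|).+1 => // m /= Hm; rewrite cut_id//.
  by rewrite ltW// (lt_le_trans (truncnS_gt _))// ler_nat.
have -> : (\int[P']_w (`|Z w| ^+ p)%:E)%E =
    (\int[P']_w limn (fun m => (`|cut m (Z w)| ^+ p)%:E))%E.
  by apply: eq_integral => w _; rewrite Zlim.
have nd m m' w : (m <= m')%N -> ((`|cut m (Z w)| ^+ p)%:E <= (`|cut m' (Z w)| ^+ p)%:E)%E.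
  by move=> mm'; rewrite lee_fin lerXn2r ?nnegrE//; exact: cut_norm_nd.
rewrite monotone_convergence//.
- apply: lime_le.
    apply: ereal_nondecreasing_is_cvgn => m m' mm'.
    apply: ge0_le_integral => //; [exact/measurable_EFinP|exact/measurable_EFinP|].
    by move=> w _; exact: nd.
  by apply: nearW => m; exact: int_cut.
- by move=> m; exact/measurable_EFinP.
- by move=> w _ m m' mm'; exact: nd.
Qed.

(** Cutting off at level [m] costs at most [2 |x| ^ (r + 1) / m], which the moment
    of order [r + 1] controls uniformly. *)
Lemma cvg_moments r : \int[P]_w (Q n w ^+ r) @[n --> \oo] --> \int[P']_w (Z w ^+ r).
Proof.
have triangle (a b a' b' x : R) : 0 < x -> `|a - b| <= x / 4 ->
    `|a' - b'| <= x / 4 -> `|b' - b| <= x / 4 -> `|a' - a| <= x.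
  by rewrite !ler_norml; lra.
have bZ := limit_moment_bounded.
have [C HC] := moment_bounded_Rintegral r.+1 bQ.
have [C' HC'] := moment_bounded_Rintegral r.+1 bZ.
have cost d0 (T : measurableType d0) (S : probability T R) (X : T -> R) (K : R) m :
    (0 < m)%N -> moment_bounded S (fun _ : unit => X) ->
    \int[S]_w (`|X w| ^+ r.+1) <= K ->
    `|\int[S]_w (X w ^+ r) - \int[S]_w (cut m (X w) ^+ r)| <= m%:R^-1 * (2 * K).
  move=> m0 bX XK; have m0' : (0 : R) < m%:R by rewrite ltr0n.
  have mX : measurable_fun setT X by have [/(_ tt)] := bX.
  have int F : moment_bounded S (fun _ : unit => F) -> S.-integrable setT (EFin \o F).
    exact: (moment_bounded_integrable tt).
  have bcst (c : R) : moment_bounded S (fun (_ : unit) (_ : T) => c).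
    exact: (moment_bounded_cst S (c := fun=> c) (fun=> lexx _)).
  have bcut : moment_bounded S (fun _ : unit => (fun w => cut m (X w))).
    apply: moment_bounded_le bX => [_|_ w]; last exact: cut_norm_le.
    apply: measurableT_comp => //; apply: continuous_measurable_fun.
    exact: cut_continuous.
  have bd : moment_bounded S (fun _ : unit => (fun w => X w ^+ r - cut m (X w) ^+ r)).
    by apply: moment_boundedB; exact: moment_boundedX.
  have bn : moment_bounded S (fun _ : unit => (fun w => `|X w| ^+ r.+1)).
    apply: moment_boundedX; apply: moment_bounded_le bX => [_|_ w].
      exact: measurableT_comp.
    by rewrite normr_id.
  rewrite -RintegralB//; [|by apply: int; exact: moment_boundedX..].
  apply: (le_trans (le_normr_Rintegral _ (int _ bd))) => //.
  apply: (@le_trans _ _ (\int[S]_w (m%:R^-1 * (2 * `|X w| ^+ r.+1)))).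
    apply: le_Rintegral => //.
    - exact: (integrable_norm (int _ bd)).
    - by apply: int; apply: moment_boundedM => //; exact: moment_boundedM.
    - move=> w _; have [Xm|/ltW mX'] := leP `|X w| m%:R.
        by rewrite cut_id// subrr normr0 mulr_ge0 ?invr_ge0 ?(ltW m0').
      apply: (@le_trans _ _ (2 * `|X w| ^+ r)).
        rewrite (le_trans (ler_normB _ _))// !normrX mulrDl mul1r lerD2l.
        by rewrite lerXn2r ?nnegrE.
      rewrite [leRHS]mulrC ler_pdivlMr// exprS -mulrA ler_wpM2l// mulrC.
      by rewrite ler_wpM2r// exprn_ge0.
  rewrite RintegralZl//; last by apply: int; exact: moment_boundedM.
  rewrite RintegralZl//; last exact: int.
  by rewrite ler_wpM2l ?invr_ge0 ?(ltW m0')// ler_wpM2l.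
apply/cvgrPdist_le => e e0.
have e4 : 0 < e / 4 by rewrite divr_gt0.
pose K := Num.max (2 * C) (2 * C').
pose m := (Num.truncn (K / (e / 4))).+1.
have m0 : (0 < m)%N by [].
have Km c : c <= K -> m%:R^-1 * c <= e / 4.
  move=> cK; rewrite mulrC ler_pdivrMr ?ltr0n// mulrC -ler_pdivrMr//.
  apply: ltW; apply: le_lt_trans (truncnS_gt _).
  by rewrite ler_wpM2r// invr_ge0 ltW.
have cv := Q_cvg (cutX_continuous (m := m) (r := r)) (cutX_le m r).
have /cvgrPdist_le /(_ _ e4) nearc := cv.
near=> n.
have bQn : moment_bounded P (fun _ : unit => Q n).
  exact: (moment_bounded_comp (fun _ : unit => n) bQ).
have h1 : `|\int[P]_w (Q n w ^+ r) - \int[P]_w (cut m (Q n w) ^+ r)| <= e / 4.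
  apply: le_trans (cost _ _ _ _ _ _ m0 bQn (HC n)) (Km _ _).
  by rewrite le_max lexx.
have h2 : `|\int[P']_w (Z w ^+ r) - \int[P']_w (cut m (Z w) ^+ r)| <= e / 4.
  apply: le_trans (cost _ _ _ _ _ _ m0 bZ (HC' tt)) (Km _ _).
  by rewrite le_max lexx orbT.
have h3 : `|\int[P']_w (cut m (Z w) ^+ r) - \int[P]_w (cut m (Q n w) ^+ r)| <= e / 4.
  by near: n.
exact: triangle e0 h1 h2 h3.
Unshelve. all: by end_near. Qed.

End moment_convergence.

(** * The Laplace transform of the Gamma law *)

Section gamma_transform.
Context {R : realType}.
Local Notation leb := (@lebesgue_measure R).

(** The rescaled Lebesgue measure agrees with Lebesgue measure on intervals. *)
Lemma ge0_integral_lebesgue_scale (c : R) (g : R -> \bar R) : (0 < c)%R ->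
  measurable_fun setT g -> (forall x, 0 <= g x) ->
  \int[leb]_x g x = c%:E * \int[leb]_x g (c * x)%R.
Proof.
move=> c0 mg g0.
pose phi : measurableTypeR R -> measurableTypeR R := fun x => (c * (x : R))%R.
have mphi : measurable_fun [set: measurableTypeR R] phi by exact: measurable_funM.
pose phiM : {mfun measurableTypeR R >-> measurableTypeR R} :=
  HB.pack phi (isMeasurableFun.Build _ _ _ _ phi mphi).
pose k : {nonneg R} := NngNum (ltW c0).
have E (A : set (measurableTypeR R)) : measurable A ->
    leb A = mscale k (pushforward leb phiM) A.
  move=> mA; apply: (lebesgue_measure_unique _ mA) => _ [[a b] _ <-].
  rewrite -[RHS]/(c%:E * leb (phi @^-1` `]a, b])).
  rewrite (_ : phi @^-1` `]a, b] = `](a / c)%R, (b / c)%R]%classic); last first.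
    apply/seteqP; split=> x; rewrite /phi/= !in_itv/= ltr_pdivrMr// ler_pdivlMr//;
      by rewrite mulrC.
  rewrite !lebesgue_measure_itv/= !lte_fin ltr_pM2r ?invr_gt0//.
  case: ifP => _; last by rewrite mule0.
  by rewrite -!EFinB -EFinM -mulrBl mulrCA divff ?mulr1// gt_eqF.
rewrite (eq_measure_integral (mscale k (pushforward leb phiM))); last first.
  by move=> A mA _; exact: E.
rewrite ge0_integral_mscale//; congr (_ * _).
by rewrite ge0_integral_pushforward.
Qed.

(** The law is dominated by Lebesgue measure, and its Radon-Nikodym derivative is
    almost everywhere the density. *)
Lemma ge0_expectation_density d (O : measurableType d) (P : probability O R)
    (X : {RV P >-> R}) (pdf g : R -> R) (M : R) :
  (forall A, measurable A -> distribution P X A = \int[leb]_(x in A) (pdf x)%:E) ->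
  measurable_fun setT pdf -> (forall x, 0 <= pdf x)%R ->
  measurable_fun setT g -> (forall x, `|g x| <= M)%R ->
  \int[P]_w (g (X w))%:E = \int[leb]_x ((g x)%:E * (pdf x)%:E).
Proof.
move=> XE mpdf pdf0 mg gM.
have mpdfE : measurable_fun setT (EFin \o pdf) by exact/measurable_EFinP.
have mgE : measurable_fun setT (EFin \o g) by exact/measurable_EFinP.
have mX : measurable_fun setT (X : O -> measurableTypeR R) by exact: (measurable_funP X).
pose X' : {mfun O >-> measurableTypeR R} :=
  HB.pack (X : O -> measurableTypeR R) (isMeasurableFun.Build _ _ _ _ _ mX).
pose nu : probability (measurableTypeR R) R := distribution P (X' : {RV P >-> _}).
have nuE A : measurable A -> nu A = \int[leb]_(x in A) (pdf x)%:E by exact: XE.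
have dom : nu `<< leb.
  apply/null_content_dominatesP => A mA A0; rewrite nuE//.
  by apply: null_set_integral => //; exact: measurable_funTS.
have ipdf : leb.-integrable setT (EFin \o pdf).
  apply/integrableP; split => //.
  under eq_integral do rewrite /= ger0_norm//.
  by rewrite -nuE// probability_setT ltry.
have ig : nu.-integrable setT (EFin \o g).
  exact: (@bounded_integrable _ _ _ nu g M).
transitivity (\int[nu]_x (g x)%:E).
  have igX : P.-integrable setT ((EFin \o g) \o X).
    apply: (@bounded_integrable _ _ _ P (g \o X) M) => //.
      exact: measurableT_comp.
    by move=> w; exact: gM.
  by rewrite -[LHS](@integral_distribution _ _ _ _ _ P X' _ mgE igX).
rewrite -(Radon_Nikodym_change_of_variables dom measurableT ig).
apply: ae_eq_integral => //.
- exact: emeasurable_funM.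
- exact: emeasurable_funM.
- apply: ae_eqe_mul2l => /=.
  rewrite Radon_NikodymE//=.
  case: cid => /= h [h1 h2 h3].
  apply: integral_ae_eq => //=.
  by move=> E _ mE; rewrite -h3//= -nuE.
Qed.

Lemma measurable_gamma_pdf (a : R) : measurable_fun setT (gamma_pdf a).
Proof.
apply: measurable_fun_ifT => //; first exact: measurable_fun_ltr.
apply: measurable_funM => //; apply: measurable_funM; last first.
  by apply: measurableT_comp => //; exact: measurableT_comp.
exact: measurable_powR.
Qed.

Lemma gamma_pdf_ge0 (a x : R) : (0 <= gamma_pdf a x)%R.
Proof.
rewrite /gamma_pdf; case: ifP => // _.
rewrite divr_ge0 ?mulr_ge0 ?powR_ge0 ?expR_ge0//.
by apply: Rintegral_ge0 => y _; rewrite mulr_ge0 ?powR_ge0 ?expR_ge0.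
Qed.

(** The density at [c * x] is, up to the factor [c ^ (a - 1)], the density at [x]
    times [exp (- (c - 1) x)]: the transform is a rescaling of the total mass. It
    is taken at the positive part, almost surely equal to [X], since the
    exponential is bounded there. *)
Lemma gamma_laplace d (O : measurableType d) (P : probability O R)
    (a : R) (X : {RV P >-> R}) (t : R) : (0 <= t)%R -> gamma_distributed a X ->
  (\int[P]_w expR (- (t * Num.max (X w) 0)) = (1 + t) `^ (- a))%R.
Proof.
move=> t0 Xa; have c0 : (0 < 1 + t)%R by rewrite ltr_wpDr.
have mm : measurable_fun setT (fun x : R => Num.max x 0%R).
  by apply: measurable_maxr.
have mg : measurable_fun setT (fun x : R => expR (- (t * Num.max x 0))%R).
  apply: measurableT_comp => //; apply: measurableT_comp => //.
  exact: measurable_funM.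
have gM x : (`|expR (- (t * Num.max x 0))| <= 1 :> R)%R.
  by rewrite ger0_norm ?expR_ge0// -expR0 ler_expR oppr_le0 mulr_ge0// le_max lexx orbT.
have mpdf := measurable_gamma_pdf a.
rewrite /Rintegral (ge0_expectation_density Xa mpdf (@gamma_pdf_ge0 a) mg gM).
have mass : \int[leb]_x (gamma_pdf a x)%:E = 1.
  by rewrite -Xa//; exact: (probability_setT (distribution P X)).
have E x : (expR (- (t * Num.max x 0)))%:E * (gamma_pdf a x)%:E =
    ((1 + t) `^ (1 - a))%:E * (gamma_pdf a ((1 + t) * x))%:E.
  rewrite -!EFinM; congr EFin; rewrite /gamma_pdf pmulr_rgt0//.
  case: ifP => x0; last by rewrite !mulr0.
  rewrite max_l ?ltW// powRM ?(ltW c0) ?(ltW x0)//.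
  have -> : (expR (- ((1 + t) * x)) = expR (- (t * x)) * expR (- x))%R.
    by rewrite -expRD; congr expR; ring.
  have -> : ((1 + t) `^ (1 - a) = ((1 + t) `^ (a - 1))^-1)%R.
    by rewrite -powRN opprB.
  have u0 : ((1 + t) `^ (a - 1) != 0)%R by rewrite gt_eqF// powR_gt0.
  move: (_ `^ _)%R (x `^ _)%R (expR _) (expR _) (gamma_fun a) u0 => u v y z g u0.
  rewrite !mulrA; congr (_ / _)%R.
  by field.
under eq_integral do rewrite E.
have mE : measurable_fun setT (fun x => (gamma_pdf a ((1 + t) * x))%:E).
  apply/measurable_EFinP; apply: measurableT_comp => //; exact: measurable_funM.
rewrite ge0_integralZl//; last 2 first.
- by move=> x _; rewrite lee_fin gamma_pdf_ge0.
- by rewrite lee_fin powR_ge0.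
have := ge0_integral_lebesgue_scale c0 (g := fun x => (gamma_pdf a x)%:E).
rewrite mass => H; have {}H : 1 = (1 + t)%:E * \int[leb]_x (gamma_pdf a ((1 + t) * x))%:E.
  by apply: H => [|x]; [exact/measurable_EFinP|rewrite lee_fin gamma_pdf_ge0].
have -> : \int[leb]_x (gamma_pdf a ((1 + t) * x))%:E = ((1 + t)^-1)%:E.
  move: H; case: (\int[leb]_x _) => [r| |]; last 2 first.
  - by rewrite gt0_muley ?lte_fin.
  - by rewrite gt0_muleNy ?lte_fin.
  by move=> [] H; congr EFin; apply: (mulfI (lt0r_neq0 c0)); rewrite -H divff ?gt_eqF.
rewrite -EFinM/= -[X in (_ * X)%R]powR_inv1 ?(ltW c0)// -powRD.
  by congr (_ `^ _)%R; ring.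
by rewrite (gt_eqF c0) implybT.
Qed.

End gamma_transform.

(** * Elementary kernels in the second chaos *)

Section elementary_kernels.
Context d dO (T : measurableType d) (O : measurableType dO) (R : realType).
Variables (P : probability O R) (mu : {sigma_finite_measure set T -> \bar R}).

Lemma measurable_point_measure (A : set T) : measurable A ->
  measurable_fun setT (fun chi : point_measure_space T R => pm_measure chi A).
Proof.
move=> mA _ B mB; rewrite setTI; apply: sub_sigma_algebra.
by exists A => //; exists B => //; rewrite setTI.
Qed.

Lemma measurable_compensated (A : set T) : measurable A ->
  measurable_fun setT (fun chi : point_measure_space T R => compensated mu chi A).
Proof.
move=> mA; apply: measurable_funB => //; apply: measurableT_comp => //.
exact: measurable_point_measure.
Qed.

Lemma measurable_odk_integral (e : off_diagonal_kernel mu) :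
  measurable_fun setT (fun chi : point_measure_space T R => odk_integral e chi).
Proof.
apply: measurable_sum => i; apply: measurable_sum => j.
apply: measurable_funM; last by apply: measurable_compensated; exact: odk_measurable.
apply: measurable_funM => //.
by apply: measurable_compensated; exact: odk_measurable.
Qed.

Lemma Lfun_indic d' (T' : measurableType d') (nu : {measure set T' -> \bar R})
  (A : set T') (p : R) : measurable A -> nu A < +oo -> (1 <= p)%R ->
  \1_A \in Lfun nu p%:E.
Proof.
move=> mA Aoo p1; have p0 : (0 < p)%R by exact: lt_le_trans p1.
rewrite inE; apply/andP; split; rewrite inE/=; first exact: measurable_indic.
rewrite /finite_norm unlock/= poweR_lty//.
rewrite (eq_integral (fun x => (\1_A x)%:E)) ?integral_indic ?setIT//.
move=> x _; rewrite indicE; case: (x \in A); rewrite ?normr1 ?powR1// normr0.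
by rewrite powR0// gt_eqF.
Qed.

Lemma odk_fun_L2_sym (e : off_diagonal_kernel mu) : L2_sym mu (odk_fun e).
Proof.
split; last first.
  apply: nearW => -[x y]; rewrite /odk_fun/= exchange_big/=.
  apply: eq_bigr => i _; apply: eq_bigr => j _.
  by rewrite odk_sym mulrAC.
have -> : odk_fun e = (\sum_(i < odk_size e) \sum_(j < odk_size e)
    odk_coef i j \o* \1_(odk_set i `*` odk_set j))%R.
  apply/funext => -[x y]; rewrite /odk_fun fct_sumE; apply: eq_bigr => i _.
  rewrite fct_sumE; apply: eq_bigr => j _ /=.
  rewrite -mulrA mulrC !indicE in_setX/=; congr (_ * _)%R.
  by case: (_ \in _); case: (_ \in _); rewrite /= ?mul0r ?mulr0 ?mulr1.
have p1 : 1 <= (2 : R)%:E by rewrite lee_fin ler1n.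
have [L0 LD] := Lfun_addr_closed (mu \x mu) p1.
elim/big_ind : _ => // i _; elim/big_ind : _ => // j _.
apply: Lfun_scale; first by rewrite ler1n.
have mi := odk_measurable i; have mj := odk_measurable j.
apply: Lfun_indic; [exact: measurableX| |by rewrite ler1n].
rewrite /= product_measure1E// lte_mul_pinfty ?ge0_fin_numE ?odk_finite//.
Qed.

(** An elementary kernel is its own approximating sequence. *)
Lemma chaos2_odk_integral (eta : O -> point_measure T R) (e : off_diagonal_kernel mu) :
  (odk_integral e \o eta) \in Lfun P 2%:E -> chaos2 P mu eta (odk_integral e \o eta).
Proof.
move=> L2; exists (odk_fun e); first exact: odk_fun_L2_sym.
split=> //; exists (fun=> e); split.
  rewrite (_ : (fun k => _) = cst 0); first exact: cvg_cst.
  apply/funext => k; rewrite (_ : EFin \o _ = cst 0) ?Lnorm0//.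
  by apply/funext => x /=; rewrite subrr.
rewrite (_ : (fun k => _) = cst 0); first exact: cvg_cst.
apply/funext => k; rewrite (_ : EFin \o _ = cst 0) ?Lnorm0//.
by apply/funext => x /=; rewrite subrr.
Qed.

End elementary_kernels.

(** * Blocks of unit cells *)

Section poisson_cells.
Context dT dO (T : measurableType dT) (O : measurableType dO) (R : realType).
Variables (P : probability O R) (mu : {sigma_finite_measure set T -> \bar R}).
Variable eta : {mfun O >-> point_measure_space T R}.
Hypothesis eta_poisson : poisson_random_measure P mu eta.

Lemma measurable_eta (A : set T) : measurable A ->
  measurable_fun setT (fun w => pm_measure (eta w) A).
Proof.
move=> mA; apply: (measurableT_comp (f := fun chi : point_measure_space T R =>
  pm_measure chi A)) => //.
exact: measurable_point_measure.
Qed.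

Lemma poisson_variable_eta (A : set T) (lambda : R) : measurable A ->
  (0 < lambda)%R -> mu A = lambda%:E ->
  poisson_variable P lambda (fun w => pm_measure (eta w) A).
Proof.
move=> mA l0 muA; split=> [|//|k]; first exact: measurable_eta.
have [H _ _] := eta_poisson; rewrite H ?muA ?ltry//=.
by rewrite /poisson_prob l0 esum_set1// lee_fin poisson_pmf_ge0.
Qed.

Variable U : nat -> set T.
Hypothesis mU : forall j, measurable (U j).
Hypothesis muU : forall j, mu (U j) = 1.
Hypothesis tU : trivIset setT U.

(** An almost sure event, on which counts are real numbers and add up. *)
Definition finite_cells := \bigcap_j \bigcup_(k : nat) [set w | pm_measure (eta w) (U j) = k%:R%:E].

Lemma measurable_finite_cells : measurable finite_cells.
Proof.
apply: bigcapT_measurable => j; apply: bigcupT_measurable => k.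
exact/measurable_value/measurable_eta.
Qed.

Lemma finite_cells_ae : P (~` finite_cells) = 0.
Proof.
apply/negligibleP; first exact/measurableC/measurable_finite_cells.
rewrite /finite_cells setC_bigcap; apply: negligible_bigcup => j.
have mj : measurable (\bigcup_k [set w | pm_measure (eta w) (U j) = k%:R%:E]).
  by apply: bigcupT_measurable => k; exact/measurable_value/measurable_eta.
apply/negligibleP; first exact: measurableC.
rewrite /= probability_setC//.
by rewrite (poisson_natural ltr01 (poisson_variable_eta (mU j) ltr01 (muU j))) subee.
Qed.

Lemma probability_ae_eq (E E' : set O) : measurable E -> measurable E' ->
  (forall w, finite_cells w -> E w <-> E' w) -> P E = P E'.
Proof.
move=> mE mE' EE'; have mG := measurable_finite_cells.
have H (F : set O) : measurable F -> P F = P (F `&` finite_cells).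
  move=> mF; rewrite (measureDI P mF mG).
  rewrite (@subset_measure0 _ _ _ P (F `\` finite_cells) (~` finite_cells))//.
  - by rewrite add0e.
  - exact: measurableD.
  - exact: measurableC.
  - exact: finite_cells_ae.
rewrite H// [RHS]H//; congr (P _); apply/seteqP; split=> w [Ew Gw]; split=> //;
  exact/EE'.
Qed.

Variable d : nat.
Hypothesis d0 : (0 < d)%N.

(** Residues modulo [d] make the [d] blocks grow together inside a single
    sequence of cells. *)
Definition cell (k : 'I_d) (i : nat) := U (k + d * i).

Lemma cell_inj (k k' : 'I_d) (i i' : nat) : (k + d * i = k' + d * i')%N ->
  k = k' /\ i = i'.
Proof.
move=> E; have Ek : k = k'.
  apply: val_inj => /=; have := congr1 (modn^~ d) E.
  by rewrite !(mulnC d) ![(_ + _ * d)%N]addnC !modnMDl !modn_small.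
split=> //; move: E; rewrite Ek => /addnI/eqP.
by rewrite eqn_mul2l gtn_eqF//= => /eqP.
Qed.

Definition block n (k : 'I_d) := \big[setU/set0]_(i < n.+1) cell k i.

Lemma measurable_block n k : measurable (block n k).
Proof. by apply: bigsetU_measurable => i _; exact: mU. Qed.

Lemma cell_disjoint (k k' : 'I_d) (i i' : nat) x : cell k i x -> cell k' i' x ->
  k = k' /\ i = i'.
Proof.
move=> xi xj; apply: cell_inj; apply: (tU I I).
by exists x.
Qed.

Lemma trivIset_cell k n : trivIset setT (fun i : 'I_n => cell k i).
Proof.
move=> i j _ _ [x [xi xj]]; apply: val_inj.
by have [] := cell_disjoint xi xj.
Qed.

Lemma trivIset_block n : trivIset setT (block n).
Proof.
move=> k k' _ _ [x []]; rewrite /block -!bigcup_mkord => -[i _ xi] [j _ xj].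
by have [] := cell_disjoint xi xj.
Qed.

Lemma mu_block n k : mu (block n k) = n.+1%:R%:E.
Proof.
rewrite /block measure_bigsetU_ord//; [|by move=> i; exact: mU|exact: trivIset_cell].
rewrite (eq_bigr (fun=> 1)) => [|i _]; last exact: muU.
by rewrite sumEFin sumr_const card_ord.
Qed.

(** Read off the cells rather than the union, with which it agrees almost surely:
    the standardized count of a block is then everywhere the normalized sum of
    those of its cells. *)
Definition block_count n (k : 'I_d) (w : O) : \bar R :=
  (\sum_(i < n.+1) fine (pm_measure (eta w) (cell k i)))%:E.

Lemma measurable_block_count n k : measurable_fun setT (block_count n k).
Proof.
apply/measurable_EFinP; apply: measurable_sum => i; apply: measurableT_comp => //.
exact/measurable_eta/mU.
Qed.

Lemma block_count_eta n k w : finite_cells w ->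
  pm_measure (eta w) (block n k) = block_count n k w.
Proof.
move=> Gw; rewrite /block measure_bigsetU_ord//; [|by move=> i; exact: mU|exact: trivIset_cell].
rewrite /block_count -sumEFin; apply: eq_bigr => i _.
by have [j _ /= E] := Gw (k + d * i)%N I; rewrite /cell E.
Qed.

Lemma poisson_block_count n k : poisson_variable P n.+1%:R (block_count n k).
Proof.
split=> [|w|j]; first exact: measurable_block_count.
  by rewrite lee_fin sumr_ge0// => i _; rewrite fine_ge0.
have n0 : (0 < n.+1%:R :> R)%R by rewrite ltr0n.
have [mY _ <-] := poisson_variable_eta (measurable_block n k) n0 (mu_block n k).
apply: probability_ae_eq.
- exact/measurable_value/measurable_block_count.
- exact: measurable_value.
- by move=> w Gw /=; rewrite block_count_eta.
Qed.

Lemma independent_block_count n (B : 'I_d -> set (\bar R)) :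
  (forall k, measurable (B k)) ->
  P (\bigcap_(k in [set: 'I_d]) [set w | B k (block_count n k w)])
    = \prod_(k < d) P [set w | B k (block_count n k w)].
Proof.
move=> mB.
have m1 k : measurable [set w | B k (block_count n k w)].
  by rewrite -[X in measurable X]setTI; exact: measurable_block_count.
have m2 k : measurable [set w | B k (pm_measure (eta w) (block n k))].
  rewrite -[X in measurable X]setTI.
  by apply: (measurable_eta (measurable_block n k)).
transitivity (P (\bigcap_(k in [set: 'I_d])
    [set w | B k (pm_measure (eta w) (block n k))])).
  apply: probability_ae_eq; [exact: fin_bigcap_measurable|exact: fin_bigcap_measurable|].
  move=> w Gw; split=> H k _ /=; have := H k I => /=; by rewrite block_count_eta.
have [_ _ ind] := eta_poisson.
rewrite (ind _ _ (measurable_block n) (@trivIset_block n) _ mB).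
apply: eq_bigr => k _; apply: probability_ae_eq => // w Gw /=.
by rewrite block_count_eta.
Qed.

End poisson_cells.

(** * The off-diagonal kernel of the blocks and its gradient *)

Section chi_square_sequence.
Context dT dO (T : measurableType dT) (O : measurableType dO) (R : realType).
Variables (P : probability O R) (mu : {sigma_finite_measure set T -> \bar R}).
Variable eta : {mfun O >-> point_measure_space T R}.
Hypothesis eta_poisson : poisson_random_measure P mu eta.
Variable U : nat -> set T.
Hypothesis mU : forall j, measurable (U j).
Hypothesis muU : forall j, mu (U j) = 1.
Hypothesis tU : trivIset setT U.
Variable d : nat.
Hypothesis d0 : (0 < d)%N.

Local Open Scope ring_scope.

Section kernel.
Variable n : nat.
Let I : finType := ('I_d * 'I_n.+1)%type.
Implicit Types x y : I.

Let cellI x := cell U x.1 x.2.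

(** The matrix of the projection onto vectors that are constant on each block,
    with its diagonal replaced by 0. *)
Definition block_coef x y : R := n.+1%:R^-1 * ((x.1 == y.1)%:R - (x == y)%:R).

Let mcellI x : measurable (cellI x). Proof. exact: mU. Qed.

Let cellI_disjoint x y z : cellI x z -> cellI y z -> x = y.
Proof.
move=> xz yz; have [Ek Ei] := cell_disjoint tU d0 xz yz.
by case: x y Ek Ei {xz yz} => [k i] [k' i'] /= -> /val_inj ->.
Qed.

Let cells_finite (j : 'I_#|I|) : (mu (cellI (enum_val j)) < +oo)%E.
Proof. by rewrite muU ltry. Qed.

Let cells_trivIset : trivIset setT (fun j : 'I_#|I| => cellI (enum_val j)).
Proof.
by move=> i j _ _ [z [iz jz]]; apply: enum_val_inj; exact: cellI_disjoint iz jz.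
Qed.

Let coef_sym (i j : 'I_#|I|) :
  block_coef (enum_val i) (enum_val j) = block_coef (enum_val j) (enum_val i).
Proof. by rewrite /block_coef eq_sym (eq_sym (enum_val i)). Qed.

Let coef_diag (i : 'I_#|I|) : block_coef (enum_val i) (enum_val i) = 0.
Proof. by rewrite /block_coef !eqxx subrr mulr0. Qed.

Definition block_kernel : off_diagonal_kernel mu := OffDiagonalKernel
  (odk_set := fun j : 'I_#|I| => cellI (enum_val j))
  (fun j => mcellI (enum_val j)) cells_finite cells_trivIset coef_sym coef_diag.

Lemma block_kernel_integral (chi : point_measure T R) :
  odk_integral block_kernel chi = \sum_x \sum_y block_coef x y *
    compensated mu chi (cellI x) * compensated mu chi (cellI y).
Proof.
rewrite /odk_integral/= [RHS]big_enum_val/=; apply: eq_bigr => i _.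
by rewrite [RHS]big_enum_val.
Qed.

Lemma sum_block_coef x (c : I -> R) : \sum_y block_coef x y * c y =
  n.+1%:R^-1 * (\sum_(i < n.+1) c (x.1, i) - c x).
Proof.
rewrite /block_coef; under eq_bigr do rewrite -mulrA mulrBl.
rewrite -mulr_sumr big_split/= sumrN; congr (_ * (_ - _)).
  transitivity (\sum_k \sum_i (x.1 == k)%:R * c (k, i)).
    by rewrite pair_bigA/=; apply: eq_bigr => -[].
  rewrite (bigD1 x.1)//= [X in _ + X]big1 ?addr0 => [|k kx].
    by apply: eq_bigr => i _; rewrite eqxx mul1r.
  by apply: big1 => i _; rewrite eq_sym (negbTE kx) mul0r.
rewrite (bigD1 x)//= eqxx mul1r big1 ?addr0// => y yx.
by rewrite eq_sym (negbTE yx) mul0r.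
Qed.

(** This is 1 for a finite count, and 0 for an infinite one because [fine +oo] is
    0. The bound by 1 holds in both cases, hence for every configuration. *)
Definition count_increment (y : \bar R) : R := fine (y + 1)%E - fine y.

Lemma count_increment_le1 (y : \bar R) : `|count_increment y| <= 1.
Proof.
rewrite /count_increment; case: y => [r| |] /=; rewrite ?subrr ?normr0//.
by rewrite addrAC subrr add0r normr1.
Qed.

Definition block_gradient x (chi : point_measure T R) : R :=
  2 * count_increment (chi (cellI x)) *
  \sum_y block_coef x y * compensated mu chi (cellI y).

Let compensated_add_point chi z x :
  compensated mu (add_point chi z) (cellI x) =
  compensated mu chi (cellI x) +
    \1_(cellI x) z * count_increment (chi (cellI x)).
Proof.
have E : (add_point chi z (cellI x) = chi (cellI x) + \d_z (cellI x))%E.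
  exact: measure_addE.
rewrite /compensated E diracE indicE.
case: (z \in _) => /=; last by rewrite adde0 mul0r addr0.
by rewrite mul1r /count_increment; ring.
Qed.

(** A point lies in at most one cell and the kernel vanishes on the diagonal, so
    that the increment is linear in the compensated counts. *)
Lemma add_one_cost_block_kernel chi z :
  add_one_cost (odk_integral block_kernel) z chi =
  \sum_x \1_(cellI x) z * block_gradient x chi.
Proof.
rewrite /add_one_cost !block_kernel_integral.
under eq_bigr do under eq_bigr do rewrite !compensated_add_point.
have [[x0 x0z]|nz] := pselect (exists x0, cellI x0 z); last first.
  have z0 x : \1_(cellI x) z = 0 :> R.
    by rewrite indicE memNset// => xz; apply: nz; exists x.
  rewrite [RHS]big1 => [|x _]; last by rewrite z0 mul0r.
  apply/eqP; rewrite subr_eq0; apply/eqP; apply: eq_bigr => x _.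
  by apply: eq_bigr => y _; rewrite !z0 !mul0r !addr0.
have zx x : \1_(cellI x) z = (x == x0)%:R :> R.
  rewrite indicE; have [->|xx0] := eqVneq x x0; first by rewrite mem_set.
  by rewrite memNset// => xz; move/eqP: xx0; apply; exact: cellI_disjoint xz x0z.
rewrite [RHS](bigD1 x0)//= zx eqxx mul1r [X in _ = _ + X]big1; last first.
  by move=> x xx0; rewrite zx (negbTE xx0) mul0r.
rewrite addr0.
under eq_bigr do under eq_bigr do rewrite !zx.
set c := fun x => compensated mu chi (cellI x).
set g := fun x => count_increment (chi (cellI x)).
rewrite -/(c x0) /block_gradient -/(g x0).
have E x y : block_coef x y * (c x + (x == x0)%:R * g x) * (c y + (y == x0)%:R * g y) =
    block_coef x y * c x * c y + (x == x0)%:R * (g x * (block_coef x y * c y))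
    + (y == x0)%:R * (g y * (block_coef y x * c x))
    + (x == x0)%:R * ((y == x0)%:R * (block_coef x y * g x * g y)).
  have -> : block_coef y x = block_coef x y by rewrite /block_coef eq_sym (eq_sym y).
  ring.
under eq_bigr do under eq_bigr do rewrite -/(c _) -/(g _) E.
have pick (u : I -> R) : \sum_x (x == x0)%:R * u x = u x0.
  rewrite (bigD1 x0)//= eqxx mul1r big1 ?addr0// => x xx0.
  by rewrite (negbTE xx0) mul0r.
under eq_bigr do rewrite !big_split/= -!mulr_sumr pick.
rewrite !big_split/= !pick.
have -> : \sum_x g x0 * (block_coef x0 x * c x) = g x0 * \sum_x block_coef x0 x * c x.
  by rewrite mulr_sumr.
have -> : block_coef x0 x0 = 0 by rewrite /block_coef !eqxx subrr mulr0.
by rewrite /c /g; ring.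
Qed.

End kernel.

End chi_square_sequence.

(** * The approximating sequence *)

Section chi_square_moments.
Context dT dO (T : measurableType dT) (O : measurableType dO) (R : realType).
Variables (P : probability O R) (mu : {sigma_finite_measure set T -> \bar R}).
Variable eta : {mfun O >-> point_measure_space T R}.
Hypothesis eta_poisson : poisson_random_measure P mu eta.
Variable U : nat -> set T.
Hypothesis mU : forall j, measurable (U j).
Hypothesis muU : forall j, mu (U j) = 1.
Hypothesis tU : trivIset setT U.
Variable d : nat.
Hypothesis d0 : (0 < d)%N.

Local Open Scope ring_scope.

Let W (j : nat) := standardized 1 (fun w => pm_measure (eta w) (U j)).
Let S (n : nat) (k : 'I_d) := standardized n.+1%:R (block_count eta U n k).
Let V (n : nat) (k : 'I_d) (w : O) : R :=
  (\sum_(i < n.+1) W (k + d * i)%N w ^+ 2) / n.+1%:R.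

Let n1 n : (1 : R) <= n.+1%:R. Proof. by rewrite ler1n. Qed.
Let n0 n : (0 : R) < n.+1%:R. Proof. by rewrite ltr0n. Qed.
Let sqrt0 n : 0 < Num.sqrt (n.+1%:R : R). Proof. by rewrite sqrtr_gt0. Qed.

Let poissonS n (k : 'I_d) : poisson_variable P n.+1%:R (block_count eta U n k).
Proof. exact: (poisson_block_count eta_poisson mU muU tU d0). Qed.

Let poissonW j : poisson_variable P 1 (fun w => pm_measure (eta w) (U j)).
Proof. exact: (poisson_variable_eta eta_poisson (mU j) ltr01 (muU j)). Qed.

Let W_compensated j w : compensated mu (eta w) (U j) = W j w.
Proof. by rewrite /W /standardized /compensated muU sqrtr1 divr1. Qed.

Let S_sum n k w : S n k w = (\sum_(i < n.+1) W (k + d * i)%N w) / Num.sqrt n.+1%:R.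
Proof.
rewrite /S /standardized /block_count/=; congr (_ / _).
under [RHS]eq_bigr do rewrite /W /standardized sqrtr1 divr1.
by rewrite big_split/= sumrN sumr_const card_ord.
Qed.

Let bS : moment_bounded P (fun i : nat * 'I_d => S i.1 i.2).
Proof.
exact: (standardized_moment_bounded (lam := fun i : nat * 'I_d => i.1.+1%:R)
  (fun i => n1 i.1) (fun i => poissonS i.1 i.2)).
Qed.

Let bW : moment_bounded P W.
Proof.
exact: (standardized_moment_bounded (lam := fun _ : nat => 1) (fun=> lexx 1) poissonW).
Qed.

Let bV : moment_bounded P (fun i : nat * 'I_d => V i.1 i.2).
Proof.
have := @moment_bounded_mean _ _ _ P (nat * 'I_d)%type nat (fun j w => W j w ^+ 2)
  (fun i => i.1.+1) (fun i j => i.2 + d * j)%N (fun=> isT).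
by apply; exact: moment_boundedX.
Qed.

(** The limit law is that of the sum of [N_k ^ 2 - 1] for independent standard
    Gaussian [N_k], [k < d]; the standardized count of a block stands for [N_k]. *)
Definition chi_square_integral n (chi : point_measure T R) : R :=
  odk_integral (block_kernel mU muU tU d0 n) chi.

(* In a block, the off-diagonal sum of products is the square of the sum minus the
   sum of the squares. *)
Let Q_sum n w : chi_square_integral n (eta w) =
  \sum_(k < d) (S n k w ^+ 2 - V n k w).
Proof.
rewrite /chi_square_integral block_kernel_integral.
pose c (x : 'I_d * 'I_n.+1) := W (x.1 + d * x.2)%N w.
transitivity (\sum_x (c x * (n.+1%:R^-1 * (\sum_(i < n.+1) c (x.1, i) - c x)))).
  apply: eq_bigr => x _; rewrite -sum_block_coef mulr_sumr; apply: eq_bigr => y _.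
  by rewrite /cell !W_compensated -/(c x) -/(c y); ring.
transitivity (\sum_k \sum_i (c (k, i) *
    (n.+1%:R^-1 * (\sum_(i < n.+1) c (k, i) - c (k, i))))).
  by rewrite pair_bigA/=; apply: eq_bigr => -[].
apply: eq_bigr => k _; rewrite S_sum /V exprMn exprVn sqr_sqrtr ?ltW//.
rewrite -mulrBl [RHS]mulrC.
under eq_bigr do rewrite mulrCA mulrBr.
rewrite -mulr_sumr; congr (_ * _).
by rewrite big_split/= sumrN -mulr_suml expr2.
Qed.

Lemma chi_square_integral_moment_bounded :
  moment_bounded P (fun n w => chi_square_integral n (eta w)).
Proof.
have -> : (fun n w => chi_square_integral n (eta w)) =
    (fun n w => \sum_(k < d) (S n k w ^+ 2 - V n k w)).
  by apply/funext => n; apply/funext => w; exact: Q_sum.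
apply: moment_bounded_sum => k.
apply: (@moment_boundedB _ _ _ P nat (fun n w => S n k w ^+ 2) (fun n w => V n k w)).
  by apply: moment_boundedX; exact: (moment_bounded_comp (fun n => (n, k)) bS).
exact: (moment_bounded_comp (fun n => (n, k)) bV).
Qed.

Let bW1 j p : moment_bounded P (fun _ : unit => (fun w => W j w ^+ p)).
Proof. by apply: moment_boundedX; exact: (moment_bounded_comp (fun=> j) bW). Qed.

Let bcst (c : R) : moment_bounded P (fun (_ : unit) (_ : O) => c).
Proof. exact: (moment_bounded_cst P (c := fun=> c) (fun=> lexx _)). Qed.

Let int F : moment_bounded P (fun _ : unit => F) -> P.-integrable setT (EFin \o F).
Proof. exact: (moment_bounded_integrable tt). Qed.

Let W_second_moment j : \int[P]_w (W j w ^+ 2) = 1.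
Proof.
exact: (standardized_second_moment (lam := fun _ : nat => 1) (fun=> lexx 1) poissonW).
Qed.

Let W_uncorrelated i j : i != j -> \int[P]_w (W i w ^+ 2 * W j w ^+ 2) = 1.
Proof.
move=> ij; pose a (b : 'I_2) := if b == ord0 then i else j.
have ta : trivIset setT (fun b => U (a b)).
  move=> b b' _ _ [x [xb xb']]; have := tU I I (ex_intro _ x (conj xb xb')).
  rewrite /a; case: (eqVneq b ord0) => [->|b0]; case: (eqVneq b' ord0) => [->|b'0] //.
  - by move=> E; rewrite E eqxx in ij.
  - by move=> E; rewrite E eqxx in ij.
  - move=> _; apply: val_inj; move: b b' b0 b'0 {xb xb'}.
    by case=> [[|[|//]] ?] // [[|[|//]] ?].
pose f (_ : 'I_2) (x : R) := ((x - 1) / Num.sqrt 1) ^+ 2.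
have fW b w : f b (fine (pm_measure (eta w) (U (a b)))) = W (a b) w ^+ 2 by [].
have [_ _ ind] := eta_poisson.
have := @independent_expectation_prod _ _ _ P 2 (fun=> 1)
  (fun b w => pm_measure (eta w) (U (a b))) (fun=> ltr01) (fun b => poissonW (a b))
  (ind _ _ (fun b => mU (a b)) ta) f.
have f0 b x : 0 <= f b x by exact: sqr_ge0.
have mf b : measurable_fun setT (f b).
  apply: measurable_funX; apply: measurable_funM => //; exact: measurable_funB.
have intf b : P.-integrable setT (EFin \o (fun w => f b (fine (pm_measure (eta w) (U (a b)))))).
  exact: (int (bW1 (a b) 2)).
move=> /(_ f0 mf intf); under eq_integral do rewrite 2!big_ord_recl big_ord0 mulr1 !fW.
rewrite 2!big_ord_recl big_ord0 mulr1.
under [in RHS]eq_Rintegral do rewrite fW.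
under [X in _ = (_ * X)%:E]eq_Rintegral do rewrite fW.
by rewrite !W_second_moment mulr1 /Rintegral => ->.
Qed.

(* The centred squares are orthogonal, so that their average is small in mean
   square: a law of large numbers. *)
Let D n w := \sum_(k < d) (1 - V n k w).

Let D_small : exists C, forall n, \int[P]_w (D n w ^+ 2) <= C / n.+1%:R.
Proof.
pose Z j w := 1 - W j w ^+ 2.
have bZ : moment_bounded P Z.
  apply: moment_boundedB; last exact: moment_boundedX.
  exact: (moment_bounded_cst P (c := fun=> 1) (fun=> lexx _)).
have bZ1 j : moment_bounded P (fun _ : unit => Z j).
  exact: (moment_bounded_comp (fun=> j) bZ).
have [C HC] := moment_bounded_Rintegral 2 bZ.
have ZZ i j : i != j -> \int[P]_w (Z i w * Z j w) = 0.
  move=> ij.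
  have -> : \int[P]_w (Z i w * Z j w) =
      \int[P]_w (1 - W i w ^+ 2 - W j w ^+ 2 + W i w ^+ 2 * W j w ^+ 2).
    by apply: eq_Rintegral => w _; rewrite /Z; ring.
  have b2 := moment_boundedM (bW1 i 2) (bW1 j 2).
  have b1 := moment_boundedB (bcst 1) (bW1 i 2).
  rewrite RintegralD//; last 2 first.
    by apply: int; exact: moment_boundedB.
    exact: int.
  rewrite RintegralB//; [|exact: int..].
  rewrite RintegralB//; [|exact: int..].
  rewrite Rintegral_cst//= probability_setT mul1r.
  by rewrite !W_second_moment W_uncorrelated//=; ring.
exists (d%:R * C) => n.
pose a (x : 'I_d * 'I_n.+1) := (x.1 + d * x.2)%N.
have ainj : injective a.
  by move=> [k i] [k' i'] /(cell_inj d0)/= [-> /val_inj ->].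
have DZ w : D n w ^+ 2 = n.+1%:R ^- 2 * \sum_x \sum_y Z (a x) w * Z (a y) w.
  have -> : D n w = n.+1%:R^-1 * \sum_x Z (a x) w.
    transitivity (n.+1%:R^-1 * \sum_k \sum_i Z (a (k, i)) w); last first.
      by congr (_ * _); rewrite pair_bigA/=; apply: eq_bigr => -[].
    rewrite mulr_sumr; apply: eq_bigr => k _.
    rewrite /V big_split/= sumr_const card_ord sumrN mulrBr.
    by rewrite mulVf ?gt_eqF// [_^-1 * _]mulrC.
  rewrite exprMn exprVn; congr (_ * _).
  by rewrite expr2 mulr_suml; apply: eq_bigr => x _; rewrite mulr_sumr.
have bxy x y : moment_bounded P (fun _ : unit => (fun w => Z (a x) w * Z (a y) w)).
  exact: moment_boundedM.
have isum x : P.-integrable setT (EFin \o (fun w => \sum_y Z (a x) w * Z (a y) w)).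
  have -> : EFin \o (fun w => \sum_y Z (a x) w * Z (a y) w) =
      (fun w => \sum_y (Z (a x) w * Z (a y) w)%:E)%E.
    by apply/funext => w; rewrite /= sumEFin.
  by apply: integrable_sum => // y _; exact: int.
have isum2 : P.-integrable setT (EFin \o (fun w => \sum_x \sum_y Z (a x) w * Z (a y) w)).
  have -> : EFin \o (fun w => \sum_x \sum_y Z (a x) w * Z (a y) w) =
      (fun w => \sum_x (\sum_y Z (a x) w * Z (a y) w)%:E)%E.
    by apply/funext => w; rewrite /= sumEFin.
  by apply: integrable_sum => // x _; exact: isum.
under eq_Rintegral do rewrite DZ.
rewrite RintegralZl// Rintegral_sum//.
have -> : \sum_x \int[P]_w (\sum_y Z (a x) w * Z (a y) w) =
    \sum_x \int[P]_w (`|Z (a x) w| ^+ 2).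
  apply: eq_bigr => x _; rewrite Rintegral_sum => [|y]; last exact: int.
  rewrite (bigD1 x)//= big1 ?addr0 => [|y yx]; last first.
    by rewrite ZZ// (inj_eq ainj) eq_sym.
  by apply: eq_Rintegral => w _; rewrite real_normK ?num_real// expr2.
apply: (@le_trans _ _ (n.+1%:R ^- 2 * \sum_(x : 'I_d * 'I_n.+1) C)).
  by rewrite ler_wpM2l ?invr_ge0 ?exprn_ge0//; apply: ler_sum => x _; exact: HC.
rewrite sumr_const card_prod !card_ord -[C *+ _]mulr_natr natrM.
by rewrite le_eqVlt; apply/orP; left; apply/eqP; field; rewrite gt_eqF.
Qed.

Let lap n j t := laplace_sq P (fun i : nat * 'I_d => i.1.+1%:R)
  (fun i => block_count eta U i.1 i.2) (n, j) t.

Let sqrt_inv_small (C e : R) : 0 < e ->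
  \forall n \near \oo, C / Num.sqrt (n.+1%:R : R) <= e.
Proof.
move=> e0; near=> n; rewrite ler_pdivrMr// mulrC -ler_pdivrMr//.
apply: (le_trans (ler_norm _)); rewrite -sqrtr_sqr ler_wsqrtr// ltW//.
rewrite -natr1 ltr_pwDr// ltW//.
by near: n; exact: nbhs_infty_gtr.
Unshelve. all: by end_near. Qed.

Let lap_cvg j t : 0 <= t ->
  lap n j t @[n --> \oo] --> Num.sqrt ((1 + 2 * t)^-1).
Proof.
rewrite le_eqVlt => /orP[/eqP <-|t0].
  rewrite mulr0 addr0 invr1 sqrtr1 (_ : (fun n => _) = fun=> 1).
    exact: cvg_cst.
  apply/funext => n; rewrite /lap /laplace_sq.
  under eq_Rintegral do rewrite mul0r oppr0 expR0.
  by rewrite Rintegral_cst//= probability_setT mul1r.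
have t10 : 0 < 1 + 2 * t by rewrite addr_gt0 ?mulr_gt0.
have lam1 (i : nat * 'I_d) : (1 : R) <= i.1.+1%:R by exact: n1.
have pY (i : nat * 'I_d) : poisson_variable P i.1.+1%:R (block_count eta U i.1 i.2).
  exact: poissonS.
have [C HC] := laplace_sq_limit lam1 pY t0.
have sq : lap n j t ^+ 2 @[n --> \oo] --> (1 + 2 * t)^-1.
  apply/cvgrPdist_le => e e0.
  have := sqrt_inv_small C (mulr_gt0 e0 t10); apply: filterS => n Hn.
  have /= := le_trans (HC (n, j)) Hn; rewrite -/(lap n j t) => H.
  rewrite -(ler_pM2r t10) -{2}(gtr0_norm t10) -normrM mulrBl mulVf ?gt_eqF//.
  by rewrite distrC mulrC.
have lap0 n : 0 <= lap n j t.
  by have [/andP[]] := laplace_sq_bounds lam1 pY (n, j) (ltW t0).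
rewrite (_ : (fun n => lap n j t) = (fun n => Num.sqrt (lap n j t ^+ 2))).
  by apply: continuous_cvg sq; exact: sqrt_continuous.
by apply/funext => n; rewrite sqrtr_sqr ger0_norm.
Qed.

Let Y n w := \sum_(j < d) S n j w ^+ 2.

Let Y_laplace_prod n t : 0 <= t ->
  \int[P]_w expR (- (t * Y n w)) = \prod_(j < d) lap n j t.
Proof.
move=> t0.
pose f (_ : 'I_d) (x : R) := expR (- (t * ((x - n.+1%:R) / Num.sqrt n.+1%:R) ^+ 2)).
have f0 j x : 0 <= f j x by exact: expR_ge0.
have mf j : measurable_fun setT (f j).
  apply: measurableT_comp => //; apply: measurableT_comp => //.
  apply: measurable_funM => //; apply: measurable_funX.
  by apply: measurable_funM => //; exact: measurable_funB.
have mY (j : 'I_d) : measurable_fun setT (fun w => fine (block_count eta U n j w)).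
  by have [mb _ _] := poissonS n j; exact: measurableT_comp.
have intf (j : 'I_d) : P.-integrable setT (EFin \o (fun w => f j (fine (block_count eta U n j w)))).
  apply: (@bounded_integrable _ _ _ P _ 1) => [|w]; first exact: measurableT_comp.
  by rewrite ger0_norm ?f0// /f -[leRHS]expR0 ler_expR oppr_le0 mulr_ge0 ?sqr_ge0.
have := @independent_expectation_prod _ _ _ P d (fun=> n.+1%:R)
  (fun j => block_count eta U n j) (fun=> n0 n) (fun j => poissonS n j)
  (@independent_block_count _ _ _ _ _ _ _ _ eta_poisson _ mU muU tU _ d0 n) f f0 mf intf.
rewrite /Rintegral => H.
rewrite [X in fine X = _](_ : _ = (\int[P]_w
    (\prod_(i < d) f i (fine (block_count eta U n i w)))%:E)%E); first by rewrite H.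
apply: eq_integral => w _; congr EFin; rewrite /Y mulr_sumr -sumrN.
rewrite -[LHS]/(expR _); elim/big_rec2 : _ => [|j a b _ <-]; first by rewrite expR0.
by rewrite expRD.
Qed.

Let Y_laplace t : 0 <= t ->
  \int[P]_w expR (- (t * Y n w)) @[n --> \oo] --> (1 + 2 * t) `^ (- (d%:R / 2)).
Proof.
move=> t0; rewrite (_ : (fun n => _) = (fun n => \prod_(j < d) lap n j t)); last first.
  by apply/funext => n; exact: Y_laplace_prod.
have t10 : 0 < 1 + 2 * t by rewrite ltr_wpDr ?mulr_ge0.
have -> : (1 + 2 * t) `^ (- (d%:R / 2)) = \prod_(j < d) Num.sqrt ((1 + 2 * t)^-1).
  rewrite prodr_const card_ord -powR12_sqrt ?invr_ge0 ?(ltW t10)//.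
  rewrite -powR_mulrn ?powR_ge0// -powRrM -(powR_inv1 (ltW t10)) -powRrM.
  by congr (_ `^ _); rewrite mulN1r mulrC.
apply: cvg_big => [xy|j _]; [exact: mul_continuous|exact: lap_cvg].
Qed.

Let mS n k : measurable_fun setT (S n k).
Proof. by have [/(_ (n, k))] := bS. Qed.

Let bD n : moment_bounded P (fun _ : unit => D n).
Proof.
apply: moment_bounded_sum => k; apply: moment_boundedB => //.
exact: (moment_bounded_comp (fun=> (n, k)) bV).
Qed.

(** The integral is [Y + D - d], where the transform of [Y] is a product over the
    independent blocks and [D] is negligible. *)
Lemma chi_square_integral_cvg dX (OX : measurableType dX) (PX : probability OX R)
    (X : {RV PX >-> R}) (h : R -> R) M :
  gamma_distributed (d%:R / 2) X -> continuous h -> (forall x, `|h x| <= M) ->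
  \int[P]_w h (chi_square_integral n (eta w)) @[n --> \oo] -->
  \int[PX]_w h (2 * X w - d%:R).
Proof.
move=> gX ch hM.
have mA : measurable_fun setT (fun w => 2 * Num.max (X w) 0).
  by apply: measurable_funM => //; exact: measurable_maxr.
have -> : \int[PX]_w h (2 * X w - d%:R) = \int[PX]_w h (2 * Num.max (X w) 0 - d%:R).
  congr fine; apply: ae_eq_integral => //.
  - apply/measurable_EFinP; apply: measurableT_comp; first exact: continuous_measurable_fun.
    by apply: measurable_funB => //; exact: measurable_funM.
  - apply/measurable_EFinP; apply: measurableT_comp; first exact: continuous_measurable_fun.
    exact: measurable_funB.
  - exists (X @^-1` `]-oo, 0]); split.
    + by rewrite -[X in measurable X]setTI; exact: measurable_funP.
    + suff : distribution PX X `]-oo, 0] = 0%E by [].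
      rewrite gX//; apply: integral0_eq => x; rewrite /= in_itv/= => x0.
      by rewrite /gamma_pdf ltNge x0.
    + move=> w; apply: contra_notP => /= /negP; rewrite in_itv/= -ltNge => Xw _.
      by rewrite max_l ?ltW.
have -> : (fun n => \int[P]_w h (chi_square_integral n (eta w))) =
    (fun n => \int[P]_w h (Y n w + D n w - d%:R)).
  apply/funext => n; apply: eq_Rintegral => w _; congr h; rewrite Q_sum /Y /D.
  rewrite !big_split/= !sumrN sumr_const card_ord; ring.
apply: (@laplace_cvg_perturbed _ _ _ _ _ P PX Y D (fun w => 2 * Num.max (X w) 0)
   _ _ mA _ _ _ _ _ (fun x => h (x - d%:R)) M).
- by move=> n; apply: measurable_sum => j; apply: measurable_funX.
- by move=> n; have [/(_ tt)] := bD n.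
- by move=> n w; apply: sumr_ge0 => j _; exact: sqr_ge0.
- by move=> w; rewrite mulr_ge0// le_max lexx orbT.
- by move=> n; apply: int; exact: moment_boundedX.
- have [C HC] := D_small; apply/cvgrPdist_le => e e0; near=> n.
  rewrite sub0r normrN ger0_norm; last by apply: Rintegral_ge0 => w _; exact: sqr_ge0.
  apply: (le_trans (HC n)); rewrite ler_pdivrMr// mulrC -ler_pdivrMr// ltW//.
  rewrite -natr1 ltr_pwDr// ltW//.
  by near: n; exact: nbhs_infty_gtr.
- move=> k.
  have -> : \int[PX]_w expR (- (k%:R * (2 * Num.max (X w) 0))) =
      (1 + 2 * k%:R) `^ (- (d%:R / 2)).
    rewrite -(gamma_laplace (mulr_ge0 (ler0n R 2) (ler0n R k)) gX).
    by apply: eq_Rintegral => w _; congr (expR (- _)); ring.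
  exact: Y_laplace.
- move=> x; apply: (@continuous_comp _ _ _ (fun y : R => y - d%:R) h); last exact: ch.
  by apply: cvgB; [exact: cvg_id|exact: cvg_cst].
- by move=> x; exact: hM.
Unshelve. all: by end_near. Qed.

Let I n : finType := ('I_d * 'I_n.+1)%type.
Let cellI n (x : I n) := cell U x.1 x.2.
Let grad n (x : I n) w := block_gradient mu U x (eta w).

Let mcellI n (x : I n) : measurable (cellI x).
Proof. exact: mU. Qed.

Let mgrad n (x : I n) : measurable_fun setT (grad x).
Proof.
apply: measurable_funM; first apply: measurable_funM => //.
  have mc := measurable_eta eta (mcellI x).
  apply: measurable_funB; apply: measurableT_comp => //.
  by apply: emeasurable_funD => //; exact: measurable_cst.
apply: measurable_sum => y; apply: measurable_funM => //.
have my := measurable_eta eta (mcellI y).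
by apply: measurable_funB => //; exact: measurableT_comp.
Qed.

Let sum_cells n (z : T) (u : I n -> R) :
  `|\sum_x \1_(cellI x) z * u x| ^+ 4 = \sum_x \1_(cellI x) z * `|u x| ^+ 4.
Proof.
have [[x0 x0z]|nz] := pselect (exists x0 : I n, cellI x0 z); last first.
  have z0 (x : I n) : \1_(cellI x) z = 0 :> R.
    by rewrite indicE memNset// => xz; apply: nz; exists x.
  rewrite !big1 ?normr0 ?expr0n// => x _; by rewrite z0 mul0r.
have zx (x : I n) : \1_(cellI x) z = (x == x0)%:R :> R.
  rewrite indicE; have [->|/eqP xx0] := eqVneq x x0; first by rewrite mem_set.
  rewrite memNset// => xz; apply: xx0.
  have [Ek Ei] := cell_disjoint tU d0 xz x0z.
  by case: x x0 Ek Ei {x0z xz} => [k i] [k' i'] /= -> /val_inj ->.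
have pick (v : I n -> R) : \sum_x \1_(cellI x) z * v x = v x0.
  rewrite (bigD1 x0)//= zx eqxx mul1r big1 ?addr0// => x xx0.
  by rewrite zx (negbTE xx0) mul0r.
by rewrite !pick.
Qed.

(* On a cell, the gradient is [2 / sqrt n] times the normalized sum over the other
   cells of the block, whose fourth moment is bounded. *)
Let grad_moment : exists C : R, forall n (x : I n),
  (\int[P]_w (`|grad x w| ^+ 4)%:E <= (C / n.+1%:R ^+ 2)%:E)%E.
Proof.
have bF : moment_bounded P (fun (i : nat * 'I_d * nat) w =>
    S i.1.1 i.1.2 w - (Num.sqrt i.1.1.+1%:R)^-1 * W i.2 w).
  apply: moment_boundedB.
    exact: (moment_bounded_comp (fun i : nat * 'I_d * nat => i.1) bS).
  apply: (@moment_boundedZ _ _ _ P (nat * 'I_d * nat)%type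
    (fun i w => W i.2 w) (fun i => (Num.sqrt i.1.1.+1%:R)^-1) 1).
    move=> i; rewrite ger0_norm ?invr_ge0// invf_le1//.
    by rewrite -[leLHS]sqrtr1 ler_wsqrtr.
  exact: (moment_bounded_comp (fun i : nat * 'I_d * nat => i.2) bW).
have [_ /(_ 4%N)[C HC]] := bF; exists (16 * C) => n x.
pose c : R := 2 / Num.sqrt n.+1%:R.
pose F w := S n x.1 w - (Num.sqrt n.+1%:R)^-1 * W (x.1 + d * x.2)%N w.
have mF : measurable_fun setT F by exact: (bF.1 (n, x.1, (x.1 + d * x.2)%N)).
have gradE w : `|grad x w| <= c * `|F w|.
  have -> : grad x w = count_increment (eta w (cellI x)) * (c * F w).
    rewrite /grad /block_gradient -mulrA mulrCA; congr (_ * _).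
    rewrite (sum_block_coef x (fun y => compensated mu (eta w) (cell U y.1 y.2)))/=.
    rewrite /F S_sum /cell W_compensated.
    under eq_bigr do rewrite W_compensated.
    have -> : (n.+1%:R)^-1 = (Num.sqrt n.+1%:R)^-1 * (Num.sqrt n.+1%:R)^-1 :> R.
      by rewrite -invfM -expr2 sqr_sqrtr ?ltW.
    by rewrite /c; ring.
  rewrite normrM normrM (ger0_norm (x := c)) ?divr_ge0 ?(ltW (sqrt0 n))//.
  by rewrite ler_piMl ?mulr_ge0 ?divr_ge0 ?(ltW (sqrt0 n))// count_increment_le1.
apply: (@le_trans _ _ (\int[P]_w ((c ^+ 4)%:E * (`|F w| ^+ 4)%:E))%E).
  apply: ge0_le_integral => //.
  - exact: measurable_norm_exp.
  - by apply: emeasurable_funM; [exact: measurable_cst|exact: measurable_norm_exp].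
  - move=> w _; rewrite -EFinM -exprMn lee_fin lerXn2r ?nnegrE//.
    by rewrite mulr_ge0// divr_ge0// ltW.
rewrite ge0_integralZl//; last 2 first.
- exact: measurable_norm_exp.
- by rewrite lee_fin exprn_ge0// divr_ge0// ltW.
have -> : c ^+ 4 = 16 / n.+1%:R ^+ 2.
  have -> : c ^+ 4 = 16 * (Num.sqrt n.+1%:R ^+ 2) ^- 2.
    by rewrite /c; field; rewrite gt_eqF.
  by rewrite sqr_sqrtr ?ltW.
have -> : 16 * C / n.+1%:R ^+ 2 = 16 / n.+1%:R ^+ 2 * C by rewrite mulrAC.
rewrite [in leRHS]EFinM lee_wpmul2l ?lee_fin ?divr_ge0 ?exprn_ge0//.
exact: (HC (n, x.1, (x.1 + d * x.2)%N)).
Qed.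

(** There are [d * n] cells of unit mass, and the fourth moment of the gradient is
    of order [1 / n ^ 2] on each of them. *)
Lemma J4_chi_square_integral_cvg0 :
  J4 P mu eta (chi_square_integral n) @[n --> \oo] --> 0%E.
Proof.
have [C HC] := grad_moment.
have J4E n : J4 P mu eta (chi_square_integral n) =
    (\sum_(x : I n) \int[P]_w (`|grad x w| ^+ 4)%:E)%E.
  have mg4 (x : I n) : measurable_fun setT (fun w => (`|grad x w| ^+ 4)%:E).
    exact: measurable_norm_exp.
  rewrite /J4; transitivity (\int[mu]_z \sum_(x : I n)
     ((\1_(cellI x) z)%:E * \int[P]_w (`|grad x w| ^+ 4)%:E))%E.
    apply: eq_integral => z _; rewrite unlock.
    transitivity (\int[P]_w \sum_(x : I n)
        ((\1_(cellI x) z)%:E * (`|grad x w| ^+ 4)%:E))%E.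
      apply: eq_integral => w _; rewrite add_one_cost_block_kernel sum_cells -sumEFin.
      by apply: eq_bigr => x _; rewrite EFinM.
    rewrite ge0_integral_sum//; last first.
      by move=> x; apply: emeasurable_funM => //; exact: measurable_cst.
    by apply: eq_bigr => x _; rewrite ge0_integralZl.
  have v0 (x : I n) : (0 <= \int[P]_w (`|grad x w| ^+ 4)%:E)%E by apply: integral_ge0.
  have mi (x : I n) : measurable_fun setT (fun z => (\1_(cellI x) z)%:E : \bar R).
    by apply/measurable_EFinP; exact: measurable_indic.
  rewrite ge0_integral_sum//; last 2 first.
  - by move=> x; apply: emeasurable_funM => //; exact: measurable_cst.
  - by move=> x z _; rewrite mule_ge0// lee_fin.
  apply: eq_bigr => x _; rewrite ge0_integralZr// integral_indic// setIT.
  rewrite -[RHS]mul1e; congr (_ * _)%E; exact: muU.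
apply: (@squeeze_cvge _ _ _ _ (fun=> 0%E) _ (fun n => (d%:R * C / n.+1%:R)%:E)).
- apply: nearW => n; rewrite J4E; apply/andP; split.
    by apply: sume_ge0 => x _; apply: integral_ge0.
  apply: (@le_trans _ _ (\sum_(x : I n) (C / n.+1%:R ^+ 2)%:E)%E).
    by apply: lee_sum => x _; exact: HC.
  rewrite sumEFin sumr_const card_prod !card_ord -[_ *+ _]mulr_natr natrM lee_fin.
  by rewrite le_eqVlt; apply/orP; left; apply/eqP; field; rewrite gt_eqF.
- exact: cvg_cst.
- apply: cvg_EFin; first exact: nearW.
  rewrite -[X in _ --> X](mulr0 (d%:R * C)); apply: cvgMr.
  exact: cvg_harmonic.
Qed.

End chi_square_moments.

(** * Convergence to the centred Gamma law *)

Lemma expectation_Rintegral d (O : measurableType d) (R : realType)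
    (P : probability O R) (f : O -> R) : P.-integrable setT (EFin \o f) ->
  'E_P[f] = (\int[P]_w f w)%R%:E.
Proof.
move=> intf; rewrite unlock /Rintegral fineK//.
exact: (integrable_fin_num measurableT intf).
Qed.

Unset Implicit Arguments.

Theorem proposition4p7 (R : realType)
    (dZ dO dX : measure_display)
    (Z : measurableType dZ) (O : measurableType dO) (OX : measurableType dX)
    (mu : {sigma_finite_measure set Z -> \bar R})
    (mu_atomless : atomless mu) (mu_infinite : mu [set: Z] = +oo)
    (P : probability O R) (eta : {mfun O >-> point_measure_space Z R})
    (eta_poisson : poisson_random_measure P mu eta)
    (d : nat) (d_ge1 : (1 <= d)%N)
    (PX : probability OX R) (X : {RV PX >-> R})
    (X_gamma : gamma_distributed (d%:R / 2)%R X) :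
  let Zd : OX -> R := fun w => (2 * X w - d%:R)%R in
  exists Q : nat -> {mfun point_measure_space Z R >-> R},
    [/\ forall n, chaos2 P mu eta (Q n \o eta),
        forall n (r : nat), (1 <= r)%N -> Q n \o eta \in Lfun P r%:R%:E,
        cvg_in_distribution P PX (fun n => Q n \o eta) Zd,
        J4 P mu eta (Q n) @[n --> \oo] --> 0
      & forall r : nat, (1 <= r)%N ->
          'E_P[fun w => (Q n (eta w) ^+ r)%R] @[n --> \oo]
            --> 'E_PX[fun w => (Zd w ^+ r)%R] ].
Proof.
move=> Zd.
have [U [mU muU tU]] := atomless_infinite_unit_sets mu_atomless
  (sigma_finiteT mu) mu_infinite.
pose q n := chi_square_integral mU muU tU d_ge1 n.
have mq n : measurable_fun setT (q n : point_measure_space Z R -> R).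
  exact: measurable_odk_integral.
pose Q n : {mfun point_measure_space Z R >-> R} :=
  HB.pack (q n : point_measure_space Z R -> R) (isMeasurableFun.Build _ _ _ _ _ (mq n)).
have bQ : moment_bounded P (fun n w => q n (eta w)).
  exact: chi_square_integral_moment_bounded.
have mZd : measurable_fun setT Zd.
  by apply: measurable_funB => //; exact: measurable_funM.
have cvQ (h : R -> R) M : continuous h -> (forall x, `|h x| <= M)%R ->
    (\int[P]_w h (q n (eta w)))%R @[n --> \oo] --> (\int[PX]_w h (Zd w))%R.
  exact: chi_square_integral_cvg.
have bZ : moment_bounded PX (fun _ : unit => Zd).
  exact: (limit_moment_bounded bQ mZd cvQ).
exists Q; split.
- move=> n; apply: chaos2_odk_integral.
  exact: (moment_bounded_Lfun n 2 bQ).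
- by move=> n r _; exact: (moment_bounded_Lfun n r bQ).
- move=> h ch [M hM]; have mh := continuous_measurable_fun ch.
  rewrite expectation_Rintegral; last first.
    apply: (@bounded_integrable _ _ _ PX _ M) => [|w]; last exact: hM.
    exact: measurableT_comp.
  rewrite (_ : (fun n => _) = (fun n => (\int[P]_w h (q n (eta w)))%R%:E)).
    apply: cvg_EFin; first exact: nearW.
    exact: cvQ ch hM.
  apply/funext => n /=; rewrite expectation_Rintegral//.
  apply: (@bounded_integrable _ _ _ P _ M) => [|w]; last exact: hM.
  apply: measurableT_comp => //.
  by have [+ _] := bQ; exact.
- exact: J4_chi_square_integral_cvg0.
- move=> r _; rewrite expectation_Rintegral; last first.
    exact: (moment_bounded_integrable tt (moment_boundedX r bZ)).
  rewrite (_ : (fun n => _) = (fun n => (\int[P]_w (q n (eta w) ^+ r))%R%:E)).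
    apply: cvg_EFin; first exact: nearW.
    exact: (cvg_moments bQ mZd cvQ).
  apply/funext => n; rewrite expectation_Rintegral//.
  exact: (moment_bounded_integrable n (moment_boundedX r bQ)).
Qed.
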